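(* Let $F$ be a self-similar fractal in $\mathbb R$ with spectral triple $(\mathcal A,\mathcal H,D)$, and let $d\in(0,1)$ be the Hausdorff dimension of $F$. Then $d$ is the unique exponent of singular traceability for $D^{-1}$, and the Hausdorff functional on the spectral triple gives rise to the $d$-dimensional Hausdorff measure on $F$ up to a multiplicative constant: for each Dixmier trace $\mathrm{Tr}_\omega$ there is a constant $c>0$ such that $$\mathrm{Tr}_\omega(f|D|^{-d})=c\int_Ff\,d\mathcal H^d\qquad\text{for all } f\in C(F).$$ In particular the commutative and noncommutative Hausdorff dimensions coincide, i.e. $d(\mathcal A,\mathcal H,D)=d$.
   Context: Limit fractal: let $a<b$ and, for each $n\ge1$, let $w_{n1},\dots,w_{np_n}$ be contracting similarities of $\mathbb R$ with dilation parameters $\lambda_{ni}\in(0,1)$ such that (1) $w_{ni}([a,b])\subset[a,b]$; (2) $w_{ni}([a,b])\cap w_{nj}([a,b])=\emptyset$ for $i\ne j$; (3) $\bigcup_iw_{ni}(\{a,b\})\supset\{a,b\}$. Put $w_n(\Omega)=\bigcup_{i=1}^{p_n}w_{ni}(\Omega)$ and $F=\bigcap_n w_1\circ\cdots\circ w_n([a,b])$. $F$ is self-similar if $p_n=p$ for all $n$ and the similarity parameters $\lambda_{ni}=\lambda_i$ do not depend on $n$. For a multi-index $\sigma$ of length $n$, $w_\sigma=w_{1\sigma(1)}\circ\cdots\circ w_{n\sigma(n)}$. Spectral triple: for a bounded interval $I$ let $\mathcal H(I)=\ell^2(\partial I)$, $D(I)=\frac1{|I|}\begin{pmatrix}0&1\\1&0\end{pmatrix}$.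 Let $I_1,I_2,\dots$ be the lacunae of $F$ (connected components of $[a,b]\setminus F$), $\mathcal H_\ell=\bigoplus_k\mathcal H(I_k)$, $D_\ell=\bigoplus_kD(I_k)$; let $\mathcal F_n=\{w_\sigma([a,b]):|\sigma|=n\}$ (with $\mathcal F_0=\{[a,b]\}$), $\mathcal H_f=\bigoplus_{n,\,I\in\mathcal F_n}\mathcal H(I)$, $D_f=\bigoplus_{n,\,I\in\mathcal F_n}D(I)$. Then $\mathcal H=\mathcal H_\ell\oplus\mathcal H_f$, $D=D_\ell\oplus D_f$, and $\mathcal A=\mathrm{Lip}(F)$; functions on $F$ act by pointwise multiplication. $\mathcal H^d$ denotes $d$-dimensional Hausdorff measure. A singular trace on $\mathcal B(\mathcal H)$ is a positive tracial weight $\tau:\mathcal B(\mathcal H)_+\to[0,\infty]$ vanishing on finite rank projections. $s>0$ is an exponent of singular traceability for $D^{-1}$ if some singular trace is finite and nonzero on $|D|^{-s}$. For a compact operator $x$, $\mu_n(x)$, $n\ge0$, are the eigenvalues of $|x|$ in non-increasing order with multiplicity, $\mu_x(t)=\mu_n(x)$ on $[n,n+1)$, $S_x^\uparrow(t)=\int_0^t\mu_x$. $\mathcal L^{1,\infty}$ (resp. $\mathcal L^{1,\infty}_0$) is the set of compact $x$ with $S_x^\uparrow(t)/\log t$ bounded (resp. tending to $0$) as $t\to\infty$. The Dixmier trace $\mathrm{Tr}_\omega$ is the singular trace with domain $\mathcal L^{1,\infty}$ given on positive elements by $\mathrm{Tr}_\omega(x)=\mathrm{Lim}_\omega(S_x^\uparrow(n)/\log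 n)$, with $\mathrm{Lim}_\omega$ a suitable (dilation invariant) generalized limit. The Hausdorff functional is $f\mapsto\mathrm{Tr}_\omega(f|D|^{-d})$. The noncommutative Hausdorff dimension is $d(\mathcal A,\mathcal H,D)=\inf\{\alpha>0:|D|^{-\alpha}\in\mathcal L^{1,\infty}_0\}=\sup\{\alpha>0:|D|^{-\alpha}\notin\mathcal L^{1,\infty}\}$. *)

(* Defs.v *)
From HB Require Import structures.
From mathcomp Require Import all_boot all_order all_algebra complex.
From mathcomp Require Import all_classical all_reals all_analysis.
From mathcomp Require Import ring.

Set Implicit Arguments.
Unset Strict Implicit.
Unset Printing Implicit Defensive.

Import Order.TTheory GRing.Theory Num.Theory numFieldNormedType.Exports.

Local Open Scope classical_set_scope.
Local Open Scope ring_scope.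
Local Open Scope complex_scope.

Section Hausdorff.
Context {R : realType}.
Implicit Types (s delta : R) (A U : set R).
Local Open Scope ereal_scope.

Definition diam U : \bar R :=
  ereal_sup [set (`|x.1 - x.2|%R)%:E | x in U `*` U].

(* The empty set has weight 0 for every exponent, including s = 0. *)
Definition hweight s U : \bar R := if U == set0 then 0 else diam U `^ s.

Definition hcover delta A : set (nat -> set R) :=
  [set U | (forall k, diam (U k) <= delta%:E) /\ A `<=` \bigcup_k U k].

Definition hausdorff_delta s delta A : \bar R :=
  ereal_inf [set \sum_(k <oo) hweight s (U k) | U in hcover delta A].

Definition hausdorff s A : \bar R :=
  ereal_sup [set hausdorff_delta s delta A | delta in [set x : R | 0 < x]%R].

Lemma hweight_ge0 s U : 0 <= hweight s U.
Proof. by rewrite /hweight; case: ifP => // _; exact: poweR_ge0. Qed.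

Lemma diam0 : diam set0 = -oo.
Proof.
by rewrite /diam (_ : [set _ | _ in _] = set0) ?ereal_sup0//;
  apply/seteqP; split=> [y [x []]|].
Qed.

Lemma hausdorff_delta_ge0 s delta A : 0 <= hausdorff_delta s delta A.
Proof.
apply: le_ereal_inf_tmp => _ [U _ <-].
by apply: nneseries_ge0 => k _ _; exact: hweight_ge0.
Qed.

Lemma hausdorff_delta0 s delta : hausdorff_delta s delta set0 = 0.
Proof.
apply/eqP; rewrite eq_le hausdorff_delta_ge0 andbT.
apply: ereal_inf_lbound; exists (fun=> set0).
  by split=> // k; rewrite diam0 leNye.
by rewrite eseries0// => k _ _; rewrite /hweight eqxx.
Qed.

Lemma le_hausdorff_delta s delta A B : A `<=` B ->
  hausdorff_delta s delta A <= hausdorff_delta s delta B.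
Proof.
move=> AB; apply: ereal_inf_le_tmp => _ [U [dU BU] <-].
by exists U => //; split=> //; exact: subset_trans BU.
Qed.

Lemma hausdorff_delta_sigma s delta :
  sigma_subadditive (hausdorff_delta s delta).
Proof.
move=> A; have [[i ioo]|] :=
    pselect (exists i, hausdorff_delta s delta (A i) = +oo).
  rewrite (eseries_pinfty _ _ ioo) ?leey// => n _.
  by rewrite -ltNye (lt_le_trans _ (hausdorff_delta_ge0 _ _ _)).
rewrite -forallNE => Aoo.
suff add2e (e : {posnum R}) : hausdorff_delta s delta (\bigcup_n A n) <=
    \sum_(i <oo) hausdorff_delta s delta (A i) + e%:num%:E.
  by apply/lee_addgt0Pr => _/posnumP[].
rewrite (le_trans _ (epsilon_trick _ _ _))//; last first.
  by move=> n; exact: hausdorff_delta_ge0.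
pose P n (B : nat -> set R) := hcover delta (A n) B /\
  \sum_(k <oo) hweight s (B k) <=
    hausdorff_delta s delta (A n) + (e%:num / (2 ^ n.+1)%:R)%:E.
have [G PG] : {G : nat -> nat -> set R & forall n, P n (G n)}.
  apply: (@choice _ _ P) => n; rewrite /P.
  have fn : hausdorff_delta s delta (A n) \is a fin_num.
    rewrite ge0_fin_numE ?hausdorff_delta_ge0// ltey; exact/eqP/Aoo.
  have en1 : (0 < e%:num / (2 ^ n.+1)%:R)%R by [].
  have [x [B cB <-] xS] := lb_ereal_inf_adherent en1 fn.
  by exists B; split => //; exact/ltW.
have wG_ge0 x : 0 <= (hweight s \o uncurry G) x by exact: hweight_ge0.
apply: (@le_trans _ _ (\esum_(i in setT) (hweight s \o uncurry G) i)).
  apply: ereal_inf_lbound => /=.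
  have /card_esym/ppcard_eqP[f] := card_nat2.
  exists (uncurry G \o f).
    split => [i|]; first by rewrite /=; case: (f i) => a b;
      have [[+ _] _] := PG a; exact.
    apply: (@subset_trans _ (\bigcup_n \bigcup_k G n k)) => [t [i _]|].
      by have [[_ AG] _] := PG i; move=> /AG[j _ ?]; exists i => //; exists j.
    move=> t [i _ [j _ Bijt]]; exists (f^-1%FUN (i, j)) => //=.
    by rewrite invK ?inE.
  rewrite -(esum_pred_image (hweight s \o uncurry G) _ xpredT)
    ?[fun=> _]set_true//.
  by rewrite image_eq.
rewrite (_ : esum _ _ = \sum_(i <oo) \sum_(j <oo) hweight s (G i j));
    last first.
  pose J : nat -> set (nat * nat) := fun i => [set (i, j) | j in setT].
  rewrite (_ : setT = \bigcup_k J k); last first.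
    by rewrite predeqE => -[a b]; split => // _; exists a => //; exists b.
  rewrite esum_bigcupT /=; last 2 first.
    - apply/trivIsetP => i j _ _ ij.
      rewrite predeqE => -[n m] /=; split => //= -[] [_] _ [<-{n} _].
      by move=> [m' _] [] /esym/eqP; rewrite (negbTE ij).
    - by move=> /= [n m]; exact: hweight_ge0.
  rewrite -(image_id [set: nat]) -fun_true esum_pred_image//; last first.
    by move=> n _; apply: esum_ge0 => *; exact: hweight_ge0.
  apply: eq_eseriesr => /= j _.
  rewrite -(esum_pred_image (hweight s \o uncurry G) (pair j) predT)//=;
    last by move=> ? ? _ _; exact: (@can_inj _ _ _ snd).
  by congr esum; rewrite predeqE => -[a b]; split; move=> [i _ <-]; exists i.
  by move=> n _; exact: hweight_ge0.
apply: lee_nneseries => n _; last exact: (PG n).2.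
by move=> _; apply: nneseries_ge0 => *; exact: hweight_ge0.
Qed.

Let hausdorff0 s : hausdorff s set0 = 0.
Proof.
apply/eqP; rewrite eq_le; apply/andP; split.
  by apply: ge_ereal_sup => _ [e _ <-]; rewrite hausdorff_delta0.
apply: le_trans (hausdorff_delta_ge0 s 1 set0) _.
by apply: ereal_sup_ubound; exists 1%R => //; exact: ltr01.
Qed.

Let hausdorff_ge0 s A : 0 <= hausdorff s A.
Proof.
apply: le_trans (hausdorff_delta_ge0 s 1 A) _.
by apply: ereal_sup_ubound; exists 1%R => //; exact: ltr01.
Qed.

Let le_hausdorff s : {homo hausdorff s : A B / A `<=` B >-> A <= B}.
Proof.
move=> A B AB; apply: ge_ereal_sup => _ [e e0 <-].
apply: le_trans (le_hausdorff_delta s e AB) _.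
by apply: ereal_sup_ubound; exists e.
Qed.

Let hausdorff_sigma s : sigma_subadditive (hausdorff s).
Proof.
move=> A; apply: ge_ereal_sup => _ [e e0 <-].
apply: le_trans (hausdorff_delta_sigma s e A) _.
apply: lee_nneseries => n _; first by move=> _; exact: hausdorff_delta_ge0.
by apply: ereal_sup_ubound; exists e.
Qed.

HB.instance Definition _ s := isOuterMeasure.Build R R (hausdorff s)
  (hausdorff0 s) (hausdorff_ge0 s) (@le_hausdorff s) (@hausdorff_sigma s).

Definition hausdorff_dim A : \bar R :=
  ereal_inf [set s%:E | s in [set s | (0 <= s)%R /\ hausdorff s A = 0]].

End Hausdorff.

Definition hausdorff_outer {R : realType} (s : R) :
  {outer_measure set R -> \bar R} := hausdorff s.

(* The measurable sets are the Caratheodory-measurable ones, which contain the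
   Borel sets since the Hausdorff outer measure is metric. *)
Definition hausdorff_measure {R : realType} (s : R) :
    {measure set (caratheodory_type (hausdorff_outer s)) -> \bar R} :=
  hausdorff_outer s : set (caratheodory_type (hausdorff_outer s)) -> \bar R.

Definition hausdorff_integral {R : realType} (s : R) (A : set R) (f : R -> R[i]) :
    R[i] :=
  (\int[hausdorff_measure s]_(x in A) complex.Re (f x)) +i*
  (\int[hausdorff_measure s]_(x in A) complex.Im (f x)).

Section Ell2.
Context {R : realType} {X : choiceType}.
Local Notation C := R[i].

Definition abs2 (z : C) : R := complex.Re z ^+ 2 + complex.Im z ^+ 2.

Definition sqnorm (xi : X -> C^o) : \bar R :=
  \esum_(x in [set: X]) (abs2 (xi x))%:E.

Definition sqsummable : {pred X -> C^o} :=
  [pred xi | `[< (sqnorm xi < +oo)%E >]].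

Lemma abs2_ge0 (z : C) : 0 <= abs2 z.
Proof. by rewrite addr_ge0 ?sqr_ge0. Qed.

Lemma abs2_combine (a z w : C) :
  abs2 (a * z + w) <= 2 * abs2 a * abs2 z + 2 * abs2 w.
Proof.
case: a => a1 a2; case: z => z1 z2; case: w => w1 w2; rewrite /abs2 /=.
rewrite -subr_ge0 (_ : _ - _ =
  (a1 * z1 - a2 * z2 - w1) ^+ 2 + (a1 * z2 + a2 * z1 - w2) ^+ 2).
  by rewrite addr_ge0 ?sqr_ge0.
by ring.
Qed.

Lemma sqsummable_submod : submod_closed sqsummable.
Proof.
split=> [|a xi eta].
  apply/asboolP; rewrite /sqnorm esum1// => x _ /=.
  by rewrite /abs2 /= expr0n /= addr0.
move=> /asboolP xiX /asboolP etaX; apply/asboolP.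
apply: (@le_lt_trans _ _
    ((2 * abs2 a)%:E * sqnorm xi + 2%:E * sqnorm eta)%E); last first.
  by rewrite lte_add_pinfty// lte_mul_pinfty// lee_fin ?mulr_ge0 ?abs2_ge0.
have c0 : 0 <= 2 * abs2 a by rewrite mulr_ge0 ?abs2_ge0.
apply: ge_ereal_sup => _ [F [finF _] <-].
apply: (@le_trans _ _ (\sum_(x \in F) ((2 * abs2 a)%:E * (abs2 (xi x))%:E +
    2%:E * (abs2 (eta x))%:E))%E).
  apply: lee_fsum => // x _.
  by rewrite -!EFinM -EFinD lee_fin; exact: abs2_combine.
rewrite fsbig_split//= -!ge0_mule_fsumr//; last 2 first.
  by move=> x; rewrite lee_fin abs2_ge0.
  by move=> x; rewrite lee_fin abs2_ge0.
by apply: leeD; apply: lee_wpmul2l; rewrite ?lee_fin//;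
  apply: ereal_sup_ubound; exists F.
Qed.

HB.instance Definition _ :=
  GRing.isSubmodClosed.Build C (X -> C^o) sqsummable sqsummable_submod.

Record ell2 := Ell2 { ell2_val :> X -> C^o ; _ : ell2_val \in sqsummable }.

HB.instance Definition _ := [isSub for ell2_val].
HB.instance Definition _ := [Choice of ell2 by <:].
HB.instance Definition _ := [SubChoice_isSubLmodule of ell2 by <:].

Definition norm2 (xi : ell2) : R := Num.sqrt (fine (sqnorm xi)).

(* Sum of an absolutely summable real family *)
Definition rsum (g : X -> R) : R :=
  fine (\esum_(x in [set: X]) (Num.max (g x) 0)%:E) -
  fine (\esum_(x in [set: X]) (Num.max (- g x) 0)%:E).

Definition inner (xi eta : ell2) : C :=
  rsum (fun x => complex.Re ((xi x)^* * eta x)) +i*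
  rsum (fun x => complex.Im ((xi x)^* * eta x)).

Implicit Types (T S A P : ell2 -> ell2) (V : set ell2).

Definition bounded_op T :=
  linear T /\ exists M : R, forall xi, norm2 (T xi) <= M * norm2 xi.

Definition compact_op T :=
  bounded_op T /\
  forall u : nat -> ell2, (exists M : R, forall n, norm2 (u n) <= M) ->
    exists phi : nat -> nat, {homo phi : m n / (m < n)%N} /\
    exists eta : ell2, norm2 (T (u (phi n)) - eta) @[n --> \oo] --> (0 : R).

Definition adjoint_op T S :=
  bounded_op S /\ forall xi eta, inner (T xi) eta = inner xi (S eta).

(* In the order of C, 0 <= z means that z is real and nonnegative. *)
Definition positive_op T := bounded_op T /\ forall xi, 0 <= inner xi (T xi).

Definition has_dim V (k : nat) := exists e : 'I_k -> ell2,
  (forall c : 'I_k -> C, \sum_i c i *: e i = 0 -> forall i, c i = 0) /\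
  V = [set xi | exists c : 'I_k -> C, xi = \sum_i c i *: e i].

Definition finite_rank_projection P :=
  [/\ bounded_op P, P \o P = P, adjoint_op P P & exists k, has_dim (range P) k].

(* A weight is a function on B(H)_+; the values of tau elsewhere are
   irrelevant. In the codomain 0 * +oo = 0. *)
Record singular_trace (tau : (ell2 -> ell2) -> \bar R) : Prop := {
  singular_trace_ge0 : forall T, positive_op T -> (0 <= tau T)%E ;
  singular_traceD : forall S T, positive_op S -> positive_op T ->
    tau (S \+ T) = (tau S + tau T)%E ;
  singular_traceZ : forall (c : R) T, 0 <= c -> positive_op T ->
    tau (fun xi => c%:C *: T xi) = (c%:E * tau T)%E ;
  singular_trace_tracial : forall T S, bounded_op T -> adjoint_op T S ->
    tau (S \o T) = tau (T \o S) ;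
  singular_trace_finite_rank : forall P, finite_rank_projection P ->
    tau P = 0%E
}.

(* A = |T|, the positive square root of T^* T *)
Definition is_abs_op T A :=
  positive_op A /\ exists2 S, adjoint_op T S & A \o A = S \o T.

(* The nonzero eigenvalues of |T|, in nonincreasing order and repeated
   according to multiplicity, followed by zeros if there are finitely many *)
Definition is_singular_values T (m : nat -> R) := exists2 A, is_abs_op T A &
  [/\ {homo m : i j / (i <= j)%N >-> j <= i},
      m n @[n --> \oo] --> (0 : R) &
      forall lam : R, 0 < lam -> exists k : nat,
        ([set n | m n = lam] #= `I_k)%card /\
        has_dim [set xi | A xi = lam%:C *: xi] k].

Definition mu_ T : nat -> R := xget (fun=> 0) (is_singular_values T).

Definition mu_fun T (t : R) : R := mu_ T (Num.truncn t).

Definition S_up T (t : R) : R := \int[lebesgue_measure]_(u in `[0, t]) mu_fun T u.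

Definition L1inf T := compact_op T /\
  exists M : R, \forall t \near +oo, `|S_up T t / ln t| <= M.

Definition L1inf0 T := compact_op T /\
  S_up T t / ln t @[t --> +oo] --> (0 : R).

Definition bounded_seq (u : nat -> R) := exists M : R, forall n, `|u n| <= M.

(* Invariance under the dilation (u_0, u_0, u_1, u_1, ...) is the one required
   by Dixmier and Connes; it suffices for additivity of the trace. *)
Record dilation_invariant_limit (Lim : (nat -> R) -> R) : Prop := {
  Lim_linear : forall (a : R) u v, bounded_seq u -> bounded_seq v ->
    Lim (fun n => a * u n + v n) = a * Lim u + Lim v ;
  Lim_ge0 : forall u, bounded_seq u -> (forall n, 0 <= u n) -> 0 <= Lim u ;
  Lim_cvg : forall u (l : R), u n @[n --> \oo] --> l -> Lim u = l ;
  Lim_dilation : forall u, bounded_seq u -> Lim (fun n => u n./2) = Lim u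
}.

Definition dixmier_pos (Lim : (nat -> R) -> R) T : R :=
  Lim (fun n => S_up T n%:R / ln n%:R).

(* Tr_omega(T) = z for an arbitrary T in the linear span of the positive part
   of its domain, computed from the positive and negative parts A1, A2 of the
   real part and A3, A4 of the imaginary part of T *)
Definition is_dixmier_trace Lim T (z : C) := exists A1 A2 A3 A4,
  [/\ [/\ positive_op A1, positive_op A2, positive_op A3 & positive_op A4],
      [/\ L1inf A1, L1inf A2, L1inf A3 & L1inf A4],
      A1 \o A2 = \0 /\ A3 \o A4 = \0,
      T = (fun xi => (A1 xi - A2 xi) + 'i *: (A3 xi - A4 xi)) &
      z = (dixmier_pos Lim A1 - dixmier_pos Lim A2) +i*
          (dixmier_pos Lim A3 - dixmier_pos Lim A4)].

(* D is given by its action on all families; its domain consists of the xi in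
   l^2(X) such that D xi is in l^2(X). *)
Implicit Type D : ell2 -> X -> C^o.

(* B = g(D): the eigenvectors of D are total, and B acts as g(lam) on the
   eigenspace of D for lam. This determines B. *)
Definition is_function_of D (g : R -> R) (B : ell2 -> ell2) :=
  [/\ bounded_op B,
      forall eta, (forall (lam : R) xi,
        D xi = lam%:C *: (xi : X -> C^o) -> inner xi eta = 0) -> eta = 0 &
      forall (lam : R) xi, D xi = lam%:C *: (xi : X -> C^o) ->
        B xi = (g lam)%:C *: xi].

(* |D|^-s *)
Definition abs_npow D (s : R) : ell2 -> ell2 :=
  xget (fun=> 0) (is_function_of D (fun lam => `|lam| `^ (- s))).

(* s is an exponent of singular traceability for D^-1 *)
Definition traceability_exponent D (s : R) :=
  0 < s /\ exists tau, singular_trace tau /\ (0 < tau (abs_npow D s) < +oo)%E.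

Definition is_nc_hausdorff_dim D (delta : R) :=
  ereal_inf [set s%:E | s in [set s | 0 < s /\ L1inf0 (abs_npow D s)]] = delta%:E
  /\
  ereal_sup [set s%:E | s in [set s | 0 < s /\ ~ L1inf (abs_npow D s)]] = delta%:E.

(* Pointwise multiplication by g; insubd covers the case where g xi is not
   square summable. *)
Definition mul_op (g : X -> C) (xi : ell2) : ell2 :=
  insubd (0 : ell2) ((fun x => g x * xi x) : X -> C^o).

End Ell2.

Arguments ell2 R X : clear implicits.

(* The levels are numbered from 0: lf_w 0 is the family w_1. *)
Record limit_fractal (R : realType) := LimitFractal {
  lf_a : R ;
  lf_b : R ;
  lf_p : nat -> nat ;
  lf_w : forall n, 'I_(lf_p n) -> R -> R ;
  lf_lam : forall n, 'I_(lf_p n) -> R ;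
  lf_ab : lf_a < lf_b ;
  lf_lam01 : forall n i, 0 < @lf_lam n i < 1 ;
  lf_sim : forall n i x y,
    `|@lf_w n i x - @lf_w n i y| = @lf_lam n i * `|x - y| ;
  lf_sub : forall n i, @lf_w n i @` `[lf_a, lf_b] `<=` `[lf_a, lf_b] ;
  lf_disj : forall n i j, i != j ->
    (@lf_w n i @` `[lf_a, lf_b]) `&` (@lf_w n j @` `[lf_a, lf_b]) = set0 ;
  lf_ends : forall n,
    [set lf_a; lf_b] `<=` \bigcup_i (@lf_w n i @` [set lf_a; lf_b])
}.

Arguments lf_w {R} K {n} i : rename.
Arguments lf_lam {R} K {n} i : rename.

Section Fractal.
Context {R : realType}.
Variable K : limit_fractal R.
Local Notation a := (lf_a K).
Local Notation b := (lf_b K).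
Local Notation p := (lf_p K).

Definition lf_step n (Omega : set R) : set R :=
  \bigcup_(i in [set: 'I_(p n)]) (lf_w K i @` Omega).

(* w_1 o ... o w_n *)
Fixpoint lf_iter n (Omega : set R) : set R :=
  if n is m.+1 then lf_iter m (lf_step m Omega) else Omega.

Definition fractal : set R := \bigcap_n lf_iter n `[a, b].

Definition self_similar := exists (q : nat) (l : 'I_q -> R),
  forall n, exists e : p n = q, forall i, lf_lam K i = l (cast_ord e i).

Definition lf_word n (sigma : forall k : 'I_n, 'I_(p k)) : R -> R :=
  \big[(fun f g : R -> R => f \o g)/idfun]_(k < n) lf_w K (sigma k).

Definition lacunae : set (set R) :=
  [set I | exists2 x, (`[a, b] `\` fractal) x &
           I = connected_component (`[a, b] `\` fractal) x].

(* The pairs (n, I) with I in F_n *)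
Definition cells : set (nat * set R) :=
  [set c | exists sigma : forall k : 'I_c.1, 'I_(p k),
           c.2 = lf_word sigma @` `[a, b]].

Definition piece : choiceType := (set_type lacunae + set_type cells)%type.

Definition itv_of (e : piece) : set R :=
  match e with inl J => val J | inr c => (val c).2 end.

Definition len (e : piece) : R := sup (itv_of e) - inf (itv_of e).

(* H is the Hilbert sum over all the pieces I of l^2(bd I); false and true stand
   for the left and the right endpoint of I. *)
Definition hilbert_index : choiceType := (piece * bool)%type.

Definition vertex (x : hilbert_index) : R :=
  if x.2 then sup (itv_of x.1) else inf (itv_of x.1).

Definition hilbert := ell2 R hilbert_index.

(* The direct sum of the blocks |I|^-1 [[0, 1], [1, 0]] *)
Definition dirac_op (xi : hilbert) : hilbert_index -> R[i]^o :=
  fun x => (len x.1)^-1%:C * xi (x.1, ~~ x.2).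

Definition rep_op (f : R -> R[i]) : hilbert -> hilbert := mul_op (f \o vertex).

End Fractal.

(* Main.v *)
(** On l^2(X) the operator |D|^-s is diagonal, with entry len^s on both endpoints of a piece of length len, and a
    singular trace applied to diagonal operators is a functional on nonnegative bounded weights which is additive,
    homogeneous, zero on finitely supported weights, and monotone along injections of X (conjugate by a weighted
    composition operator). Self-similarity multiplies the trace of len^s by r(s) = sum_i lambda_i^s, so it is 0 or
    infinite unless r(s) = 1, that is s = d. For s = d the number of pieces grows geometrically with the level, so the
    sum of the n largest entries is comparable to ln n and every Dixmier trace is finite and positive.

    For s = d, cells of the same level are exchanged by similarities, so the trace of len^d restricted to the pieces
    inside the cell of a word w is proportional to lambda_w^d; the Hausdorff measure of the cell scales in the same
    way. A continuous function is nearly constant on the cells of a high level, hence both functionals are squeezed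
    between the same step sums and are proportional.

    The Dixmier weight is Lim (sigma_n / ln n), where sigma_n T is the supremum of tr over orthonormal families of n
    vectors; it is subadditive, while sigma_n S + sigma_n T <= sigma_(2n) (S + T), so dilation invariance of Lim
    gives additivity. *)
Require Import Defs.
From mathcomp Require Import all_boot all_order all_algebra complex finmap.
From mathcomp Require Import all_classical all_reals all_analysis.
From mathcomp Require Import measurable_realfun ring lra.

Set Implicit Arguments.
Unset Strict Implicit.
Unset Printing Implicit Defensive.

Import Order.TTheory GRing.Theory Num.Theory numFieldNormedType.Exports.

Local Open Scope classical_set_scope.
Local Open Scope ring_scope.
Local Open Scope complex_scope.

(** Self-similarity fixes only the ratios; the maps may be placed differently at each level. This
    has two consequences. A cell is a copy of the fractal generated by the later levels, not of the
    whole fractal, so similarities are available only between cells of equal level; the scaling of a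
    cell is recovered by summing over a level, where the numbers [lam w] to the power d add up to 1.
    Moreover, the distance between sibling cells, relative to their size, has no positive lower
    bound common to all levels, so the usual separation argument for positivity of the Hausdorff
    measure breaks down; a packing argument on lengths replaces it, based on disjointness of
    siblings and on d <= 1. Singular values and powers of |D| are given as choices of an object with
    a specification, so each is computed by proving uniqueness. Lacunae are not indexed by words;
    each is charged to a cell of comparable length that starts at its right end, which bounds their
    number at each scale. *)

Lemma normr_max0 (R : realDomainType) (y : R) : `|Num.max y 0| <= `|y|.
Proof. by rewrite ger0_norm ?le_max ?lexx ?orbT// ge_max ler_norm normr_ge0. Qed.

(** * Sums of absolutely summable families *)

Section Rsum.
Context {R : realType} {X : choiceType}.
Implicit Types f g h : X -> R.

(** [rsum] subtracts two values of [fine], and [fine] sends an infinite sum to 0, so the algebraic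
    laws for [rsum] are stated under this hypothesis. *)
Definition abs_summable f := (\esum_(x in [set: X]) `|f x|%:E < +oo)%E.

Lemma abs_summable_le f g : (forall x, `|f x| <= `|g x|) ->
  abs_summable g -> abs_summable f.
Proof.
by move=> fg; apply: le_lt_trans; apply: le_esum => x _; rewrite lee_fin.
Qed.

Lemma abs_summableD f g : abs_summable f -> abs_summable g ->
  abs_summable (fun x => f x + g x).
Proof.
move=> sf sg; apply: le_lt_trans (lte_add_pinfty sf sg).
rewrite -esumD; [|by move=> x _; rewrite lee_fin..].
by apply: le_esum => x _; rewrite -EFinD lee_fin ler_normD.
Qed.

Lemma ge0_esumZ f (c : R) : 0 <= c -> (forall x, 0 <= f x) ->
  \esum_(x in [set: X]) (c * f x)%:E = (c%:E * \esum_(x in [set: X]) (f x)%:E)%E.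
Proof.
(* One inequality, for an arbitrary factor, comes from finite partial sums; used again with the
   inverse of [c] it gives the converse. *)
move=> c0 f0; have le (k : R) (h : X -> R) : 0 <= k -> (forall x, 0 <= h x) ->
    (\esum_(x in [set: X]) (k * h x)%:E <= k%:E * \esum_(x in [set: X]) (h x)%:E)%E.
  move=> k0 h0; apply: ge_ereal_sup => _ [F FX <-].
  rewrite (eq_fsbigr (fun x => (k%:E * (h x)%:E)%E)) -?ge0_mule_fsumr//.
  by apply: lee_wpmul2l; rewrite ?lee_fin//; apply: ereal_sup_ubound; exists F.
apply/eqP; rewrite eq_le le//=.
have [->|cn0] := eqVneq c 0.
  by rewrite mul0e; apply: esum_ge0 => x _; rewrite mul0r.
have c1 : 0 < c by rewrite lt_neqAle eq_sym cn0.
rewrite -lee_pdivlMl//; apply: le_trans (le c^-1 (fun x => c * f x) _ _).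
- by apply: le_esum => x _; rewrite mulKf.
- by rewrite invr_ge0.
- by move=> x; rewrite mulr_ge0.
Qed.

Lemma abs_summableZ (c : R) f : abs_summable f -> abs_summable (fun x => c * f x).
Proof.
move=> sf; rewrite /abs_summable.
under eq_esum do rewrite normrM.
by rewrite ge0_esumZ// lte_mul_pinfty// lee_fin.
Qed.

Lemma abs_summableN f : abs_summable f -> abs_summable (fun x => - f x).
Proof. by apply: abs_summable_le => x; rewrite normrN. Qed.

Let esum_fin f : (forall x, 0 <= f x) -> abs_summable f ->
  (\esum_(x in [set: X]) (f x)%:E)%E \is a fin_num.
Proof.
move=> f0 sf; rewrite ge0_fin_numE; last by apply: esum_ge0 => x _; rewrite lee_fin.
by apply: le_lt_trans sf; apply: le_esum => x _; rewrite lee_fin ger0_norm.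
Qed.

Definition psum f : R := fine (\esum_(x in [set: X]) (f x)%:E).

Lemma psumK f : (forall x, 0 <= f x) -> abs_summable f ->
  (psum f)%:E = (\esum_(x in [set: X]) (f x)%:E)%E.
Proof. by move=> f0 sf; rewrite /psum fineK//; exact: esum_fin. Qed.

(** Any decomposition into summable nonnegative functions computes [rsum], not only the one by
    positive and negative parts. Additivity and homogeneity thereby reduce to the same laws for
    [psum]. *)
Lemma rsumB f g : (forall x, 0 <= f x) -> (forall x, 0 <= g x) ->
  abs_summable f -> abs_summable g ->
  rsum (fun x => f x - g x) = psum f - psum g.
Proof.
move=> f0 g0 sf sg; apply: EFin_inj.
rewrite [RHS]EFinB !psumK// -esumB//; last 2 first.
  by move=> x _; rewrite lee_fin.
  by move=> x _; rewrite lee_fin.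
have sfg : abs_summable (fun x => f x - g x).
  by apply: abs_summableD => //; exact: abs_summableN.
have spos (h : X -> R) : abs_summable h -> abs_summable (fun x => Num.max (h x) 0).
  by apply: abs_summable_le => x; exact: normr_max0.
rewrite /rsum EFinB -[fine _]/(psum (fun x => Num.max (f x - g x) 0)).
rewrite -[fine _]/(psum (fun x => Num.max (- (f x - g x)) 0)) !psumK//.
idtac. - by congr (_ - _)%E; apply: eq_esum => x _; rewrite ?funeposE ?funenegE /= -?EFinB -?EFinN -EFin_max.
- by move=> x; rewrite le_max lexx orbT.
- by apply: (spos (fun x => - (f x - g x))); exact: abs_summableN.
- by move=> x; rewrite le_max lexx orbT.
- exact: (spos (fun x => f x - g x)).
Qed.

Let pos f x := Num.max (f x) 0.
Let neg f x := Num.max (- f x) 0.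

Let posneg f x : f x = pos f x - neg f x.
Proof.
by rewrite /pos /neg; case: (leP (f x) 0); case: (leP (- f x) 0);
  rewrite ?oppr_le0 ?oppr_gt0 ?sub0r ?subr0 ?opprK//;
  move=> f0 f1; apply/eqP; rewrite eq_le ?f0 ?f1 ?(ltW f1) ?(ltW f0)//; lra.
Qed.

Let pos_ge0 f x : 0 <= pos f x. Proof. by rewrite le_max lexx orbT. Qed.
Let neg_ge0 f x : 0 <= neg f x. Proof. by rewrite le_max lexx orbT. Qed.

Let spos f : abs_summable f -> abs_summable (pos f).
Proof. by apply: abs_summable_le => x; exact: normr_max0. Qed.

Let sneg f : abs_summable f -> abs_summable (neg f).
Proof.
by apply: abs_summable_le => x; rewrite -[leRHS]normrN; exact: normr_max0.
Qed.

Lemma psumD f g : (forall x, 0 <= f x) -> (forall x, 0 <= g x) ->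
  abs_summable f -> abs_summable g ->
  psum (fun x => f x + g x) = psum f + psum g.
Proof.
move=> f0 g0 sf sg; apply: EFin_inj; rewrite EFinD !psumK//.
- by rewrite -esumD// => x _; rewrite lee_fin.
- by move=> x; rewrite addr_ge0.
- exact: abs_summableD.
Qed.

Lemma psumZ (c : R) f : 0 <= c -> (forall x, 0 <= f x) -> abs_summable f ->
  psum (fun x => c * f x) = c * psum f.
Proof.
move=> c0 f0 sf; apply: EFin_inj; rewrite EFinM !psumK//.
- exact: ge0_esumZ.
- by move=> x; rewrite mulr_ge0.
- exact: abs_summableZ.
Qed.

Lemma eq_rsum f g : f =1 g -> rsum f = rsum g.
Proof. by move=> /funext ->. Qed.

Lemma rsumD f g : abs_summable f -> abs_summable g ->
  rsum (fun x => f x + g x) = rsum f + rsum g.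
Proof.
move=> sf sg.
rewrite (@eq_rsum _ (fun x => (pos f x + pos g x) - (neg f x + neg g x))); last first.
  by move=> x; rewrite {1}(posneg f) {1}(posneg g); ring.
rewrite rsumB; first last.
- by apply: abs_summableD; exact: sneg.
- by apply: abs_summableD; exact: spos.
- by move=> x; rewrite addr_ge0.
- by move=> x; rewrite addr_ge0.
rewrite !psumD//; try exact: spos; try exact: sneg.
rewrite (eq_rsum (posneg f)) (eq_rsum (posneg g)) !rsumB//; try exact: spos; try exact: sneg.
by ring.
Qed.

Lemma rsumZ (c : R) f : abs_summable f -> rsum (fun x => c * f x) = c * rsum f.
Proof.
move=> sf; rewrite [in RHS](eq_rsum (posneg f)) rsumB//; try exact: spos; try exact: sneg.
have [c0|c0] := leP 0 c.
  rewrite (@eq_rsum _ (fun x => c * pos f x - c * neg f x)); last first.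
    by move=> x; rewrite {1}(posneg f) mulrBr.
  rewrite rsumB//; try (by move=> x; rewrite mulr_ge0).
  - by rewrite !psumZ//; [ring|exact: sneg|exact: spos].
  - by apply: abs_summableZ; exact: spos.
  - by apply: abs_summableZ; exact: sneg.
have c1 : 0 <= - c by rewrite oppr_ge0 ltW.
rewrite (@eq_rsum _ (fun x => (- c) * neg f x - (- c) * pos f x)); last first.
  by move=> x; rewrite {1}(posneg f); ring.
rewrite rsumB//; try (by move=> x; rewrite mulr_ge0).
- by rewrite !psumZ//; [ring|exact: spos|exact: sneg].
- by apply: abs_summableZ; exact: sneg.
- by apply: abs_summableZ; exact: spos.
Qed.

Lemma rsumN f : abs_summable f -> rsum (fun x => - f x) = - rsum f.
Proof.
by move=> sf; rewrite -mulN1r -rsumZ//; apply: eq_rsum => x; rewrite mulN1r.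
Qed.

Lemma rsum_psum f : (forall x, 0 <= f x) -> abs_summable f -> rsum f = psum f.
Proof.
move=> f0 sf; rewrite (@eq_rsum _ (fun x => f x - 0)); last by move=> x; rewrite subr0.
have s0 : abs_summable (fun=> 0 : R).
  by rewrite /abs_summable esum1 ?ltry// => x _; rewrite normr0.
by rewrite rsumB// [psum (fun=> 0)]/psum esum1//= subr0.
Qed.

Lemma psum_ge0 f : (forall x, 0 <= f x) -> 0 <= psum f.
Proof. by move=> f0; apply: fine_ge0; apply: esum_ge0 => x _; rewrite lee_fin. Qed.

Lemma le_psum f g : (forall x, 0 <= f x) -> (forall x, f x <= g x) ->
  abs_summable g -> psum f <= psum g.
Proof.
move=> f0 fg sg.
have g0 x : 0 <= g x by apply: le_trans (fg x).
have sf : abs_summable f.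
  by apply: abs_summable_le sg => x; rewrite !ger0_norm.
by rewrite -lee_fin !psumK//; apply: le_esum => x _; rewrite lee_fin.
Qed.

Lemma psum_ge f x : (forall x, 0 <= f x) -> abs_summable f -> f x <= psum f.
Proof.
move=> f0 sf; rewrite -lee_fin psumK//; apply: esum_ge.
by exists [set x]; [split|rewrite fsbig_set1].
Qed.

Lemma psum_sum (I : Type) (s : seq I) (f : I -> X -> R) :
  (forall i x, 0 <= f i x) -> (forall i, abs_summable (f i)) ->
  abs_summable (fun x => \sum_(i <- s) f i x) /\
  psum (fun x => \sum_(i <- s) f i x) = \sum_(i <- s) psum (f i).
Proof.
move=> f0 sf; elim: s => [|i s [s1 IH]].
  rewrite big_nil; split.
    by rewrite /abs_summable esum1 ?ltry// => x _; rewrite big_nil normr0.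
  by rewrite /psum esum1//= => x _; rewrite big_nil.
rewrite big_cons -IH -psumD//.
  split; first by under eq_fun do rewrite big_cons; exact: abs_summableD.
  by congr psum; apply/funext => x; rewrite big_cons.
by move=> x; exact: sumr_ge0.
Qed.

(* Only the terms in [F] can exceed the average bound [M], which is charged to the total weight of [w]. *)
Lemma psumM_le (t w : X -> R) (F : seq X) (M N : R) : uniq F ->
  (forall x, 0 <= t x) -> (forall x, 0 <= w x) -> (forall x, w x <= 1) -> 0 <= M ->
  (forall x, x \notin F -> t x <= M) ->
  abs_summable w -> psum w <= N ->
  psum (fun x => t x * w x) <= \sum_(x <- F) Num.max (t x - M) 0 + N * M.
Proof.
move=> uF t0 w0 w1 M0 tM sw wN.
pose u x := if x \in F then Num.max (t x - M) 0 else 0.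
have u0 x : 0 <= u x by rewrite /u; case: ifP; rewrite // le_max lexx orbT.
have su : abs_summable u /\ psum u <= \sum_(x <- F) Num.max (t x - M) 0.
  pose v (i x : X) : R := if x == i then Num.max (t i - M) 0 else 0.
  have v0 i x : 0 <= v i x by rewrite /v; case: ifP; rewrite // le_max lexx orbT.
  have ev i : (\esum_(x in [set: X]) (v i x)%:E = (v i i)%:E)%E.
    rewrite (esumID [set i])//; last by move=> x _; rewrite lee_fin.
    rewrite setTI esum_set1 ?lee_fin// [X in (_ + X)%E]esum1 ?adde0//.
    by move=> x [_ /eqP/negbTE] /=; rewrite /v => ->.
  have sv i : abs_summable (v i).
    rewrite /abs_summable; under eq_esum do rewrite ger0_norm//.
    by rewrite ev ltry.
  have [s1 s2] := psum_sum F v0 sv.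
  have uE x : u x = \sum_(i <- F) v i x.
    rewrite /u /v; case: ifPn => xF.
      rewrite (bigD1_seq x)//= eqxx big1 ?addr0// => i.
      by rewrite eq_sym => /negbTE ->.
    rewrite big_seq_cond big1// => i /andP[iF _].
    by case: eqP => // xi; rewrite xi iF in xF.
  rewrite (funext uE); split => //.
  rewrite s2; apply: ler_sum => i _.
  by rewrite /psum ev /= /v eqxx.
have [su1 su2] := su.
have sMw : abs_summable (fun x => M * w x) by exact: abs_summableZ.
apply: (@le_trans _ _ (psum (fun x => u x + M * w x))).
  apply: le_psum.
  - by move=> x; rewrite mulr_ge0.
  - move=> x; rewrite /u; case: ifPn => [xF|/tM tx].
      rewrite -lerBlDr -mulrBl.
      have [h|h] := leP (t x - M) 0.
        by rewrite mulr_le0_ge0.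
      by rewrite ler_piMr// ltW.
    by rewrite add0r ler_wpM2r.
  - exact: abs_summableD.
rewrite psumD//; last by move=> x; rewrite mulr_ge0.
rewrite psumZ// lerD// mulrC ler_wpM2r//.
Qed.

End Rsum.

(** * The Hilbert space of square summable families *)

Section Inner.
Context {R : realType} {X : choiceType}.
Local Notation C := R[i].
Local Notation H := (ell2 R X).
Implicit Types (xi eta zeta : H) (a : C).

Lemma rsum_single (f : X -> R) x : (forall y, y != x -> f y = 0) -> rsum f = f x.
Proof.
move=> f0; have esumE (g : X -> R) : (forall y, 0 <= g y) -> (forall y, y != x -> g y = 0) ->
    fine (\esum_(y in [set: X]) (g y)%:E) = g x.
  move=> g0 gx; rewrite (esumID [set x])//; last by move=> y _; rewrite lee_fin.
  rewrite setTI esum_set1 ?lee_fin// [X in (_ + X)%E]esum1 ?adde0//.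
  by move=> y [_ /eqP/gx ->].
rewrite /rsum !esumE.
- by case: (leP (f x) 0); case: (leP (- f x) 0);
  rewrite ?oppr_le0 ?oppr_gt0 ?sub0r ?subr0 ?opprK//;
  move=> h1 h2; apply/eqP; rewrite eq_le ?h1 ?h2 ?(ltW h1) ?(ltW h2)//; lra.
- by move=> y; rewrite le_max lexx orbT.
- by move=> y /f0 ->; rewrite oppr0 maxxx.
- by move=> y; rewrite le_max lexx orbT.
- by move=> y /f0 ->; rewrite maxxx.
Qed.

Lemma ell2_eq xi eta : (forall x, xi x = eta x) -> xi = eta.
Proof. by move=> e; apply: val_inj; apply/funext. Qed.

Lemma ell2D xi eta x : (xi + eta : H) x = xi x + eta x. Proof. by []. Qed.
Lemma ell2N xi x : (- xi : H) x = - xi x. Proof. by []. Qed.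
Lemma ell2Z a xi x : (a *: xi : H) x = a * xi x. Proof. by []. Qed.
Lemma ell20 x : (0 : H) x = 0. Proof. by []. Qed.

Lemma abs_summable_abs2 xi : abs_summable (fun x => abs2 (xi x)).
Proof.
have /asboolP : (xi : X -> C^o) \in sqsummable by exact: valP xi.
by rewrite /abs_summable; under eq_esum do rewrite ger0_norm ?abs2_ge0//.
Qed.

Lemma sqsummableP (f : X -> C^o) : abs_summable (fun x => abs2 (f x)) -> f \in sqsummable.
Proof.
rewrite /abs_summable; under eq_esum do rewrite ger0_norm ?abs2_ge0//.
by move=> ?; apply/asboolP.
Qed.

Definition mk_ell2 (f : X -> C^o) (sf : abs_summable (fun x => abs2 (f x))) : H :=
  Ell2 (sqsummableP sf).

Definition nsq xi : R := psum (fun x => abs2 (xi x)).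

Lemma nsqE xi : (nsq xi)%:E = sqnorm xi.
Proof. by rewrite /nsq psumK// => [x|]; [exact: abs2_ge0|exact: abs_summable_abs2]. Qed.

Lemma nsq_ge0 xi : 0 <= nsq xi.
Proof. by apply: psum_ge0 => x; exact: abs2_ge0. Qed.

Lemma norm2E xi : norm2 xi = Num.sqrt (nsq xi).
Proof. by []. Qed.

Lemma sqr_norm2 xi : norm2 xi ^+ 2 = nsq xi.
Proof. by rewrite norm2E sqr_sqrtr// nsq_ge0. Qed.

Lemma norm2_ge0 xi : 0 <= norm2 xi. Proof. exact: sqrtr_ge0. Qed.

Lemma abs2E (z : C) : (abs2 z)%:C = z^* * z.
Proof. by case: z => u v; rewrite /abs2 /=; simpc; congr (_ +i* _); ring. Qed.

Lemma conjcE (z : C) : Num.conj z = conjc z. Proof. by []. Qed.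

Lemma abs2_eq0 (z : C) : abs2 z = 0 -> z = 0.
Proof.
case: z => u v /eqP; rewrite /abs2 /= paddr_eq0 ?sqr_ge0// !sqrf_eq0.
by case/andP => /eqP -> /eqP ->.
Qed.

Lemma nsq_eq0 xi : nsq xi = 0 -> xi = 0.
Proof.
move=> n0; apply: ell2_eq => x; apply: abs2_eq0; apply/eqP.
rewrite eq_le abs2_ge0 andbT -n0; apply: (@psum_ge _ _ (fun x => abs2 (xi x))).
  by move=> y; exact: abs2_ge0.
exact: abs_summable_abs2.
Qed.

Lemma abs_summable_sum2 xi eta (f : X -> R) :
  (forall x, `|f x| <= abs2 (xi x) + abs2 (eta x)) -> abs_summable f.
Proof.
move=> fx; apply: (@abs_summable_le _ _ _ (fun x => abs2 (xi x) + abs2 (eta x))).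
  by move=> x; apply: le_trans (fx x) (ler_norm _).
by apply: abs_summableD; exact: abs_summable_abs2.
Qed.

Lemma Re_bound (z w : C) : `|complex.Re (z^* * w)| <= abs2 z + abs2 w.
Proof.
case: z w => a b [c d]; rewrite /abs2 /=; simpc; rewrite ler_norml /=.
have := sqr_ge0 (a + c); have := sqr_ge0 (b + d); have := sqr_ge0 (a - c).
have := sqr_ge0 (b - d); have := sqr_ge0 a; have := sqr_ge0 b; have := sqr_ge0 c.
have := sqr_ge0 d; rewrite !expr2 => h1 h2 h3 h4 h5 h6 h7 h8.
by apply/andP; split; lra.
Qed.

Lemma Im_bound (z w : C) : `|complex.Im (z^* * w)| <= abs2 z + abs2 w.
Proof.
case: z w => a b [c d]; rewrite /abs2 /=; simpc; rewrite ler_norml /=.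
have := sqr_ge0 (a + d); have := sqr_ge0 (b + c); have := sqr_ge0 (a - d).
have := sqr_ge0 (b - c); have := sqr_ge0 a; have := sqr_ge0 b; have := sqr_ge0 c.
have := sqr_ge0 d; rewrite !expr2 => h1 h2 h3 h4 h5 h6 h7 h8.
by apply/andP; split; lra.
Qed.

Lemma abs_summable_Re xi eta : abs_summable (fun x => complex.Re ((xi x)^* * eta x)).
Proof. by apply: (@abs_summable_sum2 xi eta) => x; exact: Re_bound. Qed.

Lemma abs_summable_Im xi eta : abs_summable (fun x => complex.Im ((xi x)^* * eta x)).
Proof. by apply: (@abs_summable_sum2 xi eta) => x; exact: Im_bound. Qed.

Lemma innerP xi a eta zeta :
  inner xi (a *: eta + zeta) = a * inner xi eta + inner xi zeta.
Proof.
case: a => a1 a2; rewrite /inner; simpc.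
have sR := abs_summable_Re xi eta; have sI := abs_summable_Im xi eta.
have sR' := abs_summable_Re xi zeta; have sI' := abs_summable_Im xi zeta.
have s1 := abs_summableZ a1 sR; have s2 := abs_summableZ a2 sI.
have s3 := abs_summableZ a1 sI; have s4 := abs_summableZ a2 sR.
congr (_ +i* _).
  rewrite -!rsumZ// -rsumN// -rsumD//; last exact: abs_summableN.
  rewrite -rsumD//; last by apply: abs_summableD => //; exact: abs_summableN.
  apply: eq_rsum => x; rewrite ell2D ell2Z.
  by case: (xi x) (eta x) (zeta x) => u1 u2 [v1 v2] [w1 w2] /=; simpc; rewrite /=; ring.
rewrite -!rsumZ// -rsumD// -rsumD//; last exact: abs_summableD.
apply: eq_rsum => x; rewrite ell2D ell2Z.
by case: (xi x) (eta x) (zeta x) => u1 u2 [v1 v2] [w1 w2] /=; simpc; rewrite /=; ring.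
Qed.

Lemma inner_conj xi eta : inner eta xi = (inner xi eta)^*.
Proof.
rewrite /inner /=; congr (_ +i* _).
  apply: eq_rsum => x.
  by case: (xi x) (eta x) => u1 u2 [v1 v2] /=; simpc; rewrite /=; ring.
rewrite -rsumN; last exact: abs_summable_Im.
apply: eq_rsum => x.
by case: (xi x) (eta x) => u1 u2 [v1 v2] /=; simpc; rewrite /=; ring.
Qed.

Lemma inner_self xi : inner xi xi = (nsq xi)%:C.
Proof.
rewrite /inner; congr (_ +i* _).
  rewrite -[nsq xi]/(psum (fun x => abs2 (xi x))) -rsum_psum.
  - by apply: eq_rsum => x; rewrite -abs2E.
  - by move=> x; exact: abs2_ge0.
  - exact: abs_summable_abs2.
rewrite (@eq_rsum _ _ _ (fun=> 0)); last by move=> x; rewrite -abs2E.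
by rewrite /rsum oppr0 subrr.
Qed.

Lemma innerDr xi eta zeta : inner xi (eta + zeta) = inner xi eta + inner xi zeta.
Proof. by rewrite -[eta]scale1r innerP mul1r scale1r. Qed.

Lemma inner0r xi : inner xi 0 = 0.
Proof. by apply: (addrI (inner xi 0)); rewrite -innerDr !addr0. Qed.

Lemma innerZr xi a eta : inner xi (a *: eta) = a * inner xi eta.
Proof. by rewrite -[a *: eta]addr0 innerP inner0r addr0. Qed.

Lemma innerNr xi eta : inner xi (- eta) = - inner xi eta.
Proof. by rewrite -scaleN1r innerZr mulN1r. Qed.

Lemma innerBr xi eta zeta : inner xi (eta - zeta) = inner xi eta - inner xi zeta.
Proof. by rewrite innerDr innerNr. Qed.

Lemma conjcD (z w : C) : conjc (z + w) = conjc z + conjc w.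
Proof. by case: z w => a b [c d]; simpc. Qed.
Lemma conjcM (z w : C) : conjc (z * w) = conjc z * conjc w.
Proof. by case: z w => a b [c d]; simpc; congr (_ +i* _); ring. Qed.
Lemma conjcN (z : C) : conjc (- z) = - conjc z.
Proof. by case: z. Qed.

Lemma innerDl xi eta zeta : inner (eta + zeta) xi = inner eta xi + inner zeta xi.
Proof. by rewrite inner_conj innerDr conjcD -!inner_conj. Qed.

Lemma innerZl xi a eta : inner (a *: eta) xi = conjc a * inner eta xi.
Proof. by rewrite inner_conj innerZr conjcM -inner_conj. Qed.

Lemma inner0l xi : inner 0 xi = 0.
Proof. by rewrite inner_conj inner0r conjc0. Qed.

Lemma innerNl xi eta : inner (- eta) xi = - inner eta xi.
Proof. by rewrite inner_conj innerNr conjcN -inner_conj. Qed.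

Lemma innerBl xi eta zeta : inner (eta - zeta) xi = inner eta xi - inner zeta xi.
Proof. by rewrite innerDl innerNl. Qed.

Lemma inner_sumr (I : Type) (s : seq I) (P : pred I) (f : I -> H) xi :
  inner xi (\sum_(i <- s | P i) f i) = \sum_(i <- s | P i) inner xi (f i).
Proof.
by apply: (big_morph (fun f => inner xi f)) => [u v|]; [exact: innerDr|exact: inner0r].
Qed.

Lemma inner_suml (I : Type) (s : seq I) (P : pred I) (f : I -> H) xi :
  inner (\sum_(i <- s | P i) f i) xi = \sum_(i <- s | P i) inner (f i) xi.
Proof.
by apply: (big_morph (fun f => inner f xi)) => [u v|]; [exact: innerDl|exact: inner0l].
Qed.

Lemma abs2_0 : abs2 (0 : C) = 0. Proof. by rewrite /abs2 /= expr0n addr0. Qed.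
Lemma abs2M (z w : C) : abs2 (z * w) = abs2 z * abs2 w.
Proof. by case: z w => a b [c d]; rewrite /abs2 /=; ring. Qed.
Lemma abs2_real (t : R) : abs2 t%:C = t ^+ 2.
Proof. by rewrite /abs2 /= expr0n addr0. Qed.
Lemma abs_summable_fin (f : X -> R) (s : seq X) :
  (forall x, x \notin s -> f x = 0) -> abs_summable f.
Proof.
move=> f0; rewrite /abs_summable (esumID [set` s])//.
rewrite [X in (_ + X)%E]esum1 ?adde0; last first.
  by move=> x [_ /= /negP xs]; rewrite f0 ?normr0.
rewrite setTI esum_fset//.
rewrite fsbig_finite//= sumEFin ltry//.
Qed.

Lemma ebas_subproof (x : X) : abs_summable (fun y => abs2 ((y == x)%:R : C)).
Proof.
apply: (@abs_summable_fin _ [:: x]) => y; rewrite inE => /negbTE ->.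
exact: abs2_0.
Qed.

Definition ebas (x : X) : H := mk_ell2 (ebas_subproof x).

Lemma ebasE x y : ebas x y = (y == x)%:R. Proof. by []. Qed.

Lemma inner_ebas x xi : inner (ebas x) xi = xi x.
Proof.
rewrite /inner !(@rsum_single _ x); first last.
- by move=> y /negbTE yx; rewrite ebasE yx conjC0 mul0r.
- by move=> y /negbTE yx; rewrite ebasE yx conjC0 mul0r.
by rewrite ebasE eqxx conjC1 mul1r; case: (xi x).
Qed.

Lemma inner_ebasr x xi : inner xi (ebas x) = (xi x)^*.
Proof. by rewrite inner_conj inner_ebas. Qed.

Lemma nsqZ a xi : nsq (a *: xi) = abs2 a * nsq xi.
Proof.
apply: complexI; rewrite -inner_self innerZl innerZr mulrA -conjcE -abs2E inner_self.
by rewrite rmorphM.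
Qed.

Lemma nsqN xi : nsq (- xi) = nsq xi.
Proof. by apply: complexI; rewrite -!inner_self innerNl innerNr opprK. Qed.

(** The parallelogram law with the square norm of the difference dropped; it serves as triangle
    inequality for square norms. *)
Lemma nsqD_le xi eta : nsq (xi + eta) <= 2 * nsq xi + 2 * nsq eta.
Proof.
have: 0 <= nsq (xi - eta) by exact: nsq_ge0.
have -> : nsq (xi - eta) = 2 * nsq xi + 2 * nsq eta - nsq (xi + eta).
  apply: complexI; rewrite rmorphB rmorphD !rmorphM /= -!inner_self.
  rewrite !(innerDl, innerDr, innerNl, innerNr).
  have -> : (2 : R)%:C = 2 :> C by exact: rmorph_nat.
  by ring.
by rewrite subr_ge0.
Qed.

Lemma Re_inner_le xi eta : 2 * complex.Re (inner xi eta) <= nsq xi + nsq eta.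
Proof.
have := nsq_ge0 (xi - eta); have := inner_self (xi - eta).
rewrite !(innerDl, innerDr, innerNl, innerNr) !inner_self.
rewrite (inner_conj xi eta); case: (inner xi eta) => u v /=; simpc => -[+ _] h.
lra.
Qed.

Lemma ReD (z w : C) : complex.Re (z + w) = complex.Re z + complex.Re w.
Proof. by case: z w => a b []. Qed.
Lemma ImD (z w : C) : complex.Im (z + w) = complex.Im z + complex.Im w.
Proof. by case: z w => a b []. Qed.
Lemma Re_realM (t : R) (w : C) : complex.Re (t%:C * w) = t * complex.Re w.
Proof. by case: w => a b /=; rewrite mul0r subr0. Qed.
Lemma Re_sum (I : Type) (s : seq I) (F : I -> C) :
  complex.Re (\sum_(i <- s) F i) = \sum_(i <- s) complex.Re (F i).
Proof. by apply: (big_morph _ ReD). Qed.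

Lemma bounded_opP (T : H -> H) (M : R) : linear T ->
  (forall xi, nsq (T xi) <= M * nsq xi) -> bounded_op T.
Proof.
move=> lT TM; split => //; exists (Num.sqrt (Num.max M 0)) => xi.
rewrite !norm2E -sqrtrM ?le_max ?lexx ?orbT// ler_sqrt; last first.
  by rewrite mulr_ge0 ?nsq_ge0// le_max lexx orbT.
by apply: le_trans (TM xi) _; rewrite ler_wpM2r ?nsq_ge0// le_max lexx.
Qed.

Lemma bounded_op_nsq (T : H -> H) : bounded_op T ->
  exists2 M : R, 0 <= M & forall xi, nsq (T xi) <= M * nsq xi.
Proof.
case=> _ [M TM]; exists (M ^+ 2); first exact: sqr_ge0.
move=> xi; rewrite -!sqr_norm2 -exprMn.
by rewrite lerXn2r ?TM// nnegrE ?norm2_ge0//; apply: le_trans (TM xi); exact: norm2_ge0.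
Qed.

Lemma linear_opD (T : H -> H) : linear T -> forall xi eta, T (xi + eta) = T xi + T eta.
Proof. by move=> lT xi eta; rewrite -[xi]scale1r lT !scale1r. Qed.

Lemma linear_op0 (T : H -> H) : linear T -> T 0 = 0.
Proof. by move=> lT; apply: (addrI (T 0)); rewrite -linear_opD// !addr0. Qed.

Lemma linear_opZ (T : H -> H) : linear T -> forall a xi, T (a *: xi) = a *: T xi.
Proof. by move=> lT a xi; rewrite -[a *: xi]addr0 lT linear_op0// addr0. Qed.

Lemma linear_opB (T : H -> H) : linear T -> forall xi eta, T (xi - eta) = T xi - T eta.
Proof. by move=> lT xi eta; rewrite linear_opD// -scaleN1r linear_opZ// scaleN1r. Qed.

Lemma linear_op_sum (T : H -> H) : linear T -> forall (I : Type) (s : seq I) (f : I -> H),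
  T (\sum_(i <- s) f i) = \sum_(i <- s) T (f i).
Proof. by move=> lT I s f; apply: big_morph; [exact: linear_opD|exact: linear_op0]. Qed.

Lemma adjoint_opC (T S : H -> H) : bounded_op T -> adjoint_op T S -> adjoint_op S T.
Proof.
by move=> bT [bS TS]; split => // xi eta; rewrite inner_conj -TS -inner_conj.
Qed.

Lemma inner_eq xi eta : (forall zeta, inner zeta xi = inner zeta eta) -> xi = eta.
Proof. by move=> e; apply: ell2_eq => x; rewrite -!inner_ebas. Qed.

(* Polarization: a quadratic form that takes only real values is Hermitian. *)
Lemma positive_op_adjoint (T : H -> H) : positive_op T -> adjoint_op T T.
Proof.
move=> [bT pT]; split => // xi eta.
have lT := bT.1.
have real zeta : complex.Im (inner zeta (T zeta)) = 0.
  by have := pT zeta; rewrite lecE => /andP[/eqP ->].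
have := real (xi + eta); have := real (xi + 'i *: eta).
rewrite !(linear_opD lT) !(linear_opZ lT) !(innerDl, innerDr, innerZl, innerZr) !ImD.
have := real xi; have := real eta.
rewrite (inner_conj eta (T xi)).
case: (inner xi (T xi)) => p1 p2; case: (inner eta (T eta)) => q1 q2.
case: (inner xi (T eta)) => u1 u2; case: (inner eta (T xi)) => v1 v2 /=.
move=> -> -> h1 h2.
by congr (_ +i* _); lra.
Qed.

End Inner.

(** * Ky Fan sums *)

Section KyFan.
Context {R : realType} {X : choiceType}.
Local Notation C := R[i].
Local Notation H := (ell2 R X).
Implicit Types (u v e : H) (f g s : seq H) (S T : H -> H).

(* Allowing zero vectors makes the Gram-Schmidt process total, without linear independence. *)
Fixpoint onz f : Prop :=
  if f is e :: f' then
    [/\ inner e e = 1 \/ e = 0, forall h, h \in f' -> inner e h = 0 & onz f']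
  else True.

Definition proj f v : H := \sum_(e <- f) inner e v *: e.

(** For [f] satisfying [onz], the vectors fixed by [proj f] form exactly its span, so membership in
    the span becomes an equation. *)
Definition inspan f v := proj f v = v.

Lemma proj_cons e f v : proj (e :: f) v = inner e v *: e + proj f v.
Proof. by rewrite /proj big_cons. Qed.

Lemma inner_proj e f v : inner e (proj f v) = \sum_(h <- f) inner h v * inner e h.
Proof. by rewrite inner_sumr; apply: eq_bigr => h _; rewrite innerZr. Qed.

Lemma inner_proj_mem f e v : onz f -> e \in f -> inner e (proj f v) = inner e v.
Proof.
elim: f => // g f IH [ng og nf]; rewrite inE proj_cons innerDr innerZr => /orP[/eqP ->|ef].
  rewrite inner_proj big_seq big1 ?addr0; last by move=> h /og ->; rewrite mulr0.
  by case: ng => [->|->]; rewrite ?mulr1// !inner0l mul0r.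
by rewrite (inner_conj g e) (og e ef) conjc0 mulr0 add0r IH.
Qed.

Lemma sum_abs2_inner f v :
  (\sum_(e <- f) abs2 (inner e v))%:C = \sum_(e <- f) inner v e * inner e v.
Proof.
rewrite rmorph_sum; apply: eq_bigr => e _.
by rewrite [LHS]abs2E conjcE -inner_conj.
Qed.

(** The defect is the square norm of [v - proj f v]. *)
Lemma bessel f v : onz f -> \sum_(e <- f) abs2 (inner e v) <= nsq v.
Proof.
move=> of_; have := nsq_ge0 (v - proj f v).
suff -> : nsq (v - proj f v) = nsq v - \sum_(e <- f) abs2 (inner e v).
  by rewrite subr_ge0.
apply: complexI; rewrite rmorphB /= sum_abs2_inner -!inner_self innerBl.
rewrite [X in _ - X](_ : _ = 0) ?subr0.
  rewrite innerBr inner_proj; congr (_ - _); apply: eq_bigr => e _; exact: mulrC.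
rewrite {1}/proj inner_suml big_seq big1// => e ef.
by rewrite innerZl innerBr inner_proj_mem// subrr mulr0.
Qed.

Lemma parseval f v : inspan f v -> nsq v = \sum_(e <- f) abs2 (inner e v).
Proof.
move=> fv; apply: complexI; rewrite sum_abs2_inner -inner_self -{2}fv inner_proj.
by apply: eq_bigr => e _; rewrite mulrC.
Qed.

Lemma proj_linear f : linear (proj f).
Proof.
move=> a u v; rewrite /proj scaler_sumr -big_split; apply: eq_bigr => e _ /=.
by rewrite innerDr innerZr scalerDl scalerA.
Qed.

Lemma inspan_linear f a u v : inspan f u -> inspan f v -> inspan f (a *: u + v).
Proof. by move=> fu fv; rewrite /inspan proj_linear fu fv. Qed.

Lemma inspan0 f : inspan f 0.
Proof. by rewrite /inspan /proj big1// => e _; rewrite inner0r scale0r. Qed.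

Lemma inspanZ f a u : inspan f u -> inspan f (a *: u).
Proof. by move=> fu; rewrite -[a *: u]addr0; apply: inspan_linear => //; exact: inspan0. Qed.

Lemma inspanB f u v : inspan f u -> inspan f v -> inspan f (u - v).
Proof. by move=> fu fv; rewrite addrC -scaleN1r; exact: inspan_linear. Qed.

Lemma inspan_sum f s (c : H -> C) : (forall e, e \in s -> inspan f e) ->
  inspan f (\sum_(e <- s) c e *: e).
Proof.
move=> fs; rewrite big_seq; apply: (big_ind (inspan f)).
- exact: inspan0.
- by move=> u v fu fv; rewrite -[u]scale1r; exact: inspan_linear.
- by move=> e /fs; exact: inspanZ.
Qed.

Lemma inspan_orth f e v : (forall h, h \in f -> inner e h = 0) -> inspan f v -> inner e v = 0.
Proof.
by move=> ef <-; rewrite inner_proj big_seq big1// => h /ef ->; rewrite mulr0.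
Qed.

Lemma inspan_mem f e : onz f -> e \in f -> inspan f e.
Proof.
elim: f => // g f IH [ng og nf]; rewrite inE => /orP[/eqP ->|ef].
  rewrite /inspan proj_cons [X in _ + X](_ : _ = 0).
    by rewrite addr0; case: ng => [->|->]; rewrite ?scale1r ?scaler0.
  by rewrite /proj big_seq big1// => h /og; rewrite inner_conj => gh;
    rewrite (_ : inner h g = 0) ?scale0r// -[inner h g]conjcK gh conjc0.
by rewrite /inspan proj_cons og// scale0r add0r IH.
Qed.

Lemma inspan_cons f e v : onz (e :: f) -> inspan f v -> inspan (e :: f) v.
Proof.
by move=> [_ ef _] fv; rewrite /inspan proj_cons (inspan_orth ef fv) scale0r add0r.
Qed.

Lemma gram_schmidt s f : onz f -> exists f1, [/\ size f1 = size s, onz (f1 ++ f),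
  forall v, inspan f v \/ v \in s -> inspan (f1 ++ f) v &
  forall g, (forall v, v \in f ++ s -> inspan g v) -> forall v, v \in f1 -> inspan g v].
Proof.
elim: s f => [|v s IH] f nf.
  by exists [::]; split => // v [].
pose u := v - proj f v.
pose e : H := (Num.sqrt (nsq u))^-1%:C *: u.
have ou h : h \in f -> inner h u = 0.
  by move=> hf; rewrite innerBr inner_proj_mem// subrr.
have [u0|un0] := eqVneq (nsq u) 0.
  have u00 := nsq_eq0 u0.
  have [f1 [s1 n1 i1 g1]] := IH f nf.
  have n2 : onz (0 :: (f1 ++ f)).
    by split => //; [right|move=> h _; rewrite inner0l].
  exists (0 :: f1); split => //=; first by rewrite s1.
    move=> w wh; apply: inspan_cons => //; apply: i1.
    case: wh => [|]; [by left|rewrite inE => /orP[/eqP ->|]]; last by right.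
    by left; apply/esym/eqP; rewrite -subr_eq0; apply/eqP.
  move=> g gs w; rewrite inE => /orP[/eqP ->|]; first exact: inspan0.
  by apply: g1 => h; rewrite mem_cat => /orP[hf|hs]; apply: gs; rewrite mem_cat ?inE ?hf ?hs ?orbT.
have upos : 0 < nsq u by rewrite lt_neqAle eq_sym un0 nsq_ge0.
have sq0 : Num.sqrt (nsq u) != 0 by rewrite gt_eqF// sqrtr_gt0.
have nef : onz (e :: f).
  split=> //.
    left; rewrite inner_self nsqZ abs2_real exprVn sqr_sqrtr ?nsq_ge0//.
    by rewrite mulVf.
  move=> h hf; rewrite innerZl (inner_conj h u) ou// conjc0 mulr0//.
have [f1 [s1 n1 i1 g1]] := IH _ nef.
have uE : v = (Num.sqrt (nsq u))%:C *: e + proj f v.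
  by rewrite scalerA -rmorphM /= mulfV// scale1r /u subrK.
exists (rcons f1 e); rewrite cat_rcons; split => //.
- by rewrite size_rcons s1.
- move=> w [fw|]; first by apply: i1; left; exact: inspan_cons.
  rewrite inE => /orP[/eqP ->|ws]; last by apply: i1; right.
  rewrite [in inspan _ v]uE; apply: inspan_linear; apply: i1; left.
    by apply: inspan_mem => //; rewrite inE eqxx.
  apply: inspan_cons => //; apply: inspan_sum => h hf; exact: inspan_mem.
- move=> g gs w.
  have ge : inspan g e.
    apply: inspanZ; apply: inspanB; first by apply: gs; rewrite mem_cat inE eqxx orbT.
    by apply: inspan_sum => h hf; apply: gs; rewrite mem_cat hf.
  rewrite mem_rcons inE => /orP[/eqP -> //|].
  apply: g1 => h; rewrite cat_cons inE mem_cat => /or3P[/eqP -> //|hf|hs];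
    by apply: gs; rewrite mem_cat ?inE ?hf ?hs ?orbT.
Qed.

Lemma gram_schmidt0 s : exists f, [/\ size f = size s, onz f &
  forall v, v \in s -> inspan f v].
Proof.
have [|f [s1 n1 i1 _]] := @gram_schmidt s [::]; first by [].
rewrite cats0 in n1 i1.
by exists f; split => // v vs; apply: i1; right.
Qed.

(** The trace of the compression of [T] to a subspace depends on the subspace alone: expand [e] over
    [g], exchange the sums, and contract over [f]. *)
Lemma trace_basis_indep f g T : linear T -> onz f -> onz g ->
  (forall e, e \in f -> inspan g e) -> (forall h, h \in g -> inspan f h) ->
  \sum_(e <- f) inner e (T e) = \sum_(h <- g) inner h (T h).
Proof.
move=> lT nf ng fg gf.
transitivity (\sum_(e <- f) \sum_(h <- g) inner h e * inner e (T h)).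
  rewrite big_seq [RHS]big_seq; apply: eq_bigr => e /fg ge.
  rewrite -{2}ge /proj linear_op_sum// inner_sumr; apply: eq_bigr => h _.
  by rewrite linear_opZ// innerZr.
rewrite exchange_big/= big_seq [RHS]big_seq; apply: eq_bigr => h /gf fh.
rewrite -{3}fh /proj inner_suml; apply: eq_bigr => e _.
by rewrite innerZl -inner_conj.
Qed.

Definition tr f T : R := complex.Re (\sum_(e <- f) inner e (T e)).

Definition ky_fan n T : set R := [set tr f T | f in [set f | onz f /\ size f = n]].

(** By Ky Fan's variational principle this is the sum of the n largest eigenvalues when [T] is
    positive and compact. The supremum makes sense for every bounded operator, so no spectral
    theorem is needed. *)
Definition sigma n T : R := sup (ky_fan n T).

Lemma trE f T : tr f T = \sum_(e <- f) complex.Re (inner e (T e)).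
Proof. exact: Re_sum. Qed.

Lemma trD f S T : tr f (S \+ T) = tr f S + tr f T.
Proof.
rewrite !trE -big_split; apply: eq_bigr => e _.
by rewrite -[RHS]ReD -innerDr.
Qed.

Lemma tr_cat f g T : tr (f ++ g) T = tr f T + tr g T.
Proof. by rewrite !trE big_cat. Qed.

Lemma tr_ge0 f T : positive_op T -> 0 <= tr f T.
Proof.
move=> [_ pT]; rewrite trE; apply: sumr_ge0 => e _.
by have := pT e; rewrite lecE => /andP[].
Qed.

Lemma onz_nseq n : onz (nseq n 0).
Proof.
elim: n => //= n IH; split => //; first by right.
by move=> h _; rewrite inner0l.
Qed.

Lemma onz_nsq f e : onz f -> e \in f -> nsq e <= 1.
Proof.
elim: f => // g f IH [ng og nf]; rewrite inE => /orP[/eqP ->|]; last exact: IH.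
case: ng => [|->].
  by rewrite inner_self => -[->].
by rewrite (_ : nsq 0 = 0)//; apply: complexI; rewrite -inner_self inner0l.
Qed.

Lemma ky_fan_nonempty n T : ky_fan n T !=set0.
Proof. by exists (tr (nseq n 0) T), (nseq n 0) => //; split; [exact: onz_nseq|rewrite size_nseq]. Qed.

Lemma sum_le_const (I : eqType) (r : seq I) (F : I -> R) (c : R) :
  (forall i, i \in r -> F i <= c) -> \sum_(i <- r) F i <= (size r)%:R * c.
Proof.
move=> h; rewrite big_seq; apply: le_trans (ler_sum _ _) _.
  by move=> i ir; exact: (h i ir).
rewrite -big_seq; elim: r {h} => [|i r IH]; rewrite ?big_nil ?mul0r//.
by rewrite big_cons /= -natr1 mulrDl mul1r addrC lerD2r.
Qed.

Lemma ky_fan_ub n T : bounded_op T -> has_ubound (ky_fan n T).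
Proof.
move=> bT; have [M M0 TM] := bounded_op_nsq bT.
exists (n%:R * (1 + M)) => _ [f [nf sf] <-]; rewrite trE -sf.
apply: sum_le_const => e ef; have := Re_inner_le e (T e); have := onz_nsq nf ef.
have := TM e; have := nsq_ge0 e; have := nsq_ge0 (T e); nra.
Qed.

Lemma sigma_ge f T : bounded_op T -> onz f -> tr f T <= sigma (size f) T.
Proof. by move=> bT nf; apply: ub_le_sup; [exact: ky_fan_ub|exists f]. Qed.

Lemma sigma_le n T (B : R) : (forall f, onz f -> size f = n -> tr f T <= B) -> sigma n T <= B.
Proof.
by move=> h; apply: ge_sup; [exact: ky_fan_nonempty|move=> _ [f [nf sf] <-]; exact: h].
Qed.

Lemma sigma_mono m n T : positive_op T -> (m <= n)%N -> sigma m T <= sigma n T.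
Proof.
move=> pT mn; apply: sigma_le => f nf sf.
have nf' : onz (nseq (n - m) 0 ++ f).
  elim: (n - m)%N => //= k IH; split => //; first by right.
  by move=> h _; rewrite inner0l.
apply: le_trans (_ : tr (nseq (n - m) 0 ++ f) T <= _).
  by rewrite tr_cat lerDr; exact: tr_ge0.
rewrite [X in sigma X _](_ : n = size (nseq (n - m) (0 : H) ++ f)).
  by apply: sigma_ge => //; exact: pT.1.
by rewrite size_cat size_nseq sf subnK.
Qed.

Lemma sigma_ge0 n T : positive_op T -> 0 <= sigma n T.
Proof.
move=> pT; apply: le_trans (tr_ge0 (nseq n 0) pT) _.
have := sigma_ge pT.1 (onz_nseq n); by rewrite size_nseq.
Qed.

Lemma sigmaD_le n S T : bounded_op S -> bounded_op T ->
  sigma n (S \+ T) <= sigma n S + sigma n T.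
Proof.
move=> bS bT; apply: sigma_le => f nf <-.
by rewrite trD; apply: lerD; exact: sigma_ge.
Qed.

Lemma bounded_opD S T : bounded_op S -> bounded_op T -> bounded_op (S \+ T).
Proof.
move=> bS bT; have [M M0 SM] := bounded_op_nsq bS; have [N N0 TN] := bounded_op_nsq bT.
apply: (@bounded_opP _ _ _ (2 * M + 2 * N)).
  by move=> a u v /=; rewrite bS.1 bT.1 scalerDr addrACA.
move=> u /=; apply: le_trans (nsqD_le _ _) _; rewrite [leRHS]mulrDl -!mulrA.
by apply: lerD; rewrite ler_wpM2l//.
Qed.

(** A family [f] testing [S] and a family [g] testing [T] are completed to families of 2n vectors
    with a common span. The trace of [T] is the same over both completions, and positivity allows
    dropping the added vectors. *)
Lemma sigmaD_ge n S T : positive_op S -> positive_op T ->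
  sigma n S + sigma n T <= sigma n.*2 (S \+ T).
Proof.
move=> pS pT; rewrite -lerBrDr; apply: sigma_le => f nf sf.
rewrite lerBrDr addrC -lerBrDr; apply: sigma_le => g ng sg; rewrite lerBrDr addrC.
have [f1 [sf1 nf1 if1 gf1]] := gram_schmidt g nf.
have [g1 [sg1 ng1 ig1 gg1]] := gram_schmidt f ng.
have trfg : tr (f1 ++ f) T = tr (g1 ++ g) T.
  rewrite /tr; congr complex.Re; apply: trace_basis_indep => //; first exact: pT.1.1.
    have hf e : e \in f -> inspan (g1 ++ g) e by move=> ef; apply: ig1; right.
    have hg e : e \in g -> inspan (g1 ++ g) e by move=> eg; apply: ig1; left; exact: inspan_mem.
    move=> e; rewrite mem_cat => /orP[|/hf//]; apply: gf1 => h.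
    by rewrite mem_cat => /orP[/hf|/hg].
  have hg e : e \in g -> inspan (f1 ++ f) e by move=> ef; apply: if1; right.
  have hf e : e \in f -> inspan (f1 ++ f) e by move=> eg; apply: if1; left; exact: inspan_mem.
  move=> e; rewrite mem_cat => /orP[|/hg//]; apply: gg1 => h.
  by rewrite mem_cat => /orP[/hg|/hf].
apply: le_trans (_ : tr (f1 ++ f) (S \+ T) <= _).
  rewrite trD trfg !tr_cat; apply: lerD; rewrite lerDr; exact: tr_ge0.
rewrite (_ : n.*2 = size (f1 ++ f)); last by rewrite size_cat sf1 sg sf addnn.
by apply: sigma_ge => //; apply: bounded_opD; [exact: pS.1|exact: pT.1].
Qed.

Lemma sigma_mono_op n S T : positive_op S -> positive_op T -> sigma n S <= sigma n (S \+ T).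
Proof.
move=> pS pT; apply: sigma_le => f nf <-.
apply: le_trans (_ : tr f (S \+ T) <= _); first by rewrite trD lerDl; exact: tr_ge0.
by apply: sigma_ge => //; apply: bounded_opD; [exact: pS.1|exact: pT.1].
Qed.

Lemma bounded_opZ (a : C) T : bounded_op T -> bounded_op (fun u => a *: T u).
Proof.
move=> bT; have [M M0 TM] := bounded_op_nsq bT.
apply: (@bounded_opP _ _ _ (abs2 a * M)).
  by move=> b u v; rewrite bT.1 scalerDr !scalerA mulrC.
by move=> u; rewrite nsqZ -mulrA ler_wpM2l ?abs2_ge0.
Qed.

Lemma sigmaZ n (c : R) T : 0 <= c -> bounded_op T -> sigma n (fun u => c%:C *: T u) = c * sigma n T.
Proof.
move=> c0 bT; have trZ (k : R) (V : H -> H) f : tr f (fun u => k%:C *: V u) = k * tr f V.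
  by rewrite !trE mulr_sumr; apply: eq_bigr => e _; rewrite innerZr Re_realM.
apply/eqP; rewrite eq_le; apply/andP; split.
  by apply: sigma_le => f nf <-; rewrite trZ ler_wpM2l// sigma_ge.
have [->|cn0] := eqVneq c 0.
  rewrite mul0r; apply: le_trans (_ : tr (nseq n 0) (fun u => 0%:C *: T u) <= _).
    by rewrite trZ mul0r.
  by have := sigma_ge (bounded_opZ 0%:C bT) (onz_nseq n); rewrite size_nseq.
have cp : 0 < c by rewrite lt_neqAle eq_sym cn0.
rewrite mulrC -ler_pdivlMr//; apply: sigma_le => f nf <-.
rewrite ler_pdivlMr// mulrC -trZ; apply: sigma_ge => //; exact: bounded_opZ.
Qed.

Lemma tr_gram f T S : adjoint_op T S -> bounded_op T ->
  tr f (S \o T) = \sum_(e <- f) nsq (T e).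
Proof.
move=> [_ TS] bT; rewrite trE; apply: eq_bigr => e _.
by rewrite -[(S \o T) e]/(S (T e)) -TS inner_self.
Qed.

Lemma sum_abs2_exchange f g T S : bounded_op T -> adjoint_op T S ->
  \sum_(e <- f) \sum_(h <- g) abs2 (inner h (T e)) =
  \sum_(h <- g) \sum_(e <- f) abs2 (inner e (S h)).
Proof.
move=> bT aT; rewrite exchange_big /=; apply: eq_bigr => h _; apply: eq_bigr => e _.
rewrite inner_conj aT.2; apply: complexI; rewrite !abs2E !conjcE conjcK; exact: mulrC.
Qed.

(** With [S] the adjoint of [T], the trace of S T over [f] is the sum of the square norms of T e.
    Parseval over an orthonormal family [g] spanning the vectors T e, an exchange of sums and Bessel
    over [f] bound it by the trace of T S over [g], which has the same size. *)
Lemma sigma_tracial_le n T S : bounded_op T -> adjoint_op T S ->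
  sigma n (S \o T) <= sigma n (T \o S).
Proof.
move=> bT aT; have aS := adjoint_opC bT aT; have bS := aT.1.
apply: sigma_le => f nf sf; rewrite (tr_gram _ aT bT).
have [g [sg ng ig]] := gram_schmidt0 [seq T e | e <- f].
have -> : n = size g by rewrite sg size_map sf.
apply: le_trans (_ : tr g (T \o S) <= _).
  rewrite (tr_gram _ aS bS).
  have -> : \sum_(e <- f) nsq (T e) = \sum_(e <- f) \sum_(h <- g) abs2 (inner h (T e)).
    rewrite big_seq [RHS]big_seq; apply: eq_bigr => e ef.
    by apply: parseval; apply: ig; exact: map_f.
  rewrite (sum_abs2_exchange _ _ bT aT); apply: ler_sum => h _; exact: bessel.
apply: sigma_ge => //; split; first by move=> a u v /=; rewrite bS.1 bT.1.
have [_ [M TM]] := bT; have [_ [N SN]] := bS.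
exists (Num.max M 0 * N) => u /=; apply: le_trans (TM _) _.
apply: le_trans (_ : Num.max M 0 * norm2 (S u) <= _).
  by rewrite ler_wpM2r ?norm2_ge0// le_max lexx.
by rewrite -mulrA ler_wpM2l// le_max lexx orbT.
Qed.

Lemma sigma_tracial n T S : bounded_op T -> adjoint_op T S ->
  sigma n (S \o T) = sigma n (T \o S).
Proof.
move=> bT aT; apply/eqP; rewrite eq_le sigma_tracial_le//.
by apply: sigma_tracial_le; [exact: aT.1|exact: adjoint_opC].
Qed.

(** The square norms of P e are expanded over a fixed orthonormal family spanning the range; Bessel
    in the other variable then gives a bound independent of the number of test vectors. *)
Lemma sigma_finite_rank P : finite_rank_projection P ->
  exists B : R, forall n, sigma n P <= B.
Proof.
move=> [bP PP aP [k [b [_ rP]]]].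
have [g [sg ng ig]] := gram_schmidt0 [seq b i | i <- index_enum 'I_k].
have [M M0 PM] := bounded_op_nsq bP.
exists ((size g)%:R * M) => n; apply: sigma_le => f nf _.
rewrite -PP (tr_gram _ aP bP).
have -> : \sum_(e <- f) nsq (P e) = \sum_(e <- f) \sum_(h <- g) abs2 (inner h (P e)).
  apply: eq_bigr => e _; apply: parseval.
  have : range P (P e) by exists e.
  rewrite rP => -[c ->].
  apply: (big_ind (inspan g)); first exact: inspan0.
    by move=> u v fu fv; rewrite -[u]scale1r; exact: inspan_linear.
  by move=> i _; apply: inspanZ; apply: ig; apply: map_f; rewrite mem_index_enum.
rewrite (sum_abs2_exchange _ _ bP aP); apply: sum_le_const => h hg.
apply: le_trans (bessel _ nf) _; apply: le_trans (PM h) _.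
by rewrite ler_piMr// (onz_nsq ng).
Qed.

End KyFan.

(** * Dilation invariant limits and Dixmier weights *)

Section GeneralizedLimits.
Context {R : realType}.
Implicit Types u v : nat -> R.

Lemma bounded_seq_le u v : (forall n, `|u n| <= v n) -> bounded_seq v -> bounded_seq u.
Proof.
by move=> uv [M vM]; exists M => n; apply: le_trans (uv n) (le_trans (ler_norm _) (vM n)).
Qed.

Lemma bounded_seqD u v : bounded_seq u -> bounded_seq v -> bounded_seq (fun n => u n + v n).
Proof.
move=> [M uM] [N vN]; exists (M + N) => n.
by apply: le_trans (ler_normD _ _) _; exact: lerD.
Qed.

Lemma bounded_seqZ (a : R) u : bounded_seq u -> bounded_seq (fun n => a * u n).
Proof.
by move=> [M uM]; exists (`|a| * M) => n; rewrite normrM ler_wpM2l.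
Qed.

Lemma bounded_seqN u : bounded_seq u -> bounded_seq (fun n => - u n).
Proof. by move=> [M uM]; exists M => n; rewrite normrN. Qed.

Lemma bounded_seq_cst (c : R) : bounded_seq (fun=> c).
Proof. by exists `|c| => n. Qed.

Lemma bounded_seq_comp u (phi : nat -> nat) : bounded_seq u -> bounded_seq (u \o phi).
Proof. by move=> [M uM]; exists M => n; exact: uM. Qed.

Lemma cvg_bounded_seq u (l : R) : u n @[n --> \oo] --> l -> bounded_seq u.
Proof.
move=> ul; have : cvg (u @ \oo) by apply/cvg_ex; exists l.
move=> /cvg_seq_bounded [M [_ uM]].
by exists (M + 1) => n; apply: (uM (M + 1)) => //; rewrite ltrDl.
Qed.

(** The values lie in a compact segment, so the image of the ultrafilter has a cluster point, to
    which an ultrafilter must converge. *)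
Lemma ultra_bounded_cvg (I : Type) (U : set_system I) (f : I -> R) (M : R) :
  UltraFilter U -> (forall i, `|f i| <= M) -> cvg (f @ U).
Proof.
move=> UU fM; have UF : ProperFilter U by exact: ultra_proper.
have [|p [_ clp]] := @segment_compact R (- M) M (f @ U) _.
  by rewrite /fmap /=; apply: (@filterE _ U) => i /=; rewrite in_itv/= -ler_norml.
apply/cvg_ex; exists p => A Ap.
have [//|nA] := in_ultra_setVsetC (f @^-1` A) UU.
by have [y []] := clp (~` A) A nA Ap.
Qed.

Lemma inv_ln_cvg0 : (ln n%:R)^-1 @[n --> \oo] --> (0 : R).
Proof.
apply/cvgrPdist_le => e e0.
near=> n; rewrite sub0r normrN.
have ln1 : e^-1 <= ln (n%:R : R).
  rewrite -ler_expR lnK; last by rewrite posrE ltr0n; near: n; exact: nbhs_infty_gt.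
  by near: n; exact: nbhs_infty_ger.
have l0 : 0 < ln (n%:R : R) by apply: lt_le_trans ln1; rewrite invr_gt0.
rewrite ger0_norm; last by rewrite invr_ge0 ltW.
by rewrite -[leRHS]invrK lef_pV2// posrE ?invr_gt0.
Unshelve. all: by end_near. Qed.

(** Since n <= 3 (n./2), halving the index changes the logarithm by at most ln 3. *)
Lemma halves_log_ratio n : (1 < n./2)%N ->
  ln (n%:R : R) / ln (n./2)%:R <= 1 + ln 3 / ln (n./2)%:R.
Proof.
move=> n1; have l0 : 0 < ln ((n./2)%:R : R) by rewrite ln_gt0// ltr1n.
rewrite ler_pdivrMr// mulrDl mul1r mulfVK ?gt_eqF//.
rewrite -lnM ?posrE ?ltr0n//; last exact: ltn_trans n1.
rewrite -natrM ler_ln ?posrE ?ltr0n ?ler_nat//; last 2 first.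
- by case: n n1 {l0}.
- by rewrite muln_gt0 (ltn_trans _ n1).
- rewrite -{1}(odd_double_half n) -muln2 [(_ * 3)%N]mulnS addnC.
  by rewrite addnC leq_add// ?mulnC// (leq_trans (leq_b1 _))// ltnW.
Qed.

(** Along powers of 2 the dilation becomes a shift, and Cesaro means absorb a shift in the limit.
    The limit functional is therefore an ultrafilter limit of the means of [u (2 ^ k)]; Cesaro's
    theorem makes it extend the ordinary limit. *)
Lemma exists_dilation_invariant_limit :
  exists Lim : (nat -> R) -> R, dilation_invariant_limit Lim.
Proof.
have [U [UU oU]] := @ultraFilterLemma nat \oo _.
have UF : ProperFilter U by exact: ultra_proper.
pose avg u := arithmetic_mean (fun k => u (2 ^ k)%N).
have avgE u n : avg u n = n.+1%:R^-1 * \sum_(k < n.+1) u (2 ^ k)%N.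
  by rewrite /avg /arithmetic_mean /series /= big_mkord.
have avgM u (M : R) : (forall n, `|u n| <= M) -> forall n, `|avg u n| <= M.
  move=> uM n; rewrite avgE normrM ger0_norm ?invr_ge0// ler_pdivrMl//.
  apply: le_trans (ler_norm_sum _ _ _) _.
  apply: le_trans (_ : \sum_(k < n.+1) M <= _); first exact: ler_sum.
  by rewrite sumr_const card_ord mulr_natl.
have cv u : bounded_seq u -> cvg (avg u @ U).
  by move=> [M uM]; apply: (ultra_bounded_cvg UU); exact: avgM.
exists (fun u => lim (avg u @ U)); split.
- move=> a u v bu bv.
  rewrite (_ : avg _ = (fun n => a * avg u n + avg v n)); last first.
    apply/funext => n; rewrite !avgE big_split /= -mulr_sumr; ring.
  apply: cvg_lim => //; apply: cvgD; last exact: cv.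
  by apply: cvgMl_tmp; exact: cv.
- move=> u bu u0; apply: limr_ge; first exact: cv.
  apply: filterE => n; rewrite avgE mulr_ge0 ?invr_ge0//.
  by apply: sumr_ge0.
- move=> u l ul; apply: cvg_lim => //.
  apply: cvg_trans (_ : avg u @ \oo --> l).
    by move=> A; exact: oU.
  apply: cesaro; apply: (cvg_comp _ _ _ ul).
  apply/cvgnyPge => A; exists A => // n /= An.
  by apply: leq_trans An _; apply: ltnW; exact: ltn_expl.
- move=> u bu; have [M uM] := bu.
  have bu2 : bounded_seq (fun n => u n./2) by exists M => n; exact: uM.
  (* As [1./2 = 0], the dilated sum starts with [u 0] and then repeats the original sum without its
     last term. *)
  have dE n : avg (fun n => u n./2) n - avg u n = harmonic n * (u 0%N - u (2 ^ n)%N).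
    rewrite !avgE big_ord_recl big_ord_recr /= /harmonic /=.
    rewrite (eq_bigr (fun i : 'I_n => u (2 ^ i)%N)); last first.
      by move=> i _; rewrite /bump /= add1n expnS mul2n doubleK.
    by rewrite -mulrBr; congr (_ * _); ring.
  have d0 : avg (fun n => u n./2) n - avg u n @[n --> \oo] --> (0 : R).
    have M1 : 0 < 2 * M + 1 by have := le_trans (normr_ge0 _) (uM 0%N); lra.
    apply/cvgr0Pnorm_le => e e0; near=> n; rewrite dE normrM.
    apply: le_trans (_ : harmonic n * (2 * M + 1) <= _).
      rewrite ger0_norm ?harmonic_ge0// ler_wpM2l ?harmonic_ge0//.
      apply: le_trans (ler_normB _ _) _; have := uM 0%N; have := uM (2 ^ n)%N; lra.
    rewrite -ler_pdivlMr//; apply: ltW.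
    rewrite -[ltLHS]ger0_norm ?harmonic_ge0//.
    near: n; apply: cvgr0_norm_lt; [exact: cvg_harmonic|by rewrite divr_gt0].
  apply/eqP; rewrite -subr_eq0; apply/eqP.
  rewrite -limB; [|exact: cv..].
  apply: cvg_lim => //; apply: cvg_trans d0.
  by move=> A; exact: oU.
Unshelve. all: by end_near. Qed.

Section Lim.
Variables (Lim : (nat -> R) -> R) (L : dilation_invariant_limit Lim).

Lemma LimD u v : bounded_seq u -> bounded_seq v ->
  Lim (fun n => u n + v n) = Lim u + Lim v.
Proof.
move=> bu bv; rewrite -[Lim u]mul1r -(Lim_linear L)//; congr Lim.
by apply/funext => n; rewrite mul1r.
Qed.

Lemma Lim0 : Lim (fun=> 0) = 0.
Proof. by apply: (Lim_cvg L); exact: cvg_cst. Qed.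

Lemma LimZ (a : R) u : bounded_seq u -> Lim (fun n => a * u n) = a * Lim u.
Proof.
move=> bu; rewrite -[RHS]addr0 -Lim0 -(Lim_linear L)//; last exact: bounded_seq_cst.
by congr Lim; apply/funext => n; rewrite addr0.
Qed.

Lemma le_Lim u v : bounded_seq u -> bounded_seq v -> (forall n, u n <= v n) -> Lim u <= Lim v.
Proof.
move=> bu bv uv; have bN := bounded_seqN bu; rewrite -subr_ge0.
have -> : Lim v - Lim u = Lim (fun n => v n - u n).
  rewrite LimD//; congr (_ + _); rewrite -mulN1r -LimZ//; congr Lim.
  by apply/funext => n; rewrite mulN1r.
by apply: (Lim_ge0 L) => [|n]; [exact: bounded_seqD|rewrite subr_ge0].
Qed.

Section Dixmier.
Context {X : choiceType}.
Local Notation H := (ell2 R X).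
Implicit Types S T : H -> H.

(** At n = 0 and n = 1 the logarithm vanishes and the quotient is 0 by the convention on
    inverses. *)
Definition dix T n : R := sigma n T / ln n%:R.

(** [Lim] is controlled on bounded sequences only. The value +oo elsewhere is compatible with
    additivity, because for positive operators the sequence of a sum is bounded exactly when both
    sequences are. *)
Definition dixmier_weight T : \bar R :=
  if `[< bounded_seq (dix T) >] then (Lim (dix T))%:E else +oo%E.

Lemma ln_nat_ge0 n : 0 <= ln (n%:R : R).
Proof.
by case: n => [|n]; [rewrite ln0|rewrite ln_ge0 ?ler1n].
Qed.

Lemma dix_ge0 T n : positive_op T -> 0 <= dix T n.
Proof. by move=> pT; rewrite mulr_ge0 ?invr_ge0 ?ln_nat_ge0// sigma_ge0. Qed.

Lemma dixD_le S T n : bounded_op S -> bounded_op T -> dix (S \+ T) n <= dix S n + dix T n.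
Proof. by move=> bS bT; rewrite -mulrDl ler_wpM2r ?invr_ge0 ?ln_nat_ge0// sigmaD_le. Qed.

Lemma positive_opD S T : positive_op S -> positive_op T -> positive_op (S \+ T).
Proof.
move=> [bS pS] [bT pT]; split; first exact: bounded_opD.
by move=> xi /=; rewrite innerDr addr_ge0.
Qed.

(** [sigmaD_ge] bounds the two numerators at n./2 by the numerator of the sum at n. Changing the
    denominator costs a factor 1 + ln 3 / ln (n./2), hence an error tending to 0 since
    [dix (S \+ T)] is bounded. *)
Lemma dixD_half S T : positive_op S -> positive_op T -> bounded_seq (dix (S \+ T)) ->
  exists2 e : nat -> R, e n @[n --> \oo] --> (0 : R) &
  forall n, dix S n./2 + dix T n./2 <= dix (S \+ T) n + e n./2.
Proof.
move=> pS pT [B uB]; have B0 : 0 <= B := le_trans (normr_ge0 _) (uB 0%N).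
have l3 : 0 <= ln (3 : R) := ln_nat_ge0 3.
exists (fun n => B * ln 3 * (ln n%:R)^-1).
  by rewrite -[X in _ --> X](mulr0 (B * ln 3)); apply: cvgMl_tmp; exact: inv_ln_cvg0.
move=> n; have pST := positive_opD pS pT.
have [n1|n1] := leqP n./2 1.
  have l0 : ln ((n./2)%:R : R) = 0.
    by move: n1; case: n./2 => [|[|//]] _; [rewrite ln0|rewrite ln1].
  rewrite /dix l0 invr0 !mulr0 !addr0.
  exact: dix_ge0.
have l0 : 0 < ln ((n./2)%:R : R) by rewrite ln_gt0// ltr1n.
have n2 : (1 < n)%N by apply: leq_trans n1 _; rewrite leq_half_double -addnn leqW ?leq_addr.
have ln0 : 0 < ln (n%:R : R) by rewrite ln_gt0// ltr1n.
rewrite -mulrDl; apply: le_trans (_ : sigma n (S \+ T) / ln (n./2)%:R <= _).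
  rewrite ler_wpM2r ?invr_ge0 ?ln_nat_ge0//; apply: le_trans (sigmaD_ge _ pS pT) _.
  apply: sigma_mono => //; rewrite -{2}(odd_double_half n); exact: leq_addl.
have -> : sigma n (S \+ T) / ln (n./2)%:R = dix (S \+ T) n * (ln n%:R / ln (n./2)%:R).
  by rewrite mulrA divfK ?gt_eqF.
apply: le_trans (ler_wpM2l (dix_ge0 _ pST) (halves_log_ratio n1)) _.
rewrite mulrDr mulr1 lerD2l -mulrA ler_wpM2r ?mulr_ge0 ?invr_ge0 ?ln_nat_ge0//.
exact: le_trans (ler_norm _) (uB n).
Qed.

Lemma bounded_dixP T : positive_op T -> bounded_seq (dix T) <-> exists M : R, forall n, dix T n <= M.
Proof.
move=> pT; split=> -[M h]; exists M => n; first exact: le_trans (ler_norm _) (h n).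
by rewrite ger0_norm ?dix_ge0.
Qed.

Lemma dixD_bounded S T : positive_op S -> positive_op T ->
  bounded_seq (dix (S \+ T)) <-> bounded_seq (dix S) /\ bounded_seq (dix T).
Proof.
move=> pS pT; have bS := pS.1; have bT := pT.1; split=> [h|[h1 h2]].
  have le S' T' : positive_op S' -> positive_op T' -> bounded_seq (dix (S' \+ T')) ->
      bounded_seq (dix S').
    move=> pS' pT'; apply: bounded_seq_le => n; rewrite ger0_norm ?dix_ge0//.
    by rewrite ler_wpM2r ?invr_ge0 ?ln_nat_ge0// sigma_mono_op.
  split; first exact: (le S T).
  apply: (le T S) => //; rewrite (_ : T \+ S = S \+ T)//.
  by apply/funext => xi /=; rewrite addrC.
apply: (@bounded_seq_le _ (fun n => dix S n + dix T n)); last exact: bounded_seqD.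
by move=> n; rewrite ger0_norm ?dixD_le// dix_ge0//; exact: positive_opD.
Qed.

Lemma Lim_dixD S T : positive_op S -> positive_op T -> bounded_seq (dix S) ->
  bounded_seq (dix T) -> Lim (dix (S \+ T)) = Lim (dix S) + Lim (dix T).
Proof.
move=> pS pT h1 h2; have bS := pS.1; have bT := pT.1.
have h3 : bounded_seq (dix (S \+ T)) by apply/dixD_bounded.
rewrite -LimD//; have h4 := bounded_seqD h1 h2.
apply/eqP; rewrite eq_le; apply/andP; split.
  by apply: le_Lim => // n; exact: dixD_le.
have [e e0 he] := dixD_half pS pT h3; have be := cvg_bounded_seq e0.
(* Dilation invariance replaces the index n by n./2, where [dixD_half] applies; the dilated error
   sequence still has limit 0. *)
rewrite -(Lim_dilation L h4).
rewrite -[leRHS]addr0 -(Lim_cvg L e0) -(Lim_dilation L be) -LimD//; last first.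
  exact: (bounded_seq_comp half be).
apply: le_Lim => //; first exact: (bounded_seq_comp half h4).
by apply: bounded_seqD => //; exact: (bounded_seq_comp half be).
Qed.

Lemma dixmier_weight_singular_trace : singular_trace dixmier_weight.
Proof.
split.
- move=> T pT; rewrite /dixmier_weight; case: asboolP => // h.
  by rewrite lee_fin; apply: (Lim_ge0 L) => // n; exact: dix_ge0.
- move=> S T pS pT; rewrite /dixmier_weight; case: asboolP => h.
    have [h1 h2] := (dixD_bounded pS pT).1 h.
    by case: asboolP => // _; case: asboolP => // _; rewrite Lim_dixD.
  case: asboolP => h1; case: asboolP => h2 //.
  by exfalso; apply: h; apply/(dixD_bounded pS pT).
- move=> c T c0 pT; rewrite /dixmier_weight.
  have dE : dix (fun xi => c%:C *: T xi) = (fun n => c * dix T n).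
    by apply/funext => n; rewrite /dix sigmaZ ?mulrA//; exact: pT.1.
  (* For c = 0 the weight of [T] may be infinite; the convention 0 * +oo = 0 matches the zero
     sequence. *)
  rewrite dE; have [->|cn0] := eqVneq c 0.
    rewrite (_ : (fun _ => _) = fun=> 0); last by apply/funext => n; rewrite mul0r.
    by rewrite mul0e; case: asboolP => [_|[]]; [rewrite Lim0|exact: bounded_seq_cst].
  case: asboolP => h; case: asboolP => h'.
  + by rewrite LimZ.
  + exfalso; apply: h'; have := bounded_seqZ c^-1 h; congr bounded_seq.
    by apply/funext => n; rewrite mulKf.
  + by exfalso; apply: h; exact: bounded_seqZ.
  + by rewrite gt0_muley// lte_fin lt_neqAle eq_sym cn0.
- move=> T S bT aT; have dE : dix (S \o T) = dix (T \o S).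
    by apply/funext => n; rewrite /dix sigma_tracial.
  by rewrite /dixmier_weight dE.
- move=> P fP; have [B PB] := sigma_finite_rank fP.
  have pP : positive_op P.
    have [bP PP aP _] := fP; split => // xi.
    by rewrite -PP -[(P \o P) xi]/(P (P xi)) -aP.2 inner_self ler0c nsq_ge0.
  have B0 : 0 <= B := le_trans (sigma_ge0 0 pP) (PB 0%N).
  have d0 : dix P n @[n --> \oo] --> (0 : R).
    have h : B * (ln n%:R)^-1 @[n --> \oo] --> (0 : R).
      by rewrite -[X in _ --> X](mulr0 B); apply: cvgMl_tmp; exact: inv_ln_cvg0.
    apply: (squeeze_cvgr _ (cvg_cst 0) h); apply: nearW => n.
    by rewrite dix_ge0//= ler_wpM2r ?invr_ge0 ?ln_nat_ge0.
  rewrite /dixmier_weight asboolT; last exact: cvg_bounded_seq d0.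
  by rewrite (Lim_cvg L d0).
Qed.

End Dixmier.
End Lim.
End GeneralizedLimits.

(** * Diagonal operators *)

Section WeightedComposition.
Context {R : realType} {X : choiceType}.
Local Notation C := R[i].
Local Notation H := (ell2 R X).
Implicit Types (xi eta : H) (c : X -> C) (pi : X -> X) (t s : X -> R).

Lemma esum_support (A : set X) (f : X -> \bar R) : (forall x, ~ A x -> f x = 0%E) ->
  (\esum_(x in [set: X]) f x = \esum_(x in A) f x)%E.
Proof.
move=> f0; rewrite [RHS]esum_mkcond; apply: eq_esum => x _.
by case: ifPn => // /negP; rewrite inE => /f0.
Qed.

Lemma esum_reindex_inj (A : set X) pi (f g : X -> \bar R) : {in A &, injective pi} ->
  (forall y, ~ (pi @` A) y -> f y = 0%E) -> (forall x, ~ A x -> g x = 0%E) ->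
  (forall x, A x -> f (pi x) = g x) ->
  (\esum_(y in [set: X]) f y = \esum_(x in [set: X]) g x)%E.
Proof.
move=> ip f0 g0 fg; rewrite (esum_support f0) (esum_support g0) esum_image//.
exact: eq_esum.
Qed.

Lemma rsum_reindex_inj (A : set X) pi (f g : X -> R) : {in A &, injective pi} ->
  (forall y, ~ (pi @` A) y -> f y = 0) -> (forall x, ~ A x -> g x = 0) ->
  (forall x, A x -> f (pi x) = g x) -> rsum f = rsum g.
Proof.
move=> ip f0 g0 fg; rewrite /rsum; congr (fine _ - fine _);
  apply: (@esum_reindex_inj A pi) => // [y /f0 ->|x /g0 ->|x /fg ->//];
  by rewrite ?oppr0 maxxx.
Qed.

Definition wcomp c pi xi : H := insubd (0 : H) ((fun x => c x * xi (pi x)) : X -> C^o).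

(** Injectivity of [pi] is asked only where the weight is nonzero. Then no coordinate of the
    argument is counted twice, and the square norm grows by a factor at most [M]. *)
Definition wcomp_ok (M : R) c pi :=
  (forall x, abs2 (c x) <= M) /\
  (forall x y, c x != 0 -> c y != 0 -> pi x = pi y -> x = y).

Lemma wcomp_sum M c pi xi : wcomp_ok M c pi ->
  (\esum_(x in [set: X]) (abs2 (c x * xi (pi x)))%:E <= M%:E * (nsq xi)%:E)%E.
Proof.
move=> [cM ic].
have M0 (x : X) : 0 <= M by apply: le_trans (cM x); exact: abs2_ge0.
pose A := [set x | c x != 0].
rewrite (@esum_support A); last first.
  by move=> x /negP; rewrite negbK => /eqP ->; rewrite mul0r abs2_0.
have [[x0 _]|A0] := pselect (A !=set0); last first.
  rewrite esum1; last by move=> x Ax; exfalso; apply: A0; exists x.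
  (* A point of the index set is what shows [M] to be nonnegative; on an empty index set both sides
     are 0. *)
  have [[x _]|nX] := pselect ([set: X] !=set0).
    by rewrite mule_ge0 ?lee_fin ?nsq_ge0//; exact: M0 x.
  rewrite (_ : nsq xi = 0) ?mule0//.
  by apply: EFin_inj; rewrite nsqE /sqnorm esum1// => x _; exfalso; apply: nX; exists x.
apply: (@le_trans _ _ (\esum_(x in A) (M * abs2 (xi (pi x)))%:E)%E).
  by apply: le_esum => x _; rewrite lee_fin abs2M ler_wpM2r ?abs2_ge0.
have ip : {in A &, injective pi} by move=> x y /[!inE] Ax Ay; exact: ic.
rewrite -(esum_image A pi (fun y => (M * abs2 (xi y))%:E))//.
rewrite nsqE /sqnorm -ge0_esumZ//; last 2 first.
- exact: M0 x0.
- by move=> x; exact: abs2_ge0.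
rewrite [leLHS]esum_mkcond; apply: le_esum => x _; case: ifP => // _.
by rewrite lee_fin mulr_ge0 ?abs2_ge0//; exact: M0 x0.
Qed.

Lemma wcompE M c pi xi x : wcomp_ok M c pi -> wcomp c pi xi x = c x * xi (pi x).
Proof.
move=> ok; have h : ((fun x => c x * xi (pi x)) : X -> C^o) \in sqsummable.
  apply: sqsummableP; rewrite /abs_summable.
  under eq_esum do rewrite ger0_norm ?abs2_ge0//.
  by apply: le_lt_trans (wcomp_sum xi ok) _; rewrite -EFinM ltry.
exact: (congr1 (fun f : X -> C^o => f x) (insubdK (0 : H) h)).
Qed.

Lemma wcomp_nsq M c pi xi : wcomp_ok M c pi -> nsq (wcomp c pi xi) <= M * nsq xi.
Proof.
move=> ok; rewrite -lee_fin EFinM nsqE; apply: le_trans (wcomp_sum xi ok).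
by rewrite /sqnorm; apply: le_esum => x _; rewrite (wcompE _ _ ok).
Qed.

Lemma wcomp_bounded M c pi : wcomp_ok M c pi -> bounded_op (wcomp c pi).
Proof.
move=> ok; apply: (@bounded_opP _ _ _ M); last by move=> xi; exact: wcomp_nsq.
move=> a xi eta; apply: ell2_eq => x.
rewrite (wcompE _ _ ok) ell2D ell2Z ell2D ell2Z !(wcompE _ _ ok); ring.
Qed.

Lemma wcomp_adjoint M c pi c' rho (A : set X) : wcomp_ok M c pi -> wcomp_ok M c' rho ->
  {in A &, injective pi} -> (forall x, A x -> rho (pi x) = x) ->
  (forall x, ~ A x -> c x = 0) -> (forall y, ~ (pi @` A) y -> c' y = 0) ->
  (forall x, A x -> c x = conjc (c' (pi x))) ->
  adjoint_op (wcomp c' rho) (wcomp c pi).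
Proof.
move=> ok ok' ip rp c0 c0' cc; split; first exact: wcomp_bounded ok.
move=> xi eta.
have e y : Num.conj (wcomp c' rho xi y) * eta y = conjc (c' y) * (Num.conj (xi (rho y)) * eta y).
  by rewrite (wcompE _ _ ok') conjcE conjcM -conjcE mulrA.
have e' x : Num.conj (xi x) * wcomp c pi eta x = c x * (Num.conj (xi x) * eta (pi x)).
  by rewrite (wcompE _ _ ok); ring.
rewrite /inner; congr (_ +i* _); apply: (@rsum_reindex_inj A pi) => //.
- by move=> y /c0' y0; rewrite e y0 conjc0 mul0r.
- by move=> x /c0 x0; rewrite e' x0 mul0r.
- by move=> x Ax; rewrite e e' rp// (cc x Ax).
- by move=> y /c0' y0; rewrite e y0 conjc0 mul0r.
- by move=> x /c0 x0; rewrite e' x0 mul0r.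
- by move=> x Ax; rewrite e e' rp// (cc x Ax).
Qed.

Lemma mul_op_ok (M : R) (g : X -> C) : (forall x, abs2 (g x) <= M) -> wcomp_ok M g id.
Proof. by move=> gM; split. Qed.

Lemma mul_opE (M : R) (g : X -> C) xi x : (forall x, abs2 (g x) <= M) ->
  mul_op g xi x = g x * xi x.
Proof. by move=> gM; exact: (wcompE _ _ (mul_op_ok gM)). Qed.

Definition diag t : H -> H := mul_op (fun x => (t x)%:C).

Definition nnb t := (forall x, 0 <= t x) /\ exists M : R, forall x, t x <= M.

Lemma nnb_ok t : nnb t -> exists M : R, wcomp_ok M (fun x => (t x)%:C) id.
Proof.
move=> [t0 [M tM]]; exists (M ^+ 2); split=> // x.
rewrite abs2_real lerXn2r// nnegrE//; exact: le_trans (tM x).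
Qed.

Lemma diagE t xi x : nnb t -> diag t xi x = (t x)%:C * xi x.
Proof. by move=> /nnb_ok[M ok]; exact: wcompE ok. Qed.

Lemma diag_bounded t : nnb t -> bounded_op (diag t).
Proof. by move=> /nnb_ok[M ok]; exact: wcomp_bounded ok. Qed.

Lemma diag_adjoint t : nnb t -> adjoint_op (diag t) (diag t).
Proof.
move=> /nnb_ok[M ok]; apply: (wcomp_adjoint (A := setT) ok ok) => //.
  by move=> x [].
by move=> x _; rewrite conjc_real.
Qed.

Lemma inner_diag t xi : nnb t ->
  abs_summable (fun x => t x * abs2 (xi x)) /\
  inner xi (diag t xi) = (psum (fun x => t x * abs2 (xi x)))%:C.
Proof.
move=> nt; have [t0 [M tM]] := nt.
have e x : Num.conj (xi x) * diag t xi x = (t x * abs2 (xi x))%:C.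
  by rewrite diagE// rmorphM [X in _ = _ * X]abs2E; ring.
have st : abs_summable (fun x => t x * abs2 (xi x)).
  have := abs_summable_Re xi (diag t xi).
  by apply: abs_summable_le => x; rewrite e.
split => //; rewrite /inner; congr (_ +i* _).
  rewrite -rsum_psum//; last by move=> x; rewrite mulr_ge0 ?abs2_ge0.
  by apply: eq_rsum => x; rewrite e.
rewrite (@eq_rsum _ _ _ (fun=> 0)); last by move=> x; rewrite e.
by rewrite /rsum oppr0 subrr.
Qed.

Lemma diag_positive t : nnb t -> positive_op (diag t).
Proof.
move=> nt; split; first exact: diag_bounded.
move=> xi; have [_ ->] := inner_diag xi nt; rewrite ler0c psum_ge0// => x.
by rewrite mulr_ge0 ?abs2_ge0//; case: nt.
Qed.

Lemma nnbD s t : nnb s -> nnb t -> nnb (fun x => s x + t x).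
Proof.
move=> [s0 [M sM]] [t0 [N tN]]; split=> [x|]; first by rewrite addr_ge0.
by exists (M + N) => x; rewrite lerD.
Qed.

Lemma nnbZ (a : R) t : 0 <= a -> nnb t -> nnb (fun x => a * t x).
Proof.
move=> a0 [t0 [N tN]]; split=> [x|]; first by rewrite mulr_ge0.
by exists (a * N) => x; rewrite ler_wpM2l.
Qed.

Lemma nnb_le s t : (forall x, 0 <= s x) -> (forall x, s x <= t x) -> nnb t -> nnb s.
Proof. by move=> s0 st [_ [M tM]]; split => //; exists M => x; exact: le_trans (tM x). Qed.

Lemma diagD s t : nnb s -> nnb t -> diag (fun x => s x + t x) = diag s \+ diag t.
Proof.
move=> ns nt; apply/funext => xi; apply: ell2_eq => x.
by rewrite ell2D !diagE ?rmorphD ?mulrDl//; exact: nnbD.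
Qed.

Lemma diagZ (a : R) t : 0 <= a -> nnb t -> diag (fun x => a * t x) = (fun xi => a%:C *: diag t xi).
Proof.
move=> a0 nt; apply/funext => xi; apply: ell2_eq => x.
by rewrite ell2Z !diagE ?rmorphM ?mulrA//; exact: nnbZ.
Qed.

Lemma diag_comp s t : nnb s -> nnb t -> nnb (fun x => s x * t x) ->
  diag s \o diag t = diag (fun x => s x * t x).
Proof.
move=> ns nt nst; apply/funext => xi; apply: ell2_eq => x.
by rewrite -[(diag s \o diag t) xi]/(diag s (diag t xi)) !diagE// rmorphM mulrA.
Qed.

(** The support condition covers both uses: the range of a diagonal projection and an eigenspace of
    a diagonal operator. *)
Lemma has_dim_ebas (V : set H) (A : set X) (k : nat) : (A #= `I_k)%card ->
  (forall xi, V xi <-> forall x, ~ A x -> xi x = 0) -> has_dim V k.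
Proof.
move=> /card_set_bijP[rk [rA ri rs]] VE.
have /choice[b bP] : forall i : 'I_k, exists x, A x /\ rk x = i.
  by move=> i; have [x Ax <-] := rs i (ltn_ord i); exists x.
have b_inj i j : b i = b j -> i = j.
  by move=> e; apply: val_inj; rewrite /= -(bP i).2 -(bP j).2 e.
exists (fun i : 'I_k => ebas (b i)); split.
  move=> c h i; have := congr1 (inner (ebas (b i))) h.
  rewrite inner0r inner_sumr (bigD1 i)//= innerZr inner_ebas ebasE eqxx mulr1.
  rewrite big1 ?addr0// => j ji; rewrite innerZr inner_ebas ebasE.
  by case: eqP => [/b_inj ij|]; [rewrite ij eqxx in ji|rewrite mulr0].
have off (c : 'I_k -> C) x : ~ A x -> inner (ebas x) (\sum_i c i *: ebas (b i)) = 0.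
  move=> nAx; rewrite inner_sumr big1// => i _; rewrite innerZr inner_ebas ebasE.
  by case: eqP => [xb|]; [case: nAx; rewrite xb; case: (bP i)|rewrite mulr0].
apply/seteqP; split=> [xi /VE xi0|xi [c ->]]; last first.
  by apply/VE => x nAx; rewrite -inner_ebas off.
exists (fun i => xi (b i)); apply: ell2_eq => x; rewrite -[RHS]inner_ebas.
have [Ax|nAx] := pselect (A x); last by rewrite off// xi0.
pose j := Ordinal (rA x Ax).
have bj : b j = x by apply: ri; rewrite ?inE//; [case: (bP j)|case: (bP j)].
rewrite inner_sumr (bigD1 j)//= innerZr inner_ebas ebasE bj eqxx mulr1.
rewrite big1 ?addr0// => i ij; rewrite innerZr inner_ebas ebasE.
by case: eqP => [xb|]; [rewrite -bj in xb; rewrite (b_inj _ _ xb) eqxx in ij|rewrite mulr0].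
Qed.

End WeightedComposition.

(** * Singular traces of diagonal operators *)

Section DiagonalTrace.
Context {R : realType} {X : choiceType}.
Local Notation H := (ell2 R X).
Variables (tau : (H -> H) -> \bar R) (st : singular_trace tau).
Implicit Types (t s : X -> R) (pi : X -> X).

Definition dtrace t := tau (diag t).

Lemma dtrace_ge0 t : nnb t -> (0 <= dtrace t)%E.
Proof. by move=> nt; apply: (singular_trace_ge0 st); exact: diag_positive. Qed.

Lemma dtraceD s t : nnb s -> nnb t -> dtrace (fun x => s x + t x) = (dtrace s + dtrace t)%E.
Proof.
by move=> ns nt; rewrite /dtrace diagD// (singular_traceD st)//; exact: diag_positive.
Qed.

Lemma dtraceZ (a : R) t : 0 <= a -> nnb t -> dtrace (fun x => a * t x) = (a%:E * dtrace t)%E.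
Proof.
by move=> a0 nt; rewrite /dtrace diagZ// (singular_traceZ st)//; exact: diag_positive.
Qed.

Lemma le_dtrace s t : nnb s -> nnb t -> (forall x, s x <= t x) -> (dtrace s <= dtrace t)%E.
Proof.
move=> ns nt sle; have nd : nnb (fun x => t x - s x).
  by apply: (nnb_le _ _ nt) => x; rewrite ?subr_ge0// gerBl; case: ns.
rewrite (_ : t = fun x => s x + (t x - s x)); last by apply/funext => x; rewrite subrKC.
by rewrite dtraceD// leeDl// dtrace_ge0.
Qed.

(** Let U be composition with [pi] weighted by the square root of [s]. Then U U^* is [diag s], and
    U^* U is diagonal with the weight [s] carried over to the image of [A]. The tracial property
    equates their traces, and the carried weight is dominated by [t]. *)
Lemma dtrace_dom s t pi (A : set X) : nnb s -> nnb t -> {in A &, injective pi} ->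
  (forall x, A x -> s x <= t (pi x)) -> (forall x, ~ A x -> s x = 0) ->
  (dtrace s <= dtrace t)%E.
Proof.
move=> ns nt ip spi s0; have [sge0 [M sM]] := ns; have [t0 _] := nt.
(* An inverse of [pi] on the image of [A]; its values elsewhere are harmless because the weight [c']
   vanishes there. *)
have /choice[rho rhoP] : forall y, exists x, (pi @` A) y -> A x /\ pi x = y.
  move=> y; have [[x Ax e]|n] := pselect ((pi @` A) y); first by exists x.
  by exists y.
have rp x : A x -> rho (pi x) = x.
  move=> Ax; have [|A1 e] := rhoP (pi x); first by exists x.
  by apply: ip => //; rewrite inE.
pose s' y := if pselect ((pi @` A) y) then s (rho y) else 0.
have s'0 y : 0 <= s' y by rewrite /s'; case: pselect => ? /=; [exact: sge0|exact: lexx].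
have ns' : nnb s'.
  split=> //; exists (Num.max M 0) => y; rewrite /s'; case: pselect => ? /=.
    by apply: le_trans (sM _) _; rewrite le_max lexx.
  by rewrite le_max lexx orbT.
pose c x : R[i] := (Num.sqrt (s x))%:C.
pose c' y : R[i] := (Num.sqrt (s' y))%:C.
have sq0 (r : R) : 0 <= r -> (Num.sqrt r)%:C != 0 :> R[i] -> r != 0.
  by move=> r0; apply: contraNN => /eqP ->; rewrite sqrtr0.
have cA x : c x != 0 -> A x.
  move=> /(sq0 _ (sge0 x)) sx; have [//|/s0 e] := pselect (A x).
  by rewrite e eqxx in sx.
have c'A y : c' y != 0 -> (pi @` A) y.
  move=> /(sq0 _ (s'0 y)); rewrite /s'; case: pselect => // ? /=; by rewrite eqxx.
have ok : wcomp_ok (Num.max M 0) c pi.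
  split=> [x|x y /cA Ax /cA Ay]; last by apply: ip; rewrite inE.
  by rewrite abs2_real sqr_sqrtr// (le_trans (sM x))// le_max lexx.
have ok' : wcomp_ok (Num.max M 0) c' rho.
  split=> [x|x y /c'A/rhoP[_ e1] /c'A/rhoP[_ e2] e3]; last by rewrite -e1 -e2 e3.
  rewrite abs2_real sqr_sqrtr// /s'; case: pselect => ? /=.
    by rewrite (le_trans (sM _))// le_max lexx.
  by rewrite le_max lexx orbT.
have s'pi x : A x -> s' (pi x) = s x.
  by move=> Ax; rewrite /s'; case: pselect => [?|[]] /=; [rewrite rp|exists x].
have adj : adjoint_op (wcomp c' rho) (wcomp c pi).
  apply: (wcomp_adjoint (A := A) ok ok') => //.
  - by move=> x /s0 e; rewrite /c e sqrtr0.
  - by move=> y ny; rewrite /c' /s'; case: pselect => // ? /=; rewrite sqrtr0.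
  - by move=> x Ax; rewrite conjc_real /c /c' s'pi.
have := singular_trace_tracial st (wcomp_bounded ok') adj.
rewrite (_ : wcomp c pi \o wcomp c' rho = diag s); last first.
  apply/funext => xi; apply: ell2_eq => x.
  rewrite -[(_ \o _) xi]/(wcomp c pi (wcomp c' rho xi)) (wcompE _ _ ok) (wcompE _ _ ok') diagE//.
  have [Ax|/s0 e] := pselect (A x).
    by rewrite /c /c' rp// s'pi// mulrA -rmorphM -expr2 sqr_sqrtr.
  by rewrite /c e sqrtr0 !mul0r.
rewrite (_ : wcomp c' rho \o wcomp c pi = diag s'); last first.
  apply/funext => xi; apply: ell2_eq => y.
  rewrite -[(_ \o _) xi]/(wcomp c' rho (wcomp c pi xi)) (wcompE _ _ ok') (wcompE _ _ ok) diagE//.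
  have [/rhoP[A1 A2]|ny] := pselect ((pi @` A) y).
    by rewrite /c /c' -(s'pi _ A1) A2 mulrA -rmorphM -expr2 sqr_sqrtr.
  by rewrite /c' /s'; case: pselect => // ? /=; rewrite sqrtr0 !mul0r.
rewrite -/(dtrace s) -/(dtrace s') => ->; apply: le_dtrace => // y.
rewrite /s'; case: pselect => //= piA; have [A1 A2] := rhoP _ piA.
by rewrite -{2}A2; exact: spi.
Qed.

(** The weight is at most a constant times the indicator of [A], whose diagonal operator is a finite
    rank projection. *)
Lemma dtrace_finite t (A : set X) : nnb t -> finite_set A -> (forall x, ~ A x -> t x = 0) ->
  dtrace t = 0%E.
Proof.
move=> nt fA t0; have [tge0 [M tM]] := nt.
pose p x : R := if pselect (A x) then 1 else 0.
have np : nnb p.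
  by split=> [x|]; [|exists 1 => x]; rewrite /p; case: pselect.
have tp : dtrace p = 0%E.
  apply: (singular_trace_finite_rank st); split.
  - exact: diag_bounded.
  - have pp : (fun x => p x * p x) = p.
      by apply/funext => x; rewrite /p; case: pselect => ? /=; rewrite ?mulr1 ?mulr0.
    by rewrite diag_comp// pp.
  - exact: diag_adjoint.
  - have [k Ak] := (finite_setP A).1 fA; exists k; apply: (has_dim_ebas Ak) => xi; split.
      move=> [eta _ <-] x nA; rewrite diagE// /p; case: pselect => // ? /=; by rewrite mul0r.
    move=> xi0; exists xi => //; apply: ell2_eq => x; rewrite diagE// /p.
    by case: pselect => [?|/xi0 ->] /=; rewrite ?mul1r ?mulr0.
apply/eqP; rewrite eq_le dtrace_ge0// andbT.
have M0 : 0 <= Num.max M 0 by rewrite le_max lexx orbT.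
rewrite -(mule0 (Num.max M 0)%:E) -tp -dtraceZ//; apply: le_dtrace => //; first exact: nnbZ.
move=> x; rewrite /p; case: pselect => [?|/t0 ->] /=; last by rewrite mulr0.
by rewrite mulr1 le_max tM.
Qed.

Lemma dtrace_sum (I : Type) (r : seq I) (t : I -> X -> R) : (forall i, nnb (t i)) ->
  nnb (fun x => \sum_(i <- r) t i x) /\
  dtrace (fun x => \sum_(i <- r) t i x) = (\sum_(i <- r) dtrace (t i))%E.
Proof.
move=> nt; elim: r => [|i r [n1 IH]].
  have n0 : nnb (fun x : X => \sum_(i <- [::]) t i x).
    by split=> [x|]; [|exists 0 => x]; rewrite big_nil.
  split => //; rewrite big_nil; apply: (@dtrace_finite _ set0) => // x _.
  by rewrite big_nil.
have e : (fun x => \sum_(j <- i :: r) t j x) = (fun x => t i x + \sum_(j <- r) t j x).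
  by apply/funext => x; rewrite big_cons.
by rewrite e big_cons -IH; split; [exact: nnbD|exact: dtraceD].
Qed.

End DiagonalTrace.

Lemma subset_card_eq (T : choiceType) (A B : set T) (k : nat) :
  A `<=` B -> (A #= `I_k)%card -> (B #= `I_k)%card -> A = B.
Proof.
move=> AB cA cB; have fB : finite_set B by apply/finite_setP; exists k.
have fA := sub_finite_set AB fB; rewrite -(fset_setK fA) -(fset_setK fB).
suff -> : fset_set A = fset_set B by [].
apply/eqP; rewrite eqEfcard (card_fset_set cA) (card_fset_set cB) leqnn andbT.
by rewrite -fset_set_sub.
Qed.

(** * Integrals of step functions *)

Section StepIntegral.
Context {R : realType}.
Variable m : nat -> R.
Hypotheses (m0 : forall i, 0 <= m i) (hm : {homo m : i j / (i <= j)%N >-> j <= i}).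
Local Notation step := (fun u : R => m (Num.truncn u)).

Lemma step_integrable (x y : R) (bx by_ : bool) :
  lebesgue_measure.-integrable [set` Interval (BSide bx x) (BSide by_ y)] (EFin \o step).
Proof.
apply: measurable_bounded_integrable => //.
- rewrite /= lebesgue_measure_itv /=; case: ifP => _ //.
  by rewrite -EFinB ltry.
- apply: nonincreasing_measurable => // u v uv.
  by apply: hm; exact: le_truncn.
- exists (m 0%N); split; first exact: num_real.
  move=> z mz u _ /=; rewrite ger0_norm//; apply: le_trans (ltW mz); exact: hm.
Qed.

Lemma step_integralD (x y : R) : 0 <= x -> x <= y ->
  \int[lebesgue_measure]_(u in `[0, y]) step u =
  \int[lebesgue_measure]_(u in `[0, x]) step u + \int[lebesgue_measure]_(u in `]x, y]) step u.
Proof.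
move=> x0 xy; rewrite -(@Rintegral_itvB _ _ (BLeft 0) (BRight y) x); first by rewrite addrC subrK.
- exact: step_integrable.
- by rewrite bnd_simp.
- by rewrite bnd_simp.
Qed.

Lemma step_integral_homo (x y : R) : 0 <= x -> x <= y ->
  \int[lebesgue_measure]_(u in `[0, x]) step u <= \int[lebesgue_measure]_(u in `[0, y]) step u.
Proof. by move=> x0 xy; rewrite (step_integralD x0 xy) lerDl Rintegral_ge0. Qed.

Lemma step_integral_nat (n : nat) :
  \int[lebesgue_measure]_(u in `[0, n%:R]) step u = \sum_(i < n) m i.
Proof.
elim: n => [|n IH].
  rewrite big_ord0 (_ : [set` _] = [set 0]) ?Rintegral_set1//.
  by rewrite set_itv1.
rewrite big_ord_recr -IH /= (@step_integralD n%:R)//; last by rewrite ler_nat.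
congr (_ + _).
(* The endpoints are exchanged, at no cost in measure, to reach the half-open interval on which the
   truncation is constantly n. *)
rewrite Rintegral_itv_obnd_cbnd; last exact: step_integrable.
rewrite -Rintegral_itv_bndo_bndc; last exact: step_integrable.
rewrite (@eq_Rintegral _ _ _ _ _ (fun=> m n)); last first.
  move=> u; rewrite inE /= in_itv /= => un; rewrite (truncn_def un)//.
rewrite Rintegral_cst//= lebesgue_measure_itv /= lte_fin ltr_nat ltnSn.
by rewrite -EFinB /= -natrB// subSnn mulr1.
Qed.

End StepIntegral.

(** * Singular values and compactness of diagonal operators *)

Section SingularValues.
Context {R : realType} {X : choiceType}.
Local Notation C := R[i].
Local Notation H := (ell2 R X).
Implicit Types (xi eta : H) (t : X -> R) (V : set H).

(** If k < k', the k' by k matrix of coordinates has a nonzero left kernel vector, which is a linear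
    relation among the independent vectors [e']. *)
Lemma has_dim_le V k k' : has_dim V k -> has_dim V k' -> (k' <= k)%N.
Proof.
move=> [e [_ Ve]] [e' [fe' Ve']]; rewrite leqNgt; apply/negP => kk'.
have /choice[c cP] : forall j : 'I_k', exists c : 'I_k -> C, e' j = \sum_i c i *: e i.
  move=> j; have : V (e' j).
    rewrite Ve'; exists (fun i => (i == j)%:R).
    by rewrite (bigD1 j)//= eqxx scale1r big1 ?addr0// => i /negbTE ->; rewrite scale0r.
  by rewrite Ve => -[c ->]; exists c.
pose M := (\matrix_(j < k', i < k) c j i : 'M[C]_(k', k)).
have nM : kermx M != 0.
  rewrite kermx_eq0 /row_free; apply/negP => /eqP rM.
  by have := rank_leq_col M; rewrite rM leqNgt kk'.
have /rowV0Pn[v vM v0] := nM.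
have vM0 : v *m M = 0 by apply/sub_kermxP.
have h : \sum_j v 0 j *: e' j = 0.
  under eq_bigr do rewrite cP scaler_sumr.
  rewrite exchange_big big1//= => i _.
  under eq_bigr do rewrite scalerA.
  rewrite -scaler_suml (_ : \sum_j _ = 0) ?scale0r//.
  transitivity ((v *m M) 0 i); last by rewrite vM0 mxE.
  by rewrite mxE; apply: eq_bigr => j _; rewrite mxE.
have /eqP := v0; apply; apply/rowP => j; rewrite mxE.
exact: (fe' (fun j => v 0 j) h).
Qed.

Lemma has_dim_unique V k k' : has_dim V k -> has_dim V k' -> k = k'.
Proof.
by move=> h h'; apply/eqP; rewrite eqn_leq (has_dim_le h h') (has_dim_le h' h).
Qed.

(* (|T| + t)(|T| e - t e) = 0 for a basis vector e, and -t is not an eigenvalue of the positive |T|. *)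
Lemma is_abs_op_diag t (A : H -> H) : nnb t -> is_abs_op (diag t) A -> A = diag t.
Proof.
move=> nt [pA [S [bS aS] AA]]; have lA := pA.1.1; have aA := positive_op_adjoint pA.
have SE : S = diag t.
  apply/funext => xi; apply: inner_eq => zeta.
  by rewrite -aS (diag_adjoint nt).2.
have AE x : A (ebas x) = (t x)%:C *: ebas x.
  have de y : diag t (ebas y) = (t y)%:C *: ebas y.
    apply: ell2_eq => z; rewrite diagE// ell2Z !ebasE.
    by case: eqP => [->//|_]; rewrite !mulr0.
  have A2 : A (A (ebas x)) = (t x ^+ 2)%:C *: ebas x.
    rewrite -[A (A _)]/((A \o A) _) AA SE -[(diag t \o _) _]/(diag t (diag t _)).
    by rewrite !de (linear_opZ (diag_bounded nt).1) de scalerA -rmorphM.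
  pose eta := A (ebas x) - (t x)%:C *: ebas x.
  have Aeta : A eta = - (t x)%:C *: eta.
    rewrite (linear_opB lA) (linear_opZ lA) A2 /eta scalerBr scalerA mulNr -rmorphM -expr2.
    by rewrite !scaleNr opprK addrC.
  suff eta0 : eta = 0 by apply/eqP; rewrite -subr_eq0 -/eta eta0.
  have [t0 _] := nt.
  have [tx0|tx0] := eqVneq (t x) 0.
    apply: nsq_eq0; apply: complexI; rewrite -inner_self.
    have -> : eta = A (ebas x) by rewrite /eta tx0 scale0r subr0.
    by rewrite aA.2 A2 tx0 expr0n scale0r inner0r.
  have := pA.2 eta; rewrite Aeta innerZr inner_self -rmorphN -rmorphM ler0c mulNr oppr_ge0.
  rewrite pmulr_rle0; last by rewrite lt_neqAle eq_sym tx0 t0.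
  by move=> h; apply: nsq_eq0; apply/eqP; rewrite eq_le h nsq_ge0.
apply/funext => xi; apply: ell2_eq => x.
by rewrite diagE// -inner_ebas -aA.2 AE innerZl conjc_real inner_ebas.
Qed.

(** At the first index of disagreement, the larger of the two values still occurs in one sequence
    but never again in the other; all its occurrences in the latter are earlier and shared, so the
    finite multiplicities differ. This determines the sequence that [mu_] chooses. *)
Lemma eq_nonincreasing_multiplicity (m m' : nat -> R) :
  {homo m : i j / (i <= j)%N >-> j <= i} -> {homo m' : i j / (i <= j)%N >-> j <= i} ->
  m n @[n --> \oo] --> (0 : R) -> m' n @[n --> \oo] --> (0 : R) ->
  (forall lam : R, 0 < lam -> exists k : nat,
    ([set n | m n = lam] #= `I_k)%card /\ ([set n | m' n = lam] #= `I_k)%card) ->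
  m = m'.
Proof.
move=> hm hm' m0 m'0 card_m; apply/funext => n.
have ge0 (u : nat -> R) : {homo u : i j / (i <= j)%N >-> j <= i} ->
    u i @[i --> \oo] --> (0 : R) -> forall i, 0 <= u i.
  move=> hu u0 i; rewrite -(cvg_lim _ u0)//; apply: limr_le.
    by apply/cvg_ex; exists 0.
  by near=> j; apply: hu; near: j; exact: nbhs_infty_ge.
have key (u v : nat -> R) (k : nat) : {homo v : i j / (i <= j)%N >-> j <= i} ->
    (forall i, (i < k)%N -> u i = v i) -> v k < u k -> 0 < u k ->
    (exists j : nat, ([set n | u n = u k] #= `I_j)%card /\ ([set n | v n = u k] #= `I_j)%card) ->
    False.
  move=> hv uv vk uk [j [cu cv]].
  have sub : [set n | v n = u k] `<=` [set n | u n = u k].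
    move=> i /= vi; rewrite -vi uv//; rewrite ltnNge; apply/negP => ki.
    by have := hv _ _ ki; rewrite vi leNgt vk.
  have fu : finite_set [set n | u n = u k] by apply/finite_setP; exists j.
  have fv := sub_finite_set sub fu.
  suff e : [set n | v n = u k] = [set n | u n = u k].
    have : [set n | v n = u k] k by rewrite e.
    by move=> /= vuk; rewrite vuk ltxx in vk.
  exact: subset_card_eq cv cu.
elim/ltn_ind: n => n IH.
have [mn|mn|//] := ltgtP (m n) (m' n).
- have p : 0 < m' n by apply: le_lt_trans mn; exact: ge0.
  case: (key m' m n) => //; first by move=> i /IH.
  by have [k [k1 k2]] := card_m _ p; exists k.
- have p : 0 < m n by apply: le_lt_trans mn; exact: ge0.
  case: (key m m' n) => //; exact: card_m.
Unshelve. all: by end_near. Qed.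

(** The form that compactness of [diag t] takes for a nonnegative bounded weight. *)
Definition finite_levels t := forall e : R, 0 < e -> finite_set [set x | e <= t x].

Lemma seq_argmax t (s : seq X) : s != [::] -> exists2 x, x \in s & forall y, y \in s -> t y <= t x.
Proof.
elim: s => // x s IH _; have [->|/IH[z zs zm]] := eqVneq s [::].
  by exists x; rewrite ?inE ?eqxx// => y; rewrite inE => /eqP ->.
have [xz|zx] := leP (t x) (t z).
  exists z; first by rewrite inE zs orbT.
  by move=> y; rewrite inE => /orP[/eqP -> //|/zm].
exists x; first by rewrite inE eqxx.
move=> y; rewrite inE => /orP[/eqP -> //|/zm yz].
exact: le_trans yz (ltW zx).
Qed.

(** If some value off [s] is positive, a maximum is found in a finite level set. Otherwise all
    remaining values are 0 and any point off [s] serves; infinity of the index set provides one. *)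
Lemma argmax_avoiding t (s : seq X) : infinite_set [set: X] -> (forall x, 0 <= t x) ->
  finite_levels t -> exists x, x \notin s /\ forall y, y \notin s -> t y <= t x.
Proof.
move=> iX t0 ft; have [[y [ys ty]]|none] := pselect (exists y, y \notin s /\ 0 < t y).
  have fl := ft _ ty.
  pose l := [seq x <- fset_set [set x | t y <= t x] | x \notin s].
  have lE x : x \in l = (x \notin s) && (t y <= t x).
    rewrite mem_filter; congr (_ && _); rewrite in_fset_set//.
    by apply/idP/idP => [/set_mem|/mem_set].
  have [|x xl xm] := @seq_argmax t l.
    by apply/eqP => l0; have := lE y; rewrite l0 ys lexx.
  exists x; move: (xl); rewrite lE => /andP[xs yx]; split=> // z zs.
  have [yz|zy] := leP (t y) (t z); first by apply: xm; rewrite lE zs.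
  exact: le_trans (ltW zy) yx.
have [x xs] : exists x, x \notin s.
  apply: contrapT => h; apply: iX; apply: (@sub_finite_set _ _ [set` s]); last exact: finite_seq.
  by move=> x _ /=; apply: contrapT => /negP xs; apply: h; exists x.
exists x; split=> // y ys; apply: le_trans (t0 x).
by rewrite leNgt; apply/negP => ty; apply: none; exists y.
Qed.

(** Surjectivity is not demanded: points of weight 0 may be missed, while [enum_surj] shows that
    those of positive weight are reached. *)
Definition decreasing_enum t (e : nat -> X) :=
  injective e /\ forall n y, (forall i, (i < n)%N -> y != e i) -> t y <= t (e n).

Lemma exists_decreasing_enum t : infinite_set [set: X] -> (forall x, 0 <= t x) ->
  finite_levels t -> exists e, decreasing_enum t e.
Proof.
move=> iX t0 ft; have [f fP] := choice (fun s => argmax_avoiding s iX t0 ft).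
(* [pre n] lists the first n choices, latest first; each choice maximizes the weight off the
   list. *)
pose pre := fix pre n := if n is n'.+1 then f (pre n') :: pre n' else [::].
have preP n y : reflect (exists2 i, (i < n)%N & y = f (pre i)) (y \in pre n).
  apply: (iffP idP) => [|h].
    elim: n => //= n IH; rewrite inE => /orP[/eqP ->|/IH[i ni ->]]; first by exists n.
    by exists i => //; exact: ltnW.
  case: h => i; elim: n => //= n IH; rewrite ltnS inE leq_eqVlt => /orP[/eqP -> -> |ni yi]; first by rewrite eqxx.
  by rewrite IH ?orbT.
exists (fun n => f (pre n)); split.
  suff lt i j : (i < j)%N -> f (pre i) <> f (pre j).
    move=> i j e; have [ij|ij|//] := ltngtP i j; first by case: (lt i j).
    by case: (lt j i).
  move=> ij e; have := (fP (pre j)).1; rewrite -e => /negP; apply.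
  by apply/preP; exists i.
move=> n y ny; apply: (fP (pre n)).2; apply/preP => -[i ni yi].
by have := ny i ni; rewrite yi eqxx.
Qed.

Section Enumerated.
Variables (t : X -> R) (e : nat -> X).
Hypotheses (nt : nnb t) (ft : finite_levels t) (de : decreasing_enum t e).

Let e_inj : injective e := de.1.

Lemma enum_nonincreasing : {homo t \o e : i j / (i <= j)%N >-> j <= i}.
Proof.
move=> i j ij /=; apply: de.2 => k ki; apply/eqP => /e_inj jk.
by move: ki; rewrite -jk ltnNge ij.
Qed.

Lemma enum_finite_level (lam : R) : 0 < lam -> finite_set [set n | lam <= t (e n)].
Proof.
move=> /ft; apply: (@finite_preimage _ _ [set x | lam <= t x] e).
by move=> x y _ _; exact: e_inj.
Qed.

Lemma enum_cvg0 : t (e n) @[n --> \oo] --> (0 : R).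
Proof.
apply/cvgrPdist_lt => eps eps0.
have [N Nb] : exists N, forall n, eps <= t (e n) -> (n < N)%N.
  have := enum_finite_level eps0 => fN.
  exists (\max_(i <- fset_set [set n | eps <= t (e n)]) i).+1 => n nn.
  by rewrite ltnS; apply: leq_bigmax_seq => //; rewrite in_fset_set//; exact: mem_set.
near=> n; rewrite sub0r normrN ger0_norm; last by case: nt.
rewrite ltNge; apply/negP => /Nb; rewrite ltnNge => /negP; apply.
by near: n; exact: nbhs_infty_ge.
Unshelve. all: by end_near. Qed.

Lemma enum_surj x : 0 < t x -> exists n, x = e n.
Proof.
move=> tx; apply: contrapT => h.
have all n : t x <= t (e n) by apply: de.2 => i _; apply/eqP => xi; apply: h; exists i.
apply: infinite_nat; apply: sub_finite_set (enum_finite_level tx) => n _; exact: all.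
Qed.

Lemma is_singular_values_diag : is_singular_values (diag t) (t \o e).
Proof.
exists (diag t).
  by split; [exact: diag_positive|exists (diag t) => //; exact: diag_adjoint].
split; [exact: enum_nonincreasing|exact: enum_cvg0|move=> lam lam0].
pose A := [set x | t x = lam].
have fA : finite_set A by apply: sub_finite_set (ft lam0) => x /= ->.
have [k Ak] := (finite_setP A).1 fA; exists k; split.
  rewrite (_ : A = e @` [set n | (t \o e) n = lam]) in Ak.
    by apply: card_eq_trans Ak; apply: card_esym; apply: inj_card_eq => x y _ _; exact: e_inj.
  apply/seteqP; split=> [x /= tx|_ [n /= en <-]//].
  have [|n xn] := enum_surj (x := x); first by rewrite tx.
  by exists n; rewrite // -xn.
apply: (has_dim_ebas Ak) => xi; split.
  move=> h x nx; have : diag t xi x = (lam%:C *: xi : H) x by rewrite h.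
  rewrite diagE// ell2Z => /eqP; rewrite -subr_eq0 -mulrBl mulf_eq0 => /orP[|/eqP //].
  by rewrite subr_eq0 => /eqP/complexI.
move=> xi0 /=; apply: ell2_eq => x; rewrite diagE// ell2Z.
by have [->//|/xi0 ->] := pselect (t x = lam); rewrite !mulr0.
Qed.

Let te_ge0 i : 0 <= t (e i). Proof. by case: nt. Qed.

Lemma mu_diag : mu_ (diag t) = t \o e.
Proof.
apply: xget_unique; first exact: is_singular_values_diag.
move=> m' [A /(is_abs_op_diag nt) -> [hm' m'0 dm']].
apply: eq_nonincreasing_multiplicity => //.
- exact: enum_nonincreasing.
- exact: enum_cvg0.
- have [A' /(is_abs_op_diag nt) -> [_ _ dm]] := is_singular_values_diag.
  move=> lam lam0; have [k [k1 k2]] := dm' _ lam0; have [j [j1 j2]] := dm _ lam0.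
  by exists k; split=> //; rewrite (has_dim_unique k2 j2).
Qed.

Lemma S_up_diag (n : nat) : S_up (diag t) n%:R = \sum_(i < n) t (e i).
Proof.
rewrite /S_up /mu_fun mu_diag.
exact: (step_integral_nat te_ge0 enum_nonincreasing n).
Qed.

Lemma S_up_homo (x y : R) : 0 <= x -> x <= y -> S_up (diag t) x <= S_up (diag t) y.
Proof.
rewrite /S_up /mu_fun mu_diag => x0 xy.
exact: (step_integral_homo te_ge0 enum_nonincreasing).
Qed.

End Enumerated.

Lemma nsq_ebas x : nsq (ebas x : H) = 1.
Proof. by apply: complexI; rewrite -inner_self inner_ebas ebasE eqxx. Qed.

Lemma onz_ebas (s : seq X) : uniq s -> onz [seq ebas x : H | x <- s].
Proof.
elim: s => //= x s IH /andP[xs us]; split; last exact: IH.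
  by left; rewrite inner_self nsq_ebas.
move=> h /mapP[y ys ->]; rewrite inner_ebas ebasE.
by case: eqP => // xy; rewrite xy ys in xs.
Qed.

Lemma sigma_diag_ge t (s : seq X) : nnb t -> uniq s ->
  \sum_(x <- s) t x <= sigma (size s) (diag t).
Proof.
move=> nt us; have := sigma_ge (diag_bounded nt) (onz_ebas us).
rewrite size_map trE big_map; apply: le_trans.
apply: ler_sum => x _; rewrite inner_ebas diagE// ebasE eqxx mulr1//.
Qed.

(* The weights [\sum_(v <- f) |v x|^2] of an orthonormal family are at most 1 by Bessel's inequality, and sum to at most [size f]. *)
Lemma sigma_diag_le t (n : nat) (s : seq X) (M : R) : nnb t -> uniq s -> 0 <= M ->
  (forall x, x \notin s -> t x <= M) ->
  sigma n (diag t) <= \sum_(x <- s) Num.max (t x - M) 0 + n%:R * M.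
Proof.
move=> nt us M0 tM; have [t0 _] := nt; apply: sigma_le => f nf sf.
rewrite trE.
have -> : \sum_(v <- f) complex.Re (inner v (diag t v)) =
    \sum_(v <- f) psum (fun x => t x * abs2 (v x)).
  by apply: eq_bigr => v _; have [_ ->] := inner_diag v nt.
have [sw ew] := psum_sum f (fun v x => abs2_ge0 (v x)) (fun v : H => abs_summable_abs2 v).
have [s2 e2] := psum_sum f (fun (v : H) x => mulr_ge0 (t0 x) (abs2_ge0 (v x)))
  (fun v => (inner_diag v nt).1).
rewrite -e2; under eq_fun do rewrite -mulr_sumr.
apply: psumM_le => //.
- by move=> x; apply: sumr_ge0 => v _; exact: abs2_ge0.
- move=> x; rewrite -(nsq_ebas x); apply: le_trans (bessel (ebas x) nf).
  apply: ler_sum => v _; rewrite inner_ebasr.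
  by case: (v x) => p q; rewrite /abs2 /= sqrrN.
- rewrite ew -[leRHS]mulr1 -sf; apply: sum_le_const => v vf; exact: (onz_nsq nf vf).
Qed.

Lemma sigma_diag t (e : nat -> X) (n : nat) : nnb t -> decreasing_enum t e ->
  sigma n (diag t) = \sum_(i < n) t (e i).
Proof.
move=> nt de; have [t0 _] := nt.
have us : uniq [seq e i | i <- iota 0 n] by rewrite map_inj_uniq ?iota_uniq//; exact: de.1.
have bE (F : nat -> R) : \sum_(j <- iota 0 n) F j = \sum_(i < n) F i.
  by rewrite -(big_mkord xpredT) /index_iota subn0.
apply/eqP; rewrite eq_le; apply/andP; split; last first.
  by have := sigma_diag_ge nt us; rewrite size_map size_iota big_map bE.
(* With threshold [t (e n)], the excesses of the first n entries and n copies of the threshold add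
   up to the sum of these entries. *)
have := @sigma_diag_le t n _ (t (e n)) nt us (t0 _); rewrite big_map bE.
rewrite (eq_bigr (fun i : 'I_n => t (e i) - t (e n))); last first.
  move=> i _; apply/max_idPl; rewrite subr_ge0; apply: (enum_nonincreasing de).
  exact: ltnW.
rewrite sumrB sumr_const card_ord -[t (e n) *+ n]mulr_natl subrK; apply.
move=> x xs; apply: de.2 => i ni; apply/eqP => xi; move: xs; rewrite xi map_f//.
by rewrite mem_iota.
Qed.

Lemma nsq_finite_diag (s : seq X) (t : X -> R) xi : nnb t -> uniq s ->
  (forall x, x \notin s -> t x = 0) ->
  nsq (diag t xi) = \sum_(x <- s) t x ^+ 2 * abs2 (xi x).
Proof.
move=> nt us t0; apply: EFin_inj; rewrite nsqE /sqnorm.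
rewrite (@esum_support _ _ [set` s]); last first.
  by move=> x /= /negP/t0 tx; rewrite diagE// tx mul0r abs2_0.
rewrite esum_fset//; last by move=> x _; rewrite lee_fin abs2_ge0.
rewrite -fsbig_seq//= sumEFin; congr EFin; apply: eq_bigr => x _.
by rewrite diagE// abs2M abs2_real.
Qed.

(** Weak compactness of balls, coordinate by coordinate along an ultrafilter. The limit family is
    square summable because each finite partial sum is a limit of numbers at most [M]. *)
Lemma ultra_weak_limit (W : set_system nat) (u : nat -> H) (M : R) : UltraFilter W ->
  (forall n, nsq (u n) <= M) -> exists w : H, nsq w <= M /\
  forall x (e : R), 0 < e -> W [set n | abs2 ((u n - w) x) < e].
Proof.
move=> UW uM; have WF : ProperFilter W by exact: ultra_proper.
have M0 : 0 <= M := le_trans (nsq_ge0 _) (uM 0%N).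
have coord x n : complex.Re (u n x) ^+ 2 + complex.Im (u n x) ^+ 2 <= M.
  apply: le_trans (uM n); rewrite -[leLHS]/(abs2 (u n x)).
  apply: (@psum_ge _ _ (fun x => abs2 (u n x)) x) => [y|]; first exact: abs2_ge0.
  exact: abs_summable_abs2.
have bd (a b : R) : a ^+ 2 + b ^+ 2 <= M -> `|a| <= M + 1 /\ `|b| <= M + 1.
  move=> h; have := sqr_ge0 a; have := sqr_ge0 b => b2 a2.
  by split; rewrite ler_norml; apply/andP; split; nra.
have cR x : cvg ((fun n => complex.Re (u n x)) @ W).
  by apply: (@ultra_bounded_cvg _ _ _ _ (M + 1)) => // n; have [] := bd _ _ (coord x n).
have cI x : cvg ((fun n => complex.Im (u n x)) @ W).
  by apply: (@ultra_bounded_cvg _ _ _ _ (M + 1)) => // n; have [] := bd _ _ (coord x n).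
pose w x : C^o := lim ((fun n => complex.Re (u n x)) @ W) +i* lim ((fun n => complex.Im (u n x)) @ W).
have cabs x : (fun n => abs2 (u n x)) @ W --> abs2 (w x).
  by rewrite /abs2 /=; apply: cvgD; rewrite expr2; under eq_fun do rewrite expr2; apply: cvgM.
have sw : (\esum_(x in [set: X]) (abs2 (w x))%:E <= M%:E)%E.
  apply: ge_ereal_sup => _ [F [fF _] <-].
  rewrite fsbig_finite//= sumEFin lee_fin.
  have cF (s : seq X) : (fun n => \sum_(x <- s) abs2 (u n x)) @ W --> \sum_(x <- s) abs2 (w x).
    elim: s => [|x s IH].
      by rewrite big_nil; under eq_fun do rewrite big_nil; exact: cvg_cst.
    by rewrite big_cons; under eq_fun do rewrite big_cons; exact: cvgD.
  apply: (cvgr_to_le (cF _)); apply: filterE => n; apply: le_trans (uM n).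
  rewrite -lee_fin nsqE -sumEFin -fsbig_finite//=.
  by apply: ereal_sup_ubound; exists F.
have sumw : abs_summable (fun x => abs2 (w x)).
  rewrite /abs_summable; under eq_esum do rewrite ger0_norm ?abs2_ge0//.
  exact: le_lt_trans sw (ltry _).
exists (mk_ell2 sumw); split; first by rewrite -lee_fin nsqE.
move=> x e e0.
have cd : (fun n => abs2 ((u n - mk_ell2 sumw) x)) @ W --> (0 : R).
  have -> : (fun n => abs2 ((u n - mk_ell2 sumw) x)) = (fun n =>
      (complex.Re (u n x) - complex.Re (w x)) ^+ 2 + (complex.Im (u n x) - complex.Im (w x)) ^+ 2).
    by apply/funext => n; rewrite ell2D ell2N /=; case: (u n x) => p q.
  rewrite -[X in _ --> X]addr0 -[X in X + _](mulr0 0) -[X in _ + X](mulr0 0).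
  have d0 (f : nat -> R) (l : R) : f @ W --> l -> (fun n => f n - l) @ W --> (0 : R).
    by move=> fl; rewrite -(subrr l); apply: cvgB => //; exact: cvg_cst.
  apply: cvgD; under eq_fun do rewrite expr2.
    by apply: cvgM; apply: d0; exact: cR.
  by apply: cvgM; apply: d0; exact: cI.
by have /cvgr_lt := cd; apply.
Qed.

(** The weight is split into finitely many large entries, on which coordinatewise convergence is
    uniform, and a remainder of small norm, for which boundedness of the sequence suffices. *)
Lemma compact_diag t : nnb t -> finite_levels t -> compact_op (diag t).
Proof.
move=> nt ft; have bt := diag_bounded nt; split => // u [M0 uM0].
have [t0 [B tB]] := nt.
pose M := M0 ^+ 2.
have uM n : nsq (u n) <= M.
  by rewrite -sqr_norm2 lerXn2r ?uM0// nnegrE ?norm2_ge0//; apply: le_trans (uM0 n); exact: norm2_ge0.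
have M_ge0 : 0 <= M := sqr_ge0 _.
have [W [UW oW]] := @ultraFilterLemma nat \oo _.
have WF : ProperFilter W by exact: ultra_proper.
have [w [wM wlim]] := ultra_weak_limit UW uM.
have arith (p q x1 x2 x3 x4 c eps : R) : 0 < eps -> 8 * x1 + 8 * x2 + c = eps -> 16 * x3 + x4 = eps ->
    0 <= x2 -> 0 < x4 -> p <= x1 -> q <= 4 * x3 -> 0 < c -> 2 * p + 2 * q < eps.
  by clear => *; lra.
have close (eps : R) : 0 < eps -> W [set n | nsq (diag t (u n) - diag t w) < eps].
  move=> eps0.
  have K0 : 0 < 16 * M + 1 by lra.
  (* The remainder contributes at most 2 dl^2 times 4 M, which is at most eps / 2; the summand 1
     keeps the denominator positive. *)
  pose dl := Num.sqrt (eps / (16 * M + 1)).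
  have dl0 : 0 < dl by rewrite sqrtr_gt0 divr_gt0.
  have fF := ft _ dl0; pose F := fset_set [set x | dl <= t x].
  have inF x : x \in F = (dl <= t x).
    by rewrite in_fset_set//; apply/idP/idP => [/set_mem|/mem_set].
  pose t1 x := if x \in F then t x else 0.
  pose t2 x := if x \in F then 0 else t x.
  have nt1 : nnb t1 by apply: (nnb_le _ _ nt) => x; rewrite /t1; case: ifP.
  have nt2 : nnb t2 by apply: (nnb_le _ _ nt) => x; rewrite /t2; case: ifP.
  have tE : diag t = diag t1 \+ diag t2.
    rewrite -diagD//; congr diag; apply/funext => x.
    by rewrite /t1 /t2; case: ifP; rewrite ?addr0 ?add0r.
  have B2 : 0 < B ^+ 2 + 1 by have := sqr_ge0 B; lra.
  (* The large entries contribute at most 2 B^2 c for each point of [F], in total at most eps /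
     4. *)
  pose c := eps / (8 * (B ^+ 2 + 1) * (size F)%:R + 1).
  have N0 : 0 < 8 * (B ^+ 2 + 1) * (size F)%:R + 1.
    by have : 0 <= 8 * (B ^+ 2 + 1) * (size F)%:R; [rewrite !mulr_ge0// ltW|lra].
  have c0 : 0 < c by rewrite divr_gt0.
  have WF1 : W [set n | forall x, x \in F -> abs2 ((u n - w) x) < c].
    have : W (\bigcap_(x in [set` F]) [set n | abs2 ((u n - w) x) < c]).
      by apply: filter_bigI => x _; exact: wlim.
    by apply: filterS => n h x xF; exact: h.
  apply: filterS WF1 => n /= hn; rewrite -(linear_opB bt.1) tE.
  apply: le_lt_trans (nsqD_le _ _) _.
  have h1 : nsq (diag t1 (u n - w)) <= (size F)%:R * (B ^+ 2 * c).
    rewrite (@nsq_finite_diag F)//; last by move=> x /negbTE xF; rewrite /t1 xF.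
    apply: sum_le_const => x xF; rewrite /t1 xF.
    apply: ler_pM; [exact: sqr_ge0|exact: abs2_ge0| |exact/ltW/hn].
    by rewrite lerXn2r// nnegrE// (le_trans (t0 x)).
  have h2 : nsq (diag t2 (u n - w)) <= dl ^+ 2 * nsq (u n - w).
    have [t20 _] := nt2.
    apply: wcomp_nsq; split => // x; rewrite abs2_real lerXn2r ?nnegrE//; first exact: ltW.
    by rewrite /t2; case: ifPn => [_|]; [|rewrite inF -ltNge]; exact: ltW.
  have h3 : nsq (u n - w) <= 4 * M.
    apply: le_trans (nsqD_le _ _) _; rewrite nsqN.
    by apply: le_trans (lerD (ler_wpM2l _ (uM n)) (ler_wpM2l _ wM)) _; rewrite // -mulrDl -natrD.
  have h4 : dl ^+ 2 * nsq (u n - w) <= dl ^+ 2 * (4 * M) by rewrite ler_wpM2l ?sqr_ge0.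
  have h5 : dl ^+ 2 * (16 * M + 1) = eps by rewrite sqr_sqrtr ?divr_ge0 ?ltW// divfK ?gt_eqF.
  have h6 : c * (8 * (B ^+ 2 + 1) * (size F)%:R + 1) = eps by rewrite divfK ?gt_eqF.
  have s0 : 0 <= (size F)%:R * c by rewrite mulr_ge0// ltW.
  have d0 : 0 < dl ^+ 2 by rewrite exprn_gt0.
  have dM : 0 <= dl ^+ 2 * M by rewrite mulr_ge0 ?sqr_ge0.
  have h6' : 8 * ((size F)%:R * (B ^+ 2 * c)) + 8 * ((size F)%:R * c) + c = eps by rewrite -h6; ring.
  have h5' : 16 * (dl ^+ 2 * M) + dl ^+ 2 = eps by rewrite -h5; ring.
  have h4' : dl ^+ 2 * (4 * M) = 4 * (dl ^+ 2 * M) by ring.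
  rewrite h4' in h4; exact: arith eps0 h6' h5' s0 d0 h1 (le_trans h2 h4) c0.
(* Members of the ultrafilter meet every tail, so strictly increasing indices with errors tending to
   0 can be selected. *)
have step N (k : nat) : exists n, (N < n)%N /\ nsq (diag t (u n) - diag t w) < k.+1%:R^-1.
  have WN : W [set n | (N < n)%N] by apply: oW; exact: nbhs_infty_gt.
  have Wc : W [set n | nsq (diag t (u n) - diag t w) < k.+1%:R^-1] by apply: close; rewrite invr_gt0.
  have [n [n1 n2]] := @filter_ex _ W _ _ (filterI WN Wc).
  by exists n.
have [f fP] := choice (fun p : nat * nat => step p.1 p.2).
pose phi := fix phi k := if k is k'.+1 then f (phi k', k) else f (0%N, 0%N).
exists phi; split.
  by apply: homo_ltn => [y x z|k]; [exact: ltn_trans|exact: (fP (phi k, k.+1)).1].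
exists (diag t w).
have pk k : nsq (diag t (u (phi k)) - diag t w) < k.+1%:R^-1.
  by case: k => [|k]; [exact: (fP (0%N, 0%N)).2|exact: (fP (phi k, k.+1)).2].
have c2 : nsq (diag t (u (phi n)) - diag t w) @[n --> \oo] --> (0 : R).
  apply: (squeeze_cvgr _ (cvg_cst 0) cvg_harmonic); apply: nearW => n.
  by rewrite nsq_ge0//= ltW// pk.
have := @sqrt_continuous R 0; rewrite /continuous_at sqrtr0 => s0.
exact: (cvg_comp _ _ c2 s0).
Qed.

End SingularValues.

(** * Membership of diagonal operators in the Macaev ideals *)

Section MacaevIdeal.
Context {R : realType} {X : choiceType}.
Local Notation H := (ell2 R X).
Hypothesis infX : infinite_set [set: X].
Variable t : X -> R.
Hypotheses (nt : nnb t) (ft : finite_levels t).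

Lemma S_up_sigma (n : nat) : S_up (diag t) n%:R = sigma n (diag t).
Proof.
have [e de] := exists_decreasing_enum infX nt.1 ft.
by rewrite (S_up_diag nt ft de) (sigma_diag n nt de).
Qed.

Lemma dixmier_pos_diag (Lim : (nat -> R) -> R) :
  dixmier_pos Lim (diag t) = Lim (dix (diag t)).
Proof. by congr Lim; apply/funext => n; rewrite S_up_sigma. Qed.

Lemma S_up_le (x : R) : 0 <= x ->
  0 <= S_up (diag t) x <= sigma (Num.truncn x).+1 (diag t).
Proof.
move=> x0; have [e de] := exists_decreasing_enum infX nt.1 ft.
rewrite -S_up_sigma (S_up_homo nt ft de)//; last exact/ltW/truncnS_gt.
rewrite andbT; apply: le_trans (S_up_homo nt ft de (lexx _) x0).
by rewrite (_ : 0 = 0%:R :> R)// S_up_sigma; apply: sigma_ge0; exact: diag_positive.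
Qed.

Lemma bounded_seq_eventually (u : nat -> R) (N : nat) (M : R) :
  (forall n, (N <= n)%N -> `|u n| <= M) -> bounded_seq u.
Proof.
move=> h; have M0 : 0 <= M := le_trans (normr_ge0 _) (h N (leqnn N)).
have S0 : 0 <= \sum_(i < N) `|u i| by apply: sumr_ge0.
exists (M + \sum_(i < N) `|u i|) => n.
have [nN|nN] := ltnP n N; last by apply: le_trans (h n nN) _; rewrite lerDl.
rewrite (bigD1 (Ordinal nN))//= addrCA lerDl addr_ge0//; exact: sumr_ge0.
Qed.

Lemma ln_natS_le (x : R) : 2 <= x -> ln (Num.truncn x).+1%:R <= 2 * ln x.
Proof.
move=> x2; have x0 : 0 < x by apply: lt_le_trans x2.
rewrite mulr_natl -lnXn// ler_ln ?posrE ?ltr0n ?exprn_gt0//.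
apply: le_trans (_ : x + x <= _).
  rewrite -natr1; apply: lerD; first by rewrite truncn_le ltW.
  by apply: le_trans x2; rewrite ler1n.
by rewrite -mulr2n -mulr_natl expr2 ler_pM2r.
Qed.

(** The real variable of [S_up] is compared with the next integer; since ln (truncn x + 1) <= 2 ln x
    for x >= 2, the bound at most doubles. *)
Lemma L1inf_diag : L1inf (diag t) <-> bounded_seq (dix (diag t)).
Proof.
have pt := diag_positive nt; split=> [[_ [M [A [Areal hA]]]]|[M hM]].
  apply: (@bounded_seq_eventually _ (Num.truncn `|A|).+1 M) => n nA.
  rewrite /dix -S_up_sigma; apply: hA; apply: le_lt_trans (ler_norm _) _.
  by apply: lt_le_trans (truncnS_gt _) _; rewrite ler_nat.
split; first exact: compact_diag.
exists (2 * M); exists 2; split; first exact: num_real.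
move=> x x2; have x0 : 0 < x by apply: lt_trans x2.
have lx : 0 < ln x by rewrite ln_gt0// (lt_trans _ x2)// ltr1n.
have /andP[s0 s1] := S_up_le (ltW x0).
rewrite ger0_norm; last by rewrite divr_ge0// ltW.
rewrite ler_pdivrMr//; apply: le_trans s1 _.
have M0 : 0 <= M := le_trans (normr_ge0 _) (hM 0%N).
have h : sigma (Num.truncn x).+1 (diag t) <= M * ln (Num.truncn x).+1%:R.
  rewrite -ler_pdivrMr; first exact: le_trans (ler_norm _) (hM _).
  by rewrite ln_gt0// (lt_trans _ (truncnS_gt x))// (lt_trans _ x2)// ltr1n.
apply: le_trans h _; rewrite (mulrC 2) -mulrA ler_wpM2l//; exact/ln_natS_le/ltW.
Qed.

(** Bounded partial sums are more than the ideal asks for, but they are what exponents above d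
    provide. *)
Lemma L1inf0_diag (B : R) : (forall n, sigma n (diag t) <= B) -> L1inf0 (diag t).
Proof.
move=> hB; split; first exact: compact_diag.
have B0 : 0 <= B by apply: le_trans (hB 0%N); apply: sigma_ge0; exact: diag_positive.
apply/cvgrPdist_le => eps eps0; near=> x.
have x0 : 1 < x by near: x; exact: nbhs_pinfty_gt.
have lx : 0 < ln x by rewrite ln_gt0.
have /andP[s0 s1] := S_up_le (ltW (lt_trans ltr01 x0)).
rewrite sub0r normrN ger0_norm; last by rewrite divr_ge0// ltW.
rewrite ler_pdivrMr//; apply: le_trans s1 _; apply: le_trans (hB _) _.
rewrite -ler_pdivrMl// -ler_expR lnK; last by rewrite posrE (lt_trans ltr01).
by near: x; apply: nbhs_pinfty_ge; exact: num_real.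
Unshelve. all: by end_near. Qed.

End MacaevIdeal.

Lemma L1inf0_L1inf (R : realType) (X : choiceType) (T : ell2 R X -> ell2 R X) :
  L1inf0 T -> L1inf T.
Proof.
move=> [cT h]; split => //; exists 1.
by near=> x; rewrite ltW//; near: x; apply: cvgr0_norm_lt.
Unshelve. all: by end_near. Qed.

(** * Words, cells and gaps *)

Section Similarity.
Context {R : realType}.
Implicit Types (f g : R -> R) (r x y u v : R).

Definition sim r f := forall x y, `|f x - f y| = r * `|x - y|.

Lemma sim_id : sim 1 idfun. Proof. by move=> x y; rewrite mul1r. Qed.

Lemma sim_comp r r' f g : sim r f -> sim r' g -> sim (r * r') (f \o g).
Proof. by move=> sf sg x y; rewrite /= sf sg mulrA. Qed.

(** Each difference of values is r times the difference of arguments up to a sign. The sign of the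
    pair (1, 0) fixes e; a point with the other sign relative to 0, when compared with 1, is forced
    to be 0. *)
Lemma sim_affine r f : 0 < r -> sim r f -> exists e c : R, (e = 1 \/ e = -1) /\
  forall x, f x = c + e * r * x.
Proof.
move=> r0 sf.
have sgn x y : f x - f y = r * (x - y) \/ f x - f y = - (r * (x - y)).
  have /eqP : `|f x - f y| = `|r * (x - y)| by rewrite sf normrM (gtr0_norm r0).
  by rewrite eqr_norm2 => /orP[] /eqP; [left|right].
have r0' : r != 0 by rewrite gt_eqF.
have zero x : r * x = 0 -> x = 0.
  by move=> /eqP; rewrite mulf_eq0 (negbTE r0') => /eqP.
have [h1|h1] := sgn 1 0.
  exists 1, (f 0); split; first by left.
  move=> x; rewrite mul1r; have [h|h] := sgn x 0; first by lra.
  have [k|k] := sgn x 1; last by lra.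
  by have /zero x0 : r * x = 0 by [lra]; rewrite x0 mulr0 addr0.
exists (-1), (f 0); split; first by right.
move=> x; have [h|h] := sgn x 0; last by lra.
have [k|k] := sgn x 1; first by lra.
by have /zero x0 : r * x = 0 by [lra]; rewrite x0 mulr0 addr0.
Qed.

Lemma sim_inj r f : 0 < r -> sim r f -> injective f.
Proof.
move=> r0 sf x y e; have := sf x y; rewrite e subrr normr0 => /esym/eqP.
by rewrite mulf_eq0 gt_eqF//= normr_eq0 subr_eq0 => /eqP.
Qed.

Lemma sim_inv r f : 0 < r -> sim r f -> exists g, sim r^-1 g /\ cancel f g /\ cancel g f.
Proof.
move=> r0 sf; have [e [c [e1 fE]]] := sim_affine r0 sf.
have ee : e * e = 1 by case: e1 => ->; rewrite ?mulr1// mulrNN mulr1.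
have r0' : r != 0 by rewrite gt_eqF.
exists (fun y => e * r^-1 * (y - c)); split; last split.
- move=> x y; rewrite -mulrBr !normrM (gtr0_norm (_ : 0 < r^-1)) ?invr_gt0//.
  rewrite (_ : `|e| = 1) ?mul1r; last by case: e1 => ->; rewrite ?normrN normr1.
  by congr (_ * `|_|); ring.
- move=> x; rewrite fE [_ + _ - _]addrC addKr.
  rewrite (_ : _ * _ = (e * e) * (r^-1 * r) * x); last by ring.
  by rewrite ee mulVf// !mul1r.
- move=> y; rewrite fE.
  rewrite (_ : e * r * _ = (e * e) * (r^-1 * r) * (y - c)); last by ring.
  by rewrite ee mulVf// !mul1r addrC subrK.
Qed.

Lemma sim_image_itv r f u v : 0 < r -> sim r f -> u < v ->
  exists u' v', [/\ u' < v', v' - u' = r * (v - u),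
    f @` `[u, v] = `[u', v']%classic, f @` `]u, v[ = `]u', v'[%classic &
    (u' = f u /\ v' = f v) \/ (u' = f v /\ v' = f u)].
Proof.
move=> r0 sf uv; have [e [c [e1 fE]]] := sim_affine r0 sf.
have ruv : 0 < r * (v - u) by rewrite mulr_gt0// subr_gt0.
have [g [sg [fg gf]]] := sim_inv r0 sf.
case: e1 => e1; rewrite e1 ?mul1r ?mulN1r in fE.
- have d : f v - f u = r * (v - u) by rewrite !fE; ring.
  have le x y : (f x <= f y) = (x <= y) by rewrite !fE lerD2l ler_pM2l.
  have lt x y : (f x < f y) = (x < y) by rewrite !fE ltrD2l ltr_pM2l.
  exists (f u), (f v); split.
  + by rewrite -subr_gt0 d.
  + exact: d.
  + apply/seteqP; split=> [_ [x + <-]|y]; rewrite /= !in_itv/= => /andP[h1 h2].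
      by rewrite !le h1 h2.
    by exists (g y); rewrite ?gf//= in_itv/= -(le u) -(le _ v) gf h1 h2.
  + apply/seteqP; split=> [_ [x + <-]|y]; rewrite /= !in_itv/= => /andP[h1 h2].
      by rewrite !lt h1 h2.
    by exists (g y); rewrite ?gf//= in_itv/= -(lt u) -(lt _ v) gf h1 h2.
  + by left.
- have d : f u - f v = r * (v - u) by rewrite !fE; ring.
  have le x y : (f x <= f y) = (y <= x) by rewrite !fE lerD2l !mulNr lerN2 ler_pM2l.
  have lt x y : (f x < f y) = (y < x) by rewrite !fE ltrD2l !mulNr ltrN2 ltr_pM2l.
  exists (f v), (f u); split.
  + by rewrite -subr_gt0 d.
  + exact: d.
  + apply/seteqP; split=> [_ [x + <-]|y]; rewrite /= !in_itv/= => /andP[h1 h2].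
      by rewrite !le h1 h2.
    by exists (g y); rewrite ?gf//= in_itv/= -(le _ u) -(le v) gf h1 h2.
  + apply/seteqP; split=> [_ [x + <-]|y]; rewrite /= !in_itv/= => /andP[h1 h2].
      by rewrite !lt h1 h2.
    by exists (g y); rewrite ?gf//= in_itv/= -(lt _ u) -(lt v) gf h1 h2.
  + by right.
Qed.

End Similarity.

(* The maps [ss_W n i] of level [n] may be placed differently at each level, only the ratios [ss_l i] are shared. *)
Record similar_system (R : realType) := SimilarSystem {
  ss_a : R ;
  ss_b : R ;
  ss_q : nat ;
  ss_l : 'I_ss_q -> R ;
  ss_W : nat -> 'I_ss_q -> R -> R ;
  ss_ab : ss_a < ss_b ;
  ss_l01 : forall i, 0 < ss_l i < 1 ;
  ss_sim : forall n i, sim (ss_l i) (ss_W n i) ;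
  ss_sub : forall n i, ss_W n i @` `[ss_a, ss_b] `<=` `[ss_a, ss_b] ;
  ss_disj : forall n i j, i != j ->
    (ss_W n i @` `[ss_a, ss_b]) `&` (ss_W n j @` `[ss_a, ss_b]) = set0 ;
  ss_ends : forall n z, z = ss_a \/ z = ss_b ->
    exists i z', (z' = ss_a \/ z' = ss_b) /\ ss_W n i z' = z
}.

Section IteratedSystem.
Context {R : realType}.
Variable S : similar_system R.
Local Notation a := (ss_a S).
Local Notation b := (ss_b S).
Local Notation q := (ss_q S).
Local Notation l := (@ss_l _ S).
Local Notation W := (@ss_W _ S).
Let ab := ss_ab S.
Let l01 := @ss_l01 _ S.
Let simW := @ss_sim _ S.
Let subW := @ss_sub _ S.
Let disjW := @ss_disj _ S.
Let endsW := @ss_ends _ S.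
Implicit Types (s : seq 'I_q) (k n : nat).

(** The letter in position j is read by a map of level k + j, so a suffix of a word carries its own
    starting level. *)
Fixpoint wd k s : R -> R := if s is i :: s' then W k i \o wd k.+1 s' else idfun.

Definition lam s : R := \prod_(i <- s) l i.

Definition cell k s : set R := wd k s @` `[a, b].

(** The fractal generated by the levels from k on. Cells of the fractal are copies of these sets,
    which need not be similar to one another. *)
Definition tail_fractal k : set R := [set x | forall n, exists2 s, size s = n & cell k s x].

Lemma lam_gt0 s : 0 < lam s.
Proof. by apply: prodr_gt0 => i _; case/andP: (l01 i). Qed.

Lemma lam_cons i s : lam (i :: s) = l i * lam s.
Proof. by rewrite /lam big_cons. Qed.

Lemma lam_cat s s' : lam (s ++ s') = lam s * lam s'.
Proof. by rewrite /lam big_cat. Qed.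

Lemma wd_sim k s : sim (lam s) (wd k s).
Proof.
elim: s k => [|i s IH] k; first by rewrite /lam big_nil; exact: sim_id.
by rewrite lam_cons; apply: sim_comp.
Qed.

Lemma wd_inj k s : injective (wd k s).
Proof. exact: sim_inj (lam_gt0 s) (wd_sim k s). Qed.

Lemma wd_cat k s s' x : wd k (s ++ s') x = wd k s (wd (k + size s) s' x).
Proof. by elim: s k => [|i s IH] k /=; rewrite ?addn0// IH addnS addSn. Qed.

Lemma cell_sub k s : cell k s `<=` `[a, b].
Proof.
elim: s k => [|i s IH] k; first by move=> _ [x abx <-].
by move=> _ [x abx <-]; apply: (subW (n := k) (i := i)); exists (wd k.+1 s x) => //; apply: IH; exists x.
Qed.

Lemma cell_cat k s s' x : cell k (s ++ s') x <-> exists2 y, cell (k + size s) s' y & wd k s y = x.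
Proof.
split=> [[z abz <-]|[_ [z abz <-] <-]].
  by exists (wd (k + size s) s' z); [exists z|rewrite wd_cat].
by exists z => //; rewrite wd_cat.
Qed.

Lemma cell_cat_sub k s s' : cell k (s ++ s') `<=` cell k s.
Proof. by move=> x /cell_cat[y /cell_sub aby <-]; exists y. Qed.

Lemma cell_eq k s s' x : size s = size s' -> cell k s x -> cell k s' x -> s = s'.
Proof.
elim: s s' k x => [|i s IH] [|j s'] k x //= [ss'] [y aby <-] [z abz e].
have [ij|ij] := eqVneq i j; last first.
  have : ((W k i @` `[a, b]) `&` (W k j @` `[a, b])) (wd k (i :: s) y).
    split; [exists (wd k.+1 s y)|exists (wd k.+1 s' z)] => //.
      by apply: (@cell_sub k.+1 s); exists y.
    by apply: (@cell_sub k.+1 s'); exists z.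
  by rewrite disjW.
rewrite ij in e *; congr cons; apply: (IH _ k.+1 (wd k.+1 s y)) => //; first by exists y.
exists z => //; apply: sim_inj (simW k j) _ _ e.
by case/andP: (l01 j).
Qed.

Lemma ends_word k n z : z = a \/ z = b ->
  exists s z', [/\ size s = n, (z' = a \/ z' = b) & wd k s z' = z].
Proof.
elim: n k z => [|n IH] k z zab; first by exists [::], z.
have [i [y [yab yz]]] := endsW k zab; have [s [z' [sn z'ab z'y]]] := IH k.+1 y yab.
by exists (i :: s), z'; split => //=; [rewrite sn|rewrite z'y].
Qed.

Lemma in_ab z : z = a \/ z = b -> `[a, b]%classic z.
Proof. by move=> [->|->]; rewrite /= in_itv/= lexx ltW. Qed.

Lemma ends_tail_fractal k z : z = a \/ z = b -> tail_fractal k z.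
Proof.
move=> zab n; have [s [z' [sn z'ab <-]]] := ends_word k n zab.
by exists s => //; exists z' => //; exact: in_ab.
Qed.

Lemma tail_fractal_sub k : tail_fractal k `<=` `[a, b].
Proof. by move=> x /(_ 0%N)[s _]; exact: cell_sub. Qed.

(** A longer word whose cell contains a point of the cell of [s] must extend [s], by disjointness of
    cells of equal level; its remaining letters witness membership in the tail. *)
Lemma fractal_cell k s x : (tail_fractal k x /\ cell k s x) <->
  exists2 y, tail_fractal (k + size s) y & wd k s y = x.
Proof.
split=> [[Fx [y aby yx]]|[y Fy <-]].
  exists y => // n; have [s' s'n s'x] := Fx (size s + n)%N.
  have sz : size (take (size s) s') = size s by rewrite size_takel// s'n leq_addr.
  have e : take (size s) s' = s.
    apply: (@cell_eq k _ _ x) => //; last by exists y.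
    by rewrite -(cat_take_drop (size s) s') in s'x; exact: cell_cat_sub s'x.
  exists (drop (size s) s'); first by rewrite size_drop s'n addKn.
  move: s'x; rewrite -{1}(cat_take_drop (size s) s') e => /cell_cat[z zc zx].
  by rewrite -(wd_inj (etrans zx (esym yx))).
have aby := tail_fractal_sub Fy.
split; last by exists y.
move=> n; have [ns|sn] := leqP n (size s).
  exists (take n s); first by rewrite size_takel.
  by apply: (@cell_cat_sub _ _ (drop n s)); rewrite cat_take_drop; exists y.
have [s' s'n s'y] := Fy (n - size s)%N.
by exists (s ++ s'); [rewrite size_cat s'n subnKC// ltnW|apply/cell_cat; exists y].
Qed.

Fixpoint words n : seq (seq 'I_q) :=
  if n is n'.+1 then [seq i :: s | i <- enum 'I_q, s <- words n'] else [:: [::]].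

Lemma mem_words n s : (s \in words n) = (size s == n).
Proof.
elim: n s => [|n IH] [|i s] //=.
  by apply/negbTE/negP => /allpairsP[[j s'] [_ _]].
rewrite eqSS -IH; apply/allpairsP/idP => [[[j s'] [_ s'n [_ ->]]] //|sn].
by exists (i, s); rewrite mem_enum.
Qed.

Lemma words_uniq n : uniq (words n).
Proof.
elim: n => // n IH /=; apply: allpairs_uniq => //; first exact: enum_uniq.
by move=> [i s] [j s'] _ _ /= [-> ->].
Qed.

Lemma size_words n : size (words n) = (q ^ n)%N.
Proof. by elim: n => // n IH; rewrite /= size_allpairs IH size_enum_ord expnS. Qed.

Lemma sum_words n (t : R) :
  \sum_(s <- words n) lam s `^ t = (\sum_i l i `^ t) ^+ n.
Proof.
elim: n => [|n IH]; first by rewrite big_seq1 /lam big_nil powR1 expr0.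
rewrite /= big_allpairs_dep /= exprS -IH big_enum /= mulr_suml; apply: eq_bigr => i _.
rewrite mulr_sumr; apply: eq_bigr => s _; rewrite lam_cons powRM//.
  by case/andP: (l01 i) => /ltW.
exact/ltW/lam_gt0.
Qed.

Lemma cell_itv k s : exists u v, [/\ u < v, v - u = lam s * (b - a),
  cell k s = `[u, v]%classic, (u = wd k s a \/ u = wd k s b) & (v = wd k s a \/ v = wd k s b)].
Proof.
have [u [v [uv vu e _ ends]]] := sim_image_itv (lam_gt0 s) (wd_sim k s) ab.
by exists u, v; split => //; case: ends => -[]; auto.
Qed.

Lemma wd_ends_fractal k s z : z = a \/ z = b -> tail_fractal k (wd k s z).
Proof.
move=> zab; suff [] : tail_fractal k (wd k s z) /\ cell k s (wd k s z) by [].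
by apply/fractal_cell; exists z => //; exact: ends_tail_fractal.
Qed.

Lemma cell_itvF k s : exists u v, [/\ u < v, v - u = lam s * (b - a),
  cell k s = `[u, v]%classic, tail_fractal k u & tail_fractal k v].
Proof.
have [u [v [uv vu e hu hv]]] := cell_itv k s; exists u, v; split => //.
- by case: hu => ->; apply: wd_ends_fractal; auto.
- by case: hv => ->; apply: wd_ends_fractal; auto.
Qed.

Lemma fractal_word k n x : tail_fractal k x -> exists2 s, s \in words n & cell k s x.
Proof. by move=> /(_ n)[s sn sx]; exists s; rewrite ?mem_words ?sn. Qed.

Lemma tail_fractal_bigcap k : tail_fractal k = \bigcap_n \bigcup_(s in [set` words n]) cell k s.
Proof.
apply/seteqP; split=> x h n; first by move=> _; have [s sn sx] := fractal_word n h; exists s.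
by have [//|s /=] := h n; rewrite mem_words => /eqP sn sx; exists s.
Qed.

Lemma closed_tail_fractal k : closed (tail_fractal k).
Proof.
rewrite tail_fractal_bigcap; apply: closed_bigI => n _.
apply: closed_bigcup; first exact: finite_seq.
move=> s _; have [u [v [_ _ -> _ _]]] := cell_itv k s; exact: itv_closed.
Qed.

(** Both endpoints are images of endpoints. A single contraction sends these to points less than b -
    a apart, so two different maps are involved. *)
Lemma q_gt1 : (1 < q)%N.
Proof.
have [i [z [zab za]]] := endsW 0%N (or_introl (erefl a)).
have [j [z' [z'ab z'b]]] := endsW 0%N (or_intror (erefl b)).
have [ij|ij] := eqVneq i j.
  exfalso; have := simW 0%N j z' z; rewrite z'b -ij za (gtr0_norm (_ : 0 < b - a)) ?subr_gt0//.
  have /andP[l0 l1] := l01 i.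
  have : `|z' - z| <= b - a.
    by case: zab => ->; case: z'ab => ->; rewrite ?subrr ?normr0 ?subr_ge0 ?(ltW ab)//
      ?(distrC a b) ger0_norm// subr_ge0 ltW.
  have L0 : 0 < b - a by rewrite subr_gt0.
  move=> h1 h2; have : l i * `|z' - z| <= l i * (b - a) by rewrite ler_wpM2l// ltW.
  rewrite -h2 leNgt => /negP; apply; by rewrite gtr_pMl.
have := card_ord q; rewrite -cardsT => <-; rewrite (cardsD1 i) (cardsD1 j) !inE eq_sym ij //.
Qed.

Lemma l_bounds : exists lmin lmax : R, [/\ 0 < lmin, 0 < lmax < 1,
  forall i, lmin <= l i & forall i, l i <= lmax].
Proof.
have q0 : (0 < q)%N := ltnW q_gt1.
pose i0 := Ordinal q0.
pose im := [arg min_(i < i0) l i]%O; pose iM := [arg max_(i > i0) l i]%O.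
exists (l im), (l iM); split; [by case/andP: (l01 im)|exact: l01| |] => i.
  by rewrite /im; case: arg_minP => // j _ h; exact: h.
by rewrite /iM; case: arg_maxP => // j _ h; exact: h.
Qed.

Lemma lam_le_exp (lmax : R) s : (forall i, l i <= lmax) -> lam s <= lmax ^+ size s.
Proof.
move=> lM; elim: s => [|i s IH]; first by rewrite /lam big_nil expr0.
rewrite lam_cons exprS; apply: ler_pM => //; last exact/ltW/lam_gt0.
by case/andP: (l01 i) => /ltW.
Qed.

Lemma lam_le1 s : lam s <= 1.
Proof.
elim: s => [|i s IH]; first by rewrite /lam big_nil.
have /andP[l0 l1] := l01 i.
by rewrite lam_cons -[leRHS]mulr1; apply: ler_pM; rewrite ?(ltW l0) ?(ltW l1)// ltW// lam_gt0.
Qed.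

Lemma lam_small (e : R) : 0 < e -> exists N, forall s, (N <= size s)%N -> lam s < e.
Proof.
move=> e0; have [_ [lM [_ /andP[lM0 lM1] _ leM]]] := l_bounds.
have lM1' : `|lM| < 1 by rewrite gtr0_norm.
have /cvgrPdist_lt/(_ _ e0)[N _ hN] := cvg_expr lM1'.
exists N => s Ns; apply: le_lt_trans (lam_le_exp s leM) _.
by have := hN _ Ns; rewrite /= sub0r normrN gtr0_norm// exprn_gt0.
Qed.

Local Notation F := (tail_fractal 0).

Definition gap c d := [/\ c < d, F c, F d & forall x, c < x < d -> ~ F x].

Lemma inf_itvcc (u v : R) : u <= v -> inf `[u, v] = u.
Proof. by move=> uv; rewrite inf_itv// bnd_simp. Qed.

Lemma gap_cell c d u v : gap c d -> F u -> F v -> u <= v ->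
  [\/ u <= c /\ d <= v, d <= u | v <= c].
Proof.
move=> [cd Fc Fd nF] Fu Fv uv.
have [uc|cu] := leP u c; last first.
  have [ud|du] := ltP u d; first by case: (nF u _ Fu); rewrite cu.
  by constructor 2.
have [dv|vd] := leP d v; first by constructor 1.
have [vc|cv] := leP v c; first by constructor 3.
by case: (nF v _ Fv); rewrite cv.
Qed.

Lemma gap_right_inj c c' d : gap c d -> gap c' d -> c = c'.
Proof.
move=> [cd Fc Fd nF] [c'd Fc' _ nF'].
have [h|h|//] := ltgtP c c'; first by case: (nF c'); rewrite ?h.
by case: (nF' c); rewrite ?h.
Qed.

(** The ends of a cell belong to the fractal and cannot fall inside a gap, so a cell containing the
    right end [d] either contains [c] too or begins at [d]. *)
Lemma gap_level k c d : gap c d -> exists2 s, s \in words k &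
  F d /\ cell 0 s d /\ ((cell 0 s c) \/ inf (cell 0 s) = d).
Proof.
move=> g; have [cd Fc Fd nF] := g.
have [s sk sd] := fractal_word k Fd; exists s => //; split=> //; split=> //.
have [u [v [uv _ e Fu Fv]]] := cell_itvF 0 s.
move: sd; rewrite e /= in_itv/= => /andP[ud dv].
have [[uc _]|du|vc] := gap_cell g Fu Fv (ltW uv).
- by left; rewrite in_itv/= uc/= (le_trans (ltW cd)).
- by right; rewrite inf_itvcc ?(ltW uv)//; apply/eqP; rewrite eq_le ud.
- by move: cd; rewrite ltNge (le_trans dv vc).
Qed.

Lemma cell_width k s x y : cell k s x -> cell k s y -> `|x - y| <= lam s * (b - a).
Proof.
move=> [x' + <-] [y' + <-]; rewrite /= !in_itv/= => /andP[h1 h2] /andP[h3 h4].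
rewrite wd_sim ler_wpM2l ?(ltW (lam_gt0 _))// ler_norml; apply/andP; split.
  by rewrite opprB lerB.
by rewrite lerB.
Qed.

(** At the first level that separates [c] from [d], the cell of [d] begins at [d]. Its parent
    contains both points and is longer by a factor at most the inverse of the least ratio, whence
    [C]. *)
Lemma gap_word : exists2 C : R, 0 < C & forall c d, gap c d ->
  exists2 s, inf (cell 0 s) = d & d - c <= C * lam s.
Proof.
have [lm [_ [lm0 _ lem _]]] := l_bounds.
have L0 : 0 < b - a by rewrite subr_gt0.
exists ((b - a) / lm); first by rewrite divr_gt0.
move=> c d g; have [cd Fc Fd nF] := g.
pose P n := `[< exists2 s, size s = n & cell 0 s c /\ cell 0 s d >].
have [N NP] : exists n, ~~ P n.
  have [|N hN] := @lam_small ((d - c) / (b - a)); first by rewrite divr_gt0// subr_gt0.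
  exists N; apply/asboolP => -[s sN [sc sd]].
  have := cell_width sd sc; rewrite gtr0_norm ?subr_gt0// => h.
  by have := hN s; rewrite sN leqnn => /(_ isT); rewrite ltr_pdivlMr// ltNge h.
have exP : exists n, ~~ P n by exists N.
case: (ex_minnP exP) => -[|n] nP nmin.
  case/negP: nP; apply/asboolP; exists [::] => //.
  by split; [exists c|exists d] => //; exact: tail_fractal_sub.
have Pn : P n by apply: contraT => /nmin; rewrite ltnn.
have /asboolP[s sn [sc sd]] := Pn.
have [s' s'n [_ [s'd h]]] := gap_level n.+1 g.
move: s'n; rewrite mem_words => /eqP s'n.
case: h => [s'c|e]; first by case/negP: nP; apply/asboolP; exists s'.
exists s' => //.
have e' : take n s' = s.
  apply: (@cell_eq 0 _ _ d) => //; first by rewrite sn size_takel// s'n.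
  by rewrite -(cat_take_drop n s') in s'd; exact: cell_cat_sub s'd.
have : size (drop n s') = 1%N by rewrite size_drop s'n subSnn.
case E : (drop n s') => [|i []]// _.
have -> : s' = s ++ [:: i] by rewrite -(cat_take_drop n s') e' E.
rewrite lam_cat lam_cons (_ : lam [::] = 1) ?mulr1; last by rewrite /lam big_nil.
have := cell_width sd sc; rewrite gtr0_norm ?subr_gt0// => /le_trans; apply.
rewrite [leRHS](_ : _ = (lam s * (b - a)) * (l i / lm)); last by ring.
rewrite ler_peMr ?mulr_ge0 ?(ltW (lam_gt0 _)) ?(ltW L0)//.
by rewrite ler_pdivlMr// mul1r.
Qed.

(** The ends are the supremum of the fractal below [x] and its infimum above [x], which belong to
    the fractal because it is closed. *)
Lemma component_gap x : (`[a, b] `\` F) x -> exists c d,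
  [/\ gap c d, c < x < d & connected_component (`[a, b] `\` F) x = `]c, d[%classic].
Proof.
move=> [/=]; rewrite in_itv/= => /andP[ax xb] nFx.
have Fa := ends_tail_fractal 0 (or_introl (erefl a)).
have Fb := ends_tail_fractal 0 (or_intror (erefl b)).
pose A := F `&` [set y | y <= x]; pose B := F `&` [set y | x <= y].
have A0 : A !=set0 by exists a.
have B0 : B !=set0 by exists b.
have uA : has_ubound A by exists x => y [].
have lB : has_lbound B by exists x => y [].
have cA : closed A by apply: closedI; [exact: closed_tail_fractal|exact: closed_le].
have cB : closed B by apply: closedI; [exact: closed_tail_fractal|exact: closed_ge].
have Ac : A (sup A) by apply: cA; exact: closure_sup.
have Bd : B (inf B).
  apply: cB => N /nbhs_ballP[e /= e0 eN].
  have [y By yi] := inf_adherent e0 (conj B0 lB); exists y; split => //; apply: eN.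
  rewrite /ball /= ltr_distlC (lt_le_trans _ (ge_inf lB By)) ?ltrBlDr ?ltrDl//.
have [Fc cx] := Ac; have [Fd xd] := Bd.
have cx' : sup A < x.
  by rewrite lt_neqAle cx andbT; apply/eqP => e; apply: nFx; rewrite -e.
have xd' : x < inf B.
  by rewrite lt_neqAle xd andbT; apply/eqP => e; apply: nFx; rewrite e.
exists (sup A), (inf B).
have g : gap (sup A) (inf B).
  split=> //; first exact: lt_trans cx' xd'.
  move=> y /andP[cy yd] Fy; have [yx|xy] := leP y x.
    by move: cy; rewrite ltNge ub_le_sup.
  by move: yd; rewrite ltNge ge_inf//; split=> //=; exact: ltW.
have inab y : sup A <= y <= inf B -> `[a, b]%classic y.
  move=> /andP[cy yd]; rewrite /= in_itv/=.
  have := tail_fractal_sub Fc; have := tail_fractal_sub Fd.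
  rewrite /= !in_itv/= => /andP[_ h1] /andP[h2 _].
  by rewrite (le_trans h2 cy) (le_trans yd h1).
split=> //; first by rewrite cx' xd'.
apply/seteqP; split=> [y [C [Cx CA Cc] Cy]|y].
  have CI : is_interval C by apply/connected_intervalP.
  rewrite /= in_itv/=; apply/andP; split; rewrite ltNge; apply/negP => h.
    have /CA[_] : C (sup A) by apply: (CI _ _ Cy Cx); rewrite h ltW.
    exact.
  have /CA[_] : C (inf B) by apply: (CI _ _ Cx Cy); rewrite h ltW.
  exact.
move=> ycd; exists `]sup A, inf B[%classic => //; split.
- by rewrite /= in_itv/= cx' xd'.
- move=> z /=; rewrite in_itv/= => /andP[h1 h2]; split; first by apply: inab; rewrite !ltW.
  by case: g => _ _ _; apply; rewrite h1.
- exact/connected_intervalP/interval_is_interval.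
Qed.

Lemma gap_component c d : gap c d -> exists2 x, (`[a, b] `\` F) x &
  `]c, d[%classic = connected_component (`[a, b] `\` F) x.
Proof.
move=> g; have [cd Fc Fd nF] := g; pose x := (c + d) / 2.
have cxd : c < x < d by rewrite !midf_lt.
have mx : (`[a, b] `\` F) x.
  split; last exact: nF.
  have := tail_fractal_sub Fc; have := tail_fractal_sub Fd.
  rewrite /= !in_itv/= => /andP[_ h1] /andP[h2 _]; case/andP: cxd => h3 h4.
  by rewrite (le_trans h2 (ltW h3)) (le_trans (ltW h4) h1).
exists x => //; have [c' [d' [g' /andP[h1 h2] ->]]] := component_gap mx.
have [_ Fc' Fd' nF'] := g'; case/andP: cxd => h3 h4.
suff [-> ->] : c = c' /\ d = d' by [].
have cc' : c = c'.
  have [h|h|//] := ltgtP c c'; first by case: (nF c' _ Fc'); rewrite h (lt_trans h1 h4).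
  by case: (nF' c _ Fc); rewrite h (lt_trans h3 h2).
have dd' : d = d'.
  have [h|h|//] := ltgtP d d'; first by case: (nF' d _ Fd); rewrite h (lt_trans h1 h4).
  by case: (nF d' _ Fd'); rewrite h (lt_trans h3 h2).
by [].
Qed.

(** Cells of equal level are copies of the same tail, so [wd 0 s'] composed with the inverse of
    [wd 0 s] respects subcells, fractal and gaps. *)
Lemma transport s s' : size s = size s' -> exists h : R -> R,
  [/\ sim (lam s' / lam s) h, forall t, h @` cell 0 (s ++ t) = cell 0 (s' ++ t),
      h @` (F `&` cell 0 s) = F `&` cell 0 s' &
      forall c d, gap c d -> cell 0 s c -> cell 0 s d -> exists c' d',
      [/\ gap c' d', cell 0 s' c', cell 0 s' d', h @` `]c, d[ = `]c', d'[%classic &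
          d' - c' = lam s' / lam s * (d - c)]].
Proof.
move=> ss'; have [g [sg [wg gw]]] := sim_inv (lam_gt0 s) (wd_sim 0 s).
pose h := wd 0 s' \o g.
have sh : sim (lam s' / lam s) h by apply: sim_comp => //; exact: wd_sim.
have r0 : 0 < lam s' / lam s by rewrite divr_gt0 ?lam_gt0.
have hw y : h (wd 0 s y) = wd 0 s' y by rewrite /h /= wg.
have hF : h @` (F `&` cell 0 s) = F `&` cell 0 s'.
  apply/seteqP; split=> [_ [x Fx <-]|x Fx].
    have /fractal_cell[y Fy <-] := Fx; rewrite hw; apply/fractal_cell.
    by exists y => //; rewrite -ss'.
  have /fractal_cell[y Fy yx] := Fx; exists (wd 0 s y); last by rewrite hw.
  by apply/fractal_cell; exists y => //; rewrite ss'.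
exists h; split => //.
  move=> t; apply/seteqP; split=> [_ [x /cell_cat[y yc <-] <-]|x /cell_cat[y yc <-]].
    by apply/cell_cat; exists y; rewrite ?hw// -ss'.
  by exists (wd 0 s y); rewrite ?hw//; apply/cell_cat; exists y => //; rewrite ss'.
move=> c d [cd Fc Fd nF] sc sd.
have [u' [v' [uv dv _ ho he]]] := sim_image_itv r0 sh cd.
have Fh x : F x -> cell 0 s x -> (F `&` cell 0 s') (h x).
  by move=> Fx sx; rewrite -hF; exists x.
have [Fu su] : (F `&` cell 0 s') u' by case: he => -[-> _]; exact: Fh.
have [Fv sv] : (F `&` cell 0 s') v' by case: he => -[_ ->]; exact: Fh.
exists u', v'; split => //; split => // x /andP[ux xv] Fx.
have sx : cell 0 s' x.
  have [p [r [_ _ e _ _]]] := cell_itv 0 s'.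
  move: su sv; rewrite e /= !in_itv/= => /andP[h1 _] /andP[_ h2].
  by rewrite (le_trans h1 (ltW ux)) (le_trans (ltW xv) h2).
have : (F `&` cell 0 s') x by [].
rewrite -hF => -[y [Fy _] hy].
have : `]u', v'[%classic x by rewrite /= in_itv/= ux xv.
rewrite -ho => -[z zcd hz]; have yz : y = z by apply: (sim_inj r0 sh); rewrite hy hz.
by apply: (nF y) => //; rewrite yz.
Qed.

End IteratedSystem.

Arguments wd {R} S k s.
Arguments cell {R} S k s.

(** * From a limit fractal to words over a fixed alphabet *)

Section FromLimitFractal.
Context {R : realType}.
Variable K : limit_fractal R.

Lemma lf_iter_words (S : similar_system R) :
  (forall n Om, lf_step K n Om = \bigcup_(i in [set: 'I_(ss_q S)]) (ss_W (s := S) n i @` Om)) ->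
  forall n Om, lf_iter K n Om = \bigcup_(s in [set s | size s = n]) (wd S 0 s @` Om).
Proof.
move=> stepE; elim=> [|n IH] Om /=.
  apply/seteqP; split=> [x Ox|x [[|//] _ [y Oy <-]]]; last by [].
  by exists [::] => //; exists x.
rewrite IH; apply/seteqP; split=> [x [s sn [y +]]|x [s sn [y Oy]]].
  rewrite stepE => -[i _ [z Oz <-]] <-; exists (s ++ [:: i]).
    by rewrite /= size_cat sn addn1.
  by exists z => //; rewrite wd_cat sn.
case/lastP: s sn => [//|s i]; rewrite /= size_rcons => -[sn] <-.
exists s => //; exists (ss_W (s := S) n i y); last by rewrite -cats1 wd_cat sn.
by rewrite stepE; exists i => //; exists y.
Qed.

(** The number of maps at a level equals q only propositionally. Casting every index type to ['I_q]
    once removes dependent types from all that follows. *)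
Lemma self_similar_system : self_similar K -> exists S : similar_system R,
  [/\ ss_a S = lf_a K, ss_b S = lf_b K, fractal K = tail_fractal S 0 &
      forall c, cells K c <-> exists2 s, size s = c.1 & c.2 = cell S 0 s].
Proof.
move=> [q [l Kl]].
pose e n : lf_p K n = q := projT1 (cid (Kl n)).
have le n i : lf_lam K i = l (cast_ord (e n) i) by rewrite /e; case: (cid (Kl n)).
clearbody e.
pose W n (i : 'I_q) := lf_w K (cast_ord (esym (e n)) i).
have Wl n i : lf_lam K (cast_ord (esym (e n)) i) = l i by rewrite le cast_ordKV.
have wW n (i : 'I_(lf_p K n)) : lf_w K i = W n (cast_ord (e n) i) by rewrite /W cast_ordK.
have l01 i : 0 < l i < 1 by rewrite -(Wl 0%N); exact: lf_lam01.
have simW n i : sim (l i) (W n i) by move=> x y; rewrite -(Wl n) -lf_sim.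
have subW n i : W n i @` `[lf_a K, lf_b K] `<=` `[lf_a K, lf_b K] by exact: lf_sub.
have disjW n i j : i != j ->
    (W n i @` `[lf_a K, lf_b K]) `&` (W n j @` `[lf_a K, lf_b K]) = set0.
  by move=> ij; apply: lf_disj; rewrite (inj_eq (@cast_ord_inj _ _ _)).
have endsW n z : z = lf_a K \/ z = lf_b K ->
    exists i z', (z' = lf_a K \/ z' = lf_b K) /\ W n i z' = z.
  move=> zab; have [|i _ [z' z'ab wz]] := @lf_ends _ K n z.
    by case: zab => ->; [left|right].
  by exists (cast_ord (e n) i), z'; rewrite -wW.
pose S := SimilarSystem (lf_ab K) l01 simW subW disjW endsW.
have stepE n Om : lf_step K n Om = \bigcup_(i in [set: 'I_q]) (W n i @` Om).
  apply/seteqP; split=> [x [i _ [y Oy <-]]|x [i _ [y Oy <-]]].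
    by exists (cast_ord (e n) i) => //; exists y => //; rewrite -wW.
  by exists (cast_ord (esym (e n)) i) => //; exists y.
have iterE := @lf_iter_words S stepE.
exists S; split => //.
  apply/seteqP; split=> x Fx n.
    by have := Fx n I; rewrite iterE => -[s sn sx]; exists s.
  by move=> _; rewrite iterE; have [s sn sx] := Fx n; exists s.
(* Generalized over the starting level m, since removing the first letter shifts the levels of the
   others. *)
have bigE n m (f : 'I_n -> R -> R) (s : seq 'I_q) : size s = n ->
    (forall k : 'I_n, forall i0, f k = W (m + k)%N (nth i0 s k)) ->
    \big[(fun f g : R -> R => f \o g)/idfun]_(k < n) f k = wd S m s.
  elim: n m f s => [|n IH] m f [|i s] //= => [_ _|[sn] fE]; first by rewrite big_ord0.
  rewrite big_ord_recl (fE ord0 i) /= addn0; congr (_ \o _).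
  by apply: IH => // k i0; rewrite (fE _ i0) /= /bump /= add1n addnS addSn.
move=> [n I]; rewrite /cells /=; split=> [[sg ->]|[s sn ->]].
  pose s := [seq cast_ord (e (k : 'I_n)) (sg k) | k <- enum 'I_n].
  have sn : size s = n by rewrite size_map size_enum_ord.
  exists s => //; rewrite /cell /lf_word; congr image.
  apply: bigE => // k i0; rewrite add0n wW /s.
  by rewrite (nth_map k) ?size_enum_ord// nth_ord_enum.
(* The default letter for [nth] is taken from the word itself, so the empty word is treated
   apart. *)
case: n sn => [|n] sn.
  have sg (k : 'I_0) : 'I_(lf_p K k) by case: k.
  exists sg; rewrite /cell /lf_word big_ord0.
  by case: s sn.
have [i0 _] : exists i0 : 'I_q, True by case: s sn => // i0; exists i0.
exists (fun k => cast_ord (esym (e k)) (nth i0 s k)).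
rewrite /cell /lf_word; congr image; apply/esym; apply: bigE => // k i1.
by rewrite add0n /W; congr (lf_w K (cast_ord _ _)); apply: set_nth_default; rewrite sn.
Qed.

End FromLimitFractal.

(** * Pieces of the spectral triple and their coding by words *)

Section Pieces.
Context {R : realType}.
Variables (K : limit_fractal R) (S : similar_system R).
Hypotheses (Sa : ss_a S = lf_a K) (Sb : ss_b S = lf_b K).
Hypothesis KF : fractal K = tail_fractal S 0.
Hypothesis KC : forall c, cells K c <-> exists2 s, size s = c.1 & c.2 = cell S 0 s.
Local Notation q := (ss_q S).
Local Notation L := (ss_b S - ss_a S).
Local Notation F := (tail_fractal S 0).
Implicit Types (s t : seq 'I_q) (e : piece K).

Let pcell_subproof s : cells K (size s, cell S 0 s).
Proof. by apply/KC; exists s. Qed.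

Definition pcell s : piece K := inr (SigSub (mem_set (pcell_subproof s))).

Lemma pcell_inj : injective pcell.
Proof.
move=> s t [st]; have [x sx] : cell S 0 s !=set0.
  have [u [v [uv _ -> _ _]]] := cell_itv 0 s.
  by exists u; rewrite /= in_itv/= lexx ltW.
by move=> e; apply: (cell_eq st sx); rewrite -e.
Qed.

Lemma pieceP e : (exists s, e = pcell s) \/ (exists J, e = inl J).
Proof.
case: e => [J|c]; first by right; exists J.
left; have /set_mem/KC[s s1 s2] := valP c; exists s.
congr inr; apply: val_inj; rewrite [RHS]/=; rewrite s1 -s2; exact: surjective_pairing.
Qed.

Lemma lacunaP (J : set_type (lacunae K)) :
  exists c d, gap S c d /\ val J = `]c, d[%classic.
Proof.
have /set_mem[x xF ->] := valP J.
rewrite KF -Sa -Sb in xF *; have [c [d [g _ ->]]] := component_gap xF.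
by exists c, d.
Qed.

Lemma gap_lacuna c d : gap S c d -> exists J : set_type (lacunae K), val J = `]c, d[%classic.
Proof.
move=> g; have [x xF e] := gap_component g.
have h : lacunae K `]c, d[%classic by exists x; rewrite KF -Sa -Sb.
by exists (SigSub (mem_set h)).
Qed.

Lemma itv_of_pcell s : itv_of (pcell s) = cell S 0 s. Proof. by []. Qed.

Lemma len_pcell s : len (pcell s) = lam s * L.
Proof.
have [u [v [uv <- e _ _]]] := cell_itv 0 s.
by rewrite /len itv_of_pcell e inf_itvcc ?(ltW uv)// sup_itv// bnd_simp ltW.
Qed.

Lemma inf_sup_gap (c d : R) : c < d -> inf `]c, d[ = c /\ sup `]c, d[ = d.
Proof. by move=> cd; rewrite inf_itv ?sup_itv ?bnd_simp. Qed.

Lemma len_gap (J : set_type (lacunae K)) c d : gap S c d -> val J = `]c, d[%classic ->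
  len (inl J : piece K) = d - c.
Proof.
move=> [cd _ _ _] Jcd; have [i s] := inf_sup_gap cd.
by rewrite /len /itv_of Jcd i s.
Qed.

Lemma len_gt0 e : 0 < len e.
Proof.
case: (pieceP e) => [[s ->]|[J ->]].
  by rewrite len_pcell mulr_gt0 ?lam_gt0// subr_gt0 ss_ab.
by have [c [d [g Jcd]]] := lacunaP J; rewrite (len_gap g Jcd) subr_gt0; case: g.
Qed.

Lemma vertex_fractal (x : hilbert_index K) : F (vertex x).
Proof.
case: x => e bt; rewrite /vertex /=; case: (pieceP e) => [[s ->]|[J ->]].
  have [u [v [uv _ ee Fu Fv]]] := cell_itvF 0 s.
  rewrite itv_of_pcell ee inf_itvcc ?(ltW uv)// sup_itv ?bnd_simp ?(ltW uv)//.
  by case: bt.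
have [c [d [g Jcd]]] := lacunaP J; have [cd Fc Fd _] := g; have [i s] := inf_sup_gap cd.
by rewrite [itv_of _]Jcd i s; case: bt.
Qed.

Definition under s e : Prop :=
  match e with
  | inl J => val J `<=` cell S 0 s
  | inr c => (size s <= (val c).1)%N /\ (val c).2 `<=` cell S 0 s
  end.

Lemma under_sub s e : under s e -> itv_of e `<=` cell S 0 s.
Proof. by case: e => [J|c []]. Qed.

Lemma under_pcell s t : under s (pcell t) <-> exists t', t = s ++ t'.
Proof.
split=> [[/= st sub]|[t' ->]]; last first.
  by split; [rewrite /= size_cat leq_addr|exact: cell_cat_sub].
exists (drop (size s) t); rewrite -{1}(cat_take_drop (size s) t); congr (_ ++ _).
have [u [v [uv _ e _ _]]] := cell_itv 0 t.
have tu : cell S 0 t u by rewrite e /= in_itv/= lexx ltW.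
apply: (@cell_eq _ S 0 _ _ u); first by rewrite size_takel.
  by apply: (@cell_cat_sub _ S 0 _ (drop (size s) t)); rewrite cat_take_drop.
exact: sub.
Qed.

Lemma under_gap s (J : set_type (lacunae K)) c d : gap S c d -> val J = `]c, d[%classic ->
  under s (inl J) <-> cell S 0 s c /\ cell S 0 s d.
Proof.
move=> g Jcd; have [cd _ _ _] := g; have [u [v [uv _ e Fu Fv]]] := cell_itvF 0 s.
rewrite /= Jcd e; split=> [sub|[]].
  have /sub : `]c, d[%classic ((c + d) / 2) by rewrite /= in_itv/= !midf_lt.
  rewrite /= !in_itv/= => /andP[h1 h2].
  have [_ m2] := midf_lt cd; have [m1 _] := midf_lt cd.
  have [[uc dv]|du|vc] := gap_cell g Fu Fv (ltW uv).
  - by rewrite uc dv (le_trans uc (ltW cd)) (le_trans (ltW cd) dv).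
  - by have := le_lt_trans (le_trans du h1) m2; rewrite ltxx.
  - by have := lt_le_trans m1 (le_trans h2 vc); rewrite ltxx.
rewrite /= !in_itv/= => /andP[uc _] /andP[_ dv] x /=; rewrite !in_itv/= => /andP[cx xd].
by rewrite (le_trans uc (ltW cx)) (le_trans (ltW xd) dv).
Qed.

Lemma under_vertex s (x : hilbert_index K) : under s x.1 -> cell S 0 s (vertex x).
Proof.
case: x => e bt; rewrite /vertex /=; case: (pieceP e) => [[t ->] ut|[J ->] uJ].
  have [u [v [uv _ ee _ _]]] := cell_itv 0 t.
  rewrite itv_of_pcell ee inf_itvcc ?(ltW uv)// sup_itv ?bnd_simp ?(ltW uv)//.
  apply: (under_sub ut); rewrite itv_of_pcell ee /= in_itv/=.
  by case: bt; rewrite lexx ?andbT ltW.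
have [c [d [g Jcd]]] := lacunaP J; have [cd _ _ _] := g; have [i s'] := inf_sup_gap cd.
by have [h1 h2] := (under_gap s g Jcd).1 uJ; rewrite [itv_of _]Jcd i s'; case: bt.
Qed.

Lemma under_unique s t e : size s = size t -> under s e -> under t e -> s = t.
Proof.
move=> st us ut; have := under_vertex (x := (e, true)) us.
by move=> h; apply: (cell_eq st h); exact: (under_vertex (x := (e, true)) ut).
Qed.

Lemma finite_words k : finite_set [set s : seq 'I_q | (size s <= k)%N].
Proof.
pose w : seq (seq 'I_q) := flatten [seq words S n | n <- iota 0 k.+1].
suff h : [set s : seq 'I_q | (size s <= k)%N] `<=` [set` w].
  exact: sub_finite_set h (finite_seq w).
move=> s /= sk; apply/flattenP; exists (words S (size s)); last by rewrite mem_words.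
by apply: map_f; rewrite mem_iota ltnS.
Qed.

Lemma finite_inj (T U : choiceType) (A : set T) (B : set U) (f : T -> U) : finite_set B ->
  (forall x, A x -> B (f x)) -> {in A &, injective f} -> finite_set A.
Proof.
move=> fB AB fi; rewrite -(eq_finite_set (inj_card_eq fi)).
by apply: sub_finite_set fB => _ [x Ax <-]; exact: AB.
Qed.

Lemma lacuna_inj (J J' : set_type (lacunae K)) c c' d : gap S c d -> gap S c' d ->
  val J = `]c, d[%classic -> val J' = `]c', d[%classic -> J = J'.
Proof. by move=> g g' Jcd J'cd; apply: val_inj; rewrite Jcd J'cd (gap_right_inj g g'). Qed.

(** Cells of this kind have bounded level. A lacuna of this kind is determined by its right end, at
    which a cell of level k begins by [gap_level]; hence words of length at most k, in two copies,
    code all these pieces. *)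
Lemma finite_not_under k : finite_set [set e | ~ exists2 s, size s = k & under s e].
Proof.
have fw := finite_words k.
pose P e (y : seq 'I_q + seq 'I_q) := (~ exists2 s, size s = k & under s e) ->
  match y with
  | inl s => (size s <= k)%N /\ e = pcell s
  | inr s => (size s <= k)%N /\ exists J c d,
       [/\ e = inl J, gap S c d, val J = `]c, d[%classic & inf (cell S 0 s) = d]
  end.
have /choice[f fP] : forall e, exists y, P e y.
  move=> e; have [u|nu] := pselect (exists2 s, size s = k & under s e).
    by exists (inl [::]).
  case: (pieceP e) => [[s es]|[J eJ]].
    exists (inl s) => _; split=> //; rewrite leqNgt; apply/negP => ks; apply: nu.
    exists (take k s); first by rewrite size_takel// ltnW.
    by rewrite es; apply/under_pcell; exists (drop k s); rewrite cat_take_drop.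
  have [c [d [g Jcd]]] := lacunaP J.
  have [s + [Fd [sd h]]] := gap_level k g; rewrite mem_words => /eqP sk.
  exists (inr s) => _; split; first by rewrite sk.
  exists J, c, d; split=> //; case: h => // sc.
  by exfalso; apply: nu; exists s => //; rewrite eJ; apply/(under_gap s g Jcd).
apply: (@finite_inj _ _ _ ([set inl s | s in [set s : seq 'I_q | (size s <= k)%N]] `|`
    [set inr s | s in [set s : seq 'I_q | (size s <= k)%N]]) f).
- by rewrite finite_setU; split; exact: finite_image.
- move=> e /= ne; have := fP e ne; case: (f e) => s [sk _].
    by left; exists s.
  by right; exists s.
- move=> e e'; rewrite !inE /= => ne ne' ff.
  have := fP e ne; have := fP e' ne'; rewrite ff; case: (f e') => s.
    by move=> [_ ->] [_ ->].
  move=> [_ [J [c [d [-> g Jcd sd]]]]] [_ [J' [c' [d' [-> g' J'cd sd']]]]].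
  rewrite -sd sd' in g Jcd; congr inl; exact: (lacuna_inj g' g).
Qed.

(** The first bit is the endpoint, the second marks lacunae. A cell is coded by its own word, a
    lacuna by the word from [gap_word], which is injective because the right end determines the
    lacuna. The constant [C + L] serves both kinds. *)
Lemma index_code : exists (J : hilbert_index K -> seq 'I_q * bool * bool) (C : R),
  [/\ 0 < C, injective J, forall x, len x.1 <= C * lam (J x).1.1 &
      forall s bt, J (pcell s, bt) = (s, bt, false)].
Proof.
have [C C0 gC] := gap_word S.
pose P e (y : seq 'I_q * bool) := match e with
  | inl J => y.2 = true /\ exists c d, [/\ gap S c d, val J = `]c, d[%classic,
       inf (cell S 0 y.1) = d & d - c <= C * lam y.1]
  | inr c => y.2 = false /\ inr c = pcell y.1
  end.
have /choice[f fP] : forall e, exists y, P e y.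
  move=> e; case: (pieceP e) => [[s ->]|[J ->]]; first by exists (s, false).
  have [c [d [g Jcd]]] := lacunaP J; have [s sd dc] := gC _ _ g.
  by exists (s, true); split=> //; exists c, d.
have fcell s : f (pcell s) = (s, false).
  by have := fP (pcell s); case: (f (pcell s)) => t bt /= [-> /pcell_inj ->].
have L0 : 0 < L by rewrite subr_gt0 ss_ab.
exists (fun x => ((f x.1).1, x.2, (f x.1).2)), (C + L); split.
- exact: addr_gt0.
- move=> [e bt] [e' bt'] /= [f1 -> f2]; congr pair.
  move: f1 f2 (fP e) (fP e').
  case: (pieceP e) => [[s ->]|[J ->]]; case: (pieceP e') => [[s' ->]|[J' ->]].
  + by rewrite !fcell /= => ->.
  + by rewrite !fcell /= => _ e2 _ [h _]; rewrite h in e2.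
  + by rewrite !fcell /= => _ e2 [h _]; rewrite h in e2.
  + move=> f1 _ [_ [c [d [g Jcd i _]]]] [_ [c' [d' [g' J'cd i' _]]]].
    have dd : d = d' by rewrite -i -i' f1.
    by rewrite dd in g Jcd; congr inl; exact: (lacuna_inj g g').
- move=> [e bt] /=; have := fP e; case: (pieceP e) => [[s ->]|[J ->]].
    rewrite fcell /= len_pcell mulrC => _; rewrite ler_wpM2r ?(ltW (lam_gt0 _))//.
    by rewrite lerDr ltW.
  move=> [_ [c [d [g Jcd _ h]]]]; rewrite (len_gap g Jcd); apply: le_trans h _.
  by rewrite ler_wpM2r ?(ltW (lam_gt0 _))// lerDl ltW.
- by move=> s bt /=; rewrite fcell.
Qed.

(** [h] carries one piece onto the other, preserving kind and level; injectivity of [h] on the line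
    then passes to pieces. *)
Definition linked (h : R -> R) e e' : Prop :=
  match e, e' with
  | inl J, inl J' => val J' = h @` val J
  | inr c, inr c' => val c' = ((val c).1, h @` (val c).2)
  | _, _ => False
  end.

Lemma linked_inj h e1 e2 e' : injective h -> linked h e1 e' -> linked h e2 e' -> e1 = e2.
Proof.
move=> hi; have im (A B : set R) : h @` A = h @` B -> A = B.
  move=> e; apply/seteqP; split=> x Ax.
    have : (h @` B) (h x) by rewrite -e; exists x.
    by move=> [y By /hi <-].
  have : (h @` A) (h x) by rewrite e; exists x.
  by move=> [y By /hi <-].
case: e1 e2 e' => [J1|c1] [J2|c2] [J'|c'] //=.
  by move=> -> /im e; congr inl; apply: val_inj.
move=> -> [e1 /im e2]; congr inr; apply: val_inj => /=.
by move: e1 e2; case: (val c1) (val c2) => ? ? [? ?] /= -> ->.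
Qed.

Lemma transport_pieces s s' : size s = size s' -> exists pi : piece K -> piece K,
  (forall e, under s e -> under s' (pi e) /\ len (pi e) = lam s' / lam s * len e) /\
  (forall e e', under s e -> under s e' -> pi e = pi e' -> e = e').
Proof.
move=> ss'; have [h [sh hc hF hg]] := transport ss'.
have r0 : 0 < lam s' / lam s by rewrite divr_gt0 ?lam_gt0.
have hi := sim_inj r0 sh.
have /choice[pi piP] : forall e, exists e', under s e ->
    [/\ linked h e e', under s' e' & len e' = lam s' / lam s * len e].
  move=> e; have [u|nu] := pselect (under s e); last by exists e.
  case: (pieceP e) u => [[t ->] /under_pcell[t' ->]|[J ->] uJ].
    exists (pcell (s' ++ t')) => _; split.
    - by rewrite /= -hc !size_cat ss'.
    - by apply/under_pcell; exists t'.
    - rewrite !len_pcell !lam_cat; have : lam s != 0 by rewrite gt_eqF// lam_gt0.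
      by move=> l0; field.
  have [c [d [g Jcd]]] := lacunaP J; have [sc sd] := (under_gap s g Jcd).1 uJ.
  have [c' [d' [g' sc' sd' hcd ld]]] := hg _ _ g sc sd.
  have [J' J'cd] := gap_lacuna g'; exists (inl J') => _; split.
  - by rewrite /= Jcd J'cd.
  - exact/(under_gap s' g' J'cd).
  - by rewrite (len_gap g Jcd) (len_gap g' J'cd).
exists pi; split=> [e /piP[]//|e e' /piP[l1 _ _] /piP[l2 _ _] ee].
by apply: (linked_inj hi l1); rewrite ee.
Qed.

Lemma infinite_index : infinite_set [set: hilbert_index K].
Proof.
move=> fX; have i0 : 'I_q by exists 0%N; exact: ltnW (q_gt1 S).
apply: infinite_nat; apply: (finite_inj (f := fun n : nat => (pcell (nseq n i0), true)) fX) => //.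
by move=> m n _ _ [] e _; rewrite !size_nseq in e.
Qed.

End Pieces.

(** * Powers of the lengths of the pieces *)

Lemma sum_le_subset (R : numDomainType) (T : eqType) (s1 s2 : seq T) (f : T -> R) :
  (forall x, 0 <= f x) -> uniq s1 -> {subset s1 <= s2} ->
  \sum_(x <- s1) f x <= \sum_(x <- s2) f x.
Proof.
move=> f0; elim: s1 s2 => [|x s1 IH] s2 /=; first by rewrite big_nil sumr_ge0.
move=> /andP[xs1 u1] sub; have xs2 : x \in s2 by apply: sub; rewrite inE eqxx.
rewrite (perm_big _ (perm_to_rem xs2)) !big_cons lerD2l; apply: IH => // y ys1.
have yx : y != x by apply: contraNneq xs1 => <-.
have : y \in s2 by apply: sub; rewrite inE ys1 orbT.
by rewrite (perm_mem (perm_to_rem xs2)) inE (negbTE yx).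
Qed.

Lemma powR_le (R : realType) (x y s : R) : 0 <= s -> 0 <= x -> x <= y -> x `^ s <= y `^ s.
Proof.
by move=> s0 x0 xy; apply: ge0_ler_powR; rewrite ?nnegrE//; exact: le_trans xy.
Qed.

Lemma powR_V (R : realType) (x s : R) : 0 < x -> x^-1 `^ s = (x `^ s)^-1.
Proof.
move=> x0; apply: (mulfI (lt0r_neq0 (powR_gt0 s x0))).
rewrite mulfV ?gt_eqF ?powR_gt0// -powRM ?invr_ge0 ?(ltW x0)//.
by rewrite mulfV ?gt_eqF// powR1.
Qed.

Lemma powR_le1 (R : realType) (x s : R) : 0 <= s -> 0 <= x -> x <= 1 -> x `^ s <= 1.
Proof. by move=> s0 x0 x1; have := powR_le s0 x0 x1; rewrite powR1. Qed.

Lemma powR_lt1 (R : realType) (x s : R) : 0 < s -> 0 <= x -> x < 1 -> x `^ s < 1.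
Proof.
move=> s0 x0 x1; have := gt0_ltr_powR s0; rewrite /prop_in2 => /(_ x 1).
by rewrite powR1; apply => //; rewrite nnegrE.
Qed.

Section LenPowers.
Context {R : realType}.
Variables (K : limit_fractal R) (S : similar_system R).
Hypotheses (Sa : ss_a S = lf_a K) (Sb : ss_b S = lf_b K).
Hypothesis KF : fractal K = tail_fractal S 0.
Hypothesis KC : forall c, cells K c <-> exists2 s, size s = c.1 & c.2 = cell S 0 s.
Local Notation q := (ss_q S).
Local Notation L := (ss_b S - ss_a S).
Local Notation X := (hilbert_index K).
Local Notation pcell := (pcell KC).
Implicit Types (w : seq 'I_q) (x : X) (s : R).

Definition lenpow s x : R := len x.1 `^ s.

Let len_gt0 := @len_gt0 R K S Sa Sb KF KC.
Let L_gt0 : 0 < L. Proof. by rewrite subr_gt0 ss_ab. Qed.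

(** The left side of Moran's equation [ratio_sum d = 1]. *)
Definition ratio_sum s : R := \sum_i @ss_l _ S i `^ s.

Lemma ratio_sum_gt0 s : 0 < ratio_sum s.
Proof.
have i0 : 'I_q by exists 0%N; exact: ltnW (q_gt1 S).
rewrite /ratio_sum (bigD1 i0)//= ltr_pwDl ?powR_gt0//.
  by case/andP: (ss_l01 i0).
by apply: sumr_ge0 => i _; exact: powR_ge0.
Qed.

Definition words_upto m : seq (seq 'I_q) := flatten [seq words S j | j <- iota 0 m].

Lemma mem_words_upto m w : (w \in words_upto m) = (size w < m)%N.
Proof.
apply/flatten_mapP/idP => [[j]|wm].
  by rewrite mem_iota add0n => jm; rewrite mem_words => /eqP ->.
by exists (size w); rewrite ?mem_iota// mem_words.
Qed.

Lemma words_upto_uniq m : uniq (words_upto m).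
Proof.
rewrite /words_upto; elim: m => // m IH.
rewrite -addn1 iotaD map_cat flatten_cat cat_uniq IH /= cats0 add0n words_uniq andbT.
by apply/hasPn => w; rewrite mem_words => /eqP wm; rewrite mem_words_upto wm ltnn.
Qed.

Lemma sum_words_upto m s :
  \sum_(w <- words_upto m) lam w `^ s = \sum_(j < m) ratio_sum s ^+ j.
Proof.
rewrite /words_upto big_flatten big_map /= -[iota 0 m]/(iota 0 m).
rewrite -(big_mkord xpredT (fun j => ratio_sum s ^+ j)) /index_iota subn0.
by apply: eq_bigr => j _; exact: sum_words.
Qed.

Lemma size_words_upto m : (size (words_upto m) <= q ^ m)%N.
Proof.
elim: m => // m IH.
rewrite /words_upto -addn1 iotaD map_cat flatten_cat size_cat /= cats0 add0n size_words addn1 expnS.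
apply: leq_trans (_ : q ^ m + q ^ m <= _)%N; first by rewrite leq_add2r.
by rewrite addnn -mul2n leq_mul2r q_gt1 orbT.
Qed.

Variables (J : X -> seq 'I_q * bool * bool) (C : R).
Hypotheses (C0 : 0 < C) (J_inj : injective J).
Hypothesis J_len : forall x, len x.1 <= C * lam (J x).1.1.

Lemma lenpow_le s x : 0 <= s -> lenpow s x <= C `^ s * lam (J x).1.1 `^ s.
Proof.
move=> s0; rewrite -powRM ?(ltW C0) ?(ltW (lam_gt0 _))//.
by apply: powR_le; rewrite ?(ltW (len_gt0 _)).
Qed.

Lemma nnb_lenpow s : 0 <= s -> nnb (lenpow s).
Proof.
move=> s0; split=> [x|]; first exact: powR_ge0.
exists (C `^ s) => x; apply: le_trans (lenpow_le x s0) _.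
rewrite -[leRHS]mulr1 ler_wpM2l ?powR_ge0//.
apply: powR_le1; rewrite ?(ltW (lam_gt0 _))//; exact: lam_le1.
Qed.

Lemma finite_code m : finite_set [set x | (size (J x).1.1 < m)%N].
Proof.
apply: (@finite_inj X _ _ ([set` words_upto m] `*` [set: bool] `*` [set: bool]) J).
- by apply: finite_setX; [apply: finite_setX|]; [exact: finite_seq|exact: finite_finset|exact: finite_finset].
- by move=> x /= xm; split=> //; split=> //=; rewrite mem_words_upto.
- by move=> x y _ _; exact: J_inj.
Qed.

Lemma finite_levels_lenpow s : 0 < s -> finite_levels (lenpow s).
Proof.
move=> s0 e e0; have d0 : 0 < e `^ s^-1 / C by rewrite divr_gt0// powR_gt0.
have [N hN] := lam_small S d0.
apply: sub_finite_set (finite_code N) => x /= ex; rewrite ltnNge; apply/negP => /hN h.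
have : lenpow s x < e.
  rewrite -[ltRHS]powRr1 ?(ltW e0)// -(@mulVf _ s) ?gt_eqF// powRrM.
  apply: le_lt_trans (_ : (C * lam (J x).1.1) `^ s < _).
    by apply: powR_le; rewrite ?(ltW s0) ?(ltW (len_gt0 _)).
  apply: gt0_ltr_powR => //; rewrite ?nnegrE ?powR_ge0 ?mulr_ge0 ?(ltW C0) ?(ltW (lam_gt0 _))//.
  by rewrite mulrC -ltr_pdivlMr.
by rewrite ltNge ex.
Qed.

(** The factor 4 counts the values of the two bits: by injectivity of the code, a word codes at most
    four basis vectors. *)
Lemma sum_lenpow_le s (F : seq X) m : 0 <= s -> uniq F ->
  (forall x, x \in F -> (size (J x).1.1 < m)%N) ->
  \sum_(x <- F) lenpow s x <= 4 * C `^ s * \sum_(j < m) ratio_sum s ^+ j.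
Proof.
move=> s0 uF FJ.
pose Y := [seq (w, b12) | w <- words_upto m, b12 <- [:: (true, true); (true, false); (false, true); (false, false)]].
pose Jf x := ((J x).1.1, ((J x).1.2, (J x).2)).
apply: le_trans (_ : \sum_(x <- F) C `^ s * lam (Jf x).1 `^ s <= _).
  by apply: ler_sum => x _; exact: lenpow_le.
rewrite -mulr_sumr -(big_map Jf xpredT (fun y => lam y.1 `^ s)).
apply: le_trans (_ : C `^ s * \sum_(y <- Y) lam y.1 `^ s <= _).
  rewrite ler_wpM2l ?powR_ge0//; apply: sum_le_subset.
  - by move=> y; exact: powR_ge0.
  - rewrite map_inj_uniq// => x y [h1 h2 h3]; apply: J_inj.
    by move: h1 h2 h3; case: (J x) (J y) => [[? ?] ?] [[? ?] ?] /= -> -> ->.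
  - move=> _ /mapP[x xF ->]; apply/allpairsP; exists (Jf x); split => //=.
      by rewrite mem_words_upto FJ.
    by case: (J x) => [[? []] []].
rewrite big_allpairs_dep /= (eq_bigr (fun w => 4 * lam w `^ s)); last first.
  by move=> w _; rewrite !big_cons big_nil /=; ring.
by rewrite -mulr_sumr sum_words_upto mulrCA mulrA.
Qed.

(** The threshold bound [sigma_diag_le], with the basis vectors whose code word is shorter than m as
    finite set; all other entries are at most C^s lM^(s m). *)
Lemma sigma_lenpow_le s n m (lM : R) : 0 <= s -> 0 <= lM -> (forall i, @ss_l _ S i <= lM) -> lM <= 1 ->
  sigma n (diag (lenpow s)) <=
  4 * C `^ s * \sum_(j < m) ratio_sum s ^+ j + n%:R * (C `^ s * (lM `^ s) ^+ m).
Proof.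
move=> s0 lM0 leM lM1.
pose F := fset_set [set x | (size (J x).1.1 < m)%N].
have inF x : x \in F = (size (J x).1.1 < m)%N.
  rewrite in_fset_set; last exact: finite_code.
  by apply/idP/idP => [/set_mem|/mem_set].
have M0 : 0 <= C `^ s * (lM `^ s) ^+ m by rewrite mulr_ge0 ?powR_ge0// exprn_ge0// powR_ge0.
apply: le_trans (@sigma_diag_le _ _ (lenpow s) n F (C `^ s * (lM `^ s) ^+ m) (nnb_lenpow s0) _ M0 _) _.
- exact: fset_uniq.
- move=> x; rewrite inF -leqNgt => mx; apply: le_trans (lenpow_le x s0) _.
  rewrite ler_wpM2l ?powR_ge0//.
  apply: le_trans (_ : (lM ^+ size (J x).1.1) `^ s <= _).
    by apply: powR_le; rewrite ?(ltW (lam_gt0 _))//; exact: lam_le_exp.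
  have -> : (lM ^+ size (J x).1.1) `^ s = (lM `^ s) ^+ size (J x).1.1.
    elim: (size _) => [|k IH]; first by rewrite !expr0 powR1.
    by rewrite !exprS powRM ?exprn_ge0// IH.
  apply: ler_wiXn2l => //; first exact: powR_ge0.
  exact: powR_le1.
- rewrite lerD2r; apply: le_trans (@sum_lenpow_le s F m s0 (fset_uniq F) _).
    by apply: ler_sum => x _; rewrite ge_max gerBl M0 powR_ge0.
  by move=> x; rewrite inF.
Qed.

(** The test vectors are the right endpoints of all cells of level below m; since q >= 2 there are
    at most q^m of them. *)
Lemma sigma_lenpow_ge s m : 0 <= s ->
  L `^ s * \sum_(j < m) ratio_sum s ^+ j <= sigma (q ^ m) (diag (lenpow s)).
Proof.
move=> s0.
have u : uniq [seq ((pcell w, true) : X) | w <- words_upto m].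
  by rewrite map_inj_uniq ?words_upto_uniq// => w w' [] /= e1 e2;
     apply: (@pcell_inj _ _ _ KC); rewrite /pcell; congr inr; apply: val_inj => /=; rewrite e1 e2.
have pd := diag_positive (nnb_lenpow s0).
have := sigma_diag_ge (nnb_lenpow s0) u; rewrite size_map big_map => h.
apply: le_trans (le_trans h (sigma_mono pd (size_words_upto m))).
rewrite -sum_words_upto mulr_sumr; apply: ler_sum => w _.
by rewrite /lenpow /= len_pcell mulrC powRM ?(ltW (lam_gt0 _)) ?(ltW L_gt0).
Qed.

End LenPowers.

(** * Singular traces of the powers of the lengths *)

Section Traces.
Context {R : realType}.
Variables (K : limit_fractal R) (S : similar_system R).
Hypotheses (Sa : ss_a S = lf_a K) (Sb : ss_b S = lf_b K).
Hypothesis KF : fractal K = tail_fractal S 0.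
Hypothesis KC : forall c, cells K c <-> exists2 s, size s = c.1 & c.2 = cell S 0 s.
Local Notation q := (ss_q S).
Local Notation L := (ss_b S - ss_a S).
Local Notation X := (hilbert_index K).
Local Notation pcell := (pcell KC).
Local Notation lenpow := (@lenpow R K).
Implicit Types (w : seq 'I_q) (x : X) (s : R).

Let L_gt0 : 0 < L. Proof. by rewrite subr_gt0 ss_ab. Qed.

Lemma lenpow_nnb s : 0 <= s -> nnb (lenpow s).
Proof.
have [J [C [C0 _ Jl _]]] := index_code Sa Sb KF KC.
by move=> s0; exact: (nnb_lenpow Sa Sb KF KC C0 Jl s0).
Qed.

Lemma lenpow_finite_levels s : 0 < s -> finite_levels (lenpow s).
Proof.
have [J [C [C0 Ji Jl _]]] := index_code Sa Sb KF KC.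
by move=> s0; exact: (finite_levels_lenpow Sa Sb KF KC C0 Ji Jl s0).
Qed.

Variables (tau : (ell2 R X -> ell2 R X) -> \bar R) (st : singular_trace tau).
Local Notation dtrace := (dtrace tau).

Definition lenpow_on (A : set X) s x : R := if `[< A x >] then lenpow s x else 0.

Lemma lenpow_on_ge0 A s x : 0 <= lenpow_on A s x.
Proof. by rewrite /lenpow_on; case: ifP => // _; exact: powR_ge0. Qed.

Lemma lenpow_on_nnb A s : 0 <= s -> nnb (lenpow_on A s).
Proof.
move=> s0; apply: (nnb_le _ _ (lenpow_nnb s0)); first exact: lenpow_on_ge0.
by move=> x; rewrite /lenpow_on; case: ifP => // _; exact: powR_ge0.
Qed.

Lemma lenpow_onT (A : set X) s x : A x -> lenpow_on A s x = lenpow s x.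
Proof. by move=> Ax; rewrite /lenpow_on asboolT. Qed.

Lemma lenpow_onF (A : set X) s x : ~ A x -> lenpow_on A s x = 0.
Proof. by move=> Ax; rewrite /lenpow_on asboolF. Qed.

Lemma dtrace_lenpow_dom s (r : R) (A B : set X) (pi : X -> X) : 0 <= s -> 0 <= r ->
  {in A &, injective pi} -> (forall x, A x -> B (pi x) /\ len x.1 <= r * len (pi x).1) ->
  (dtrace (lenpow_on A s) <= (r `^ s)%:E * dtrace (lenpow_on B s))%E.
Proof.
move=> s0 r0 ip AB; rewrite -(dtraceZ st) ?powR_ge0//; last exact: lenpow_on_nnb.
apply: (dtrace_dom st _ _ ip); first exact: lenpow_on_nnb.
- by apply: nnbZ; [exact: powR_ge0|exact: lenpow_on_nnb].
- move=> x Ax; have [Bx lx] := AB x Ax; rewrite !lenpow_onT// /lenpow.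
  rewrite -powRM ?(ltW (len_gt0 Sa Sb KF KC _))//.
  by apply: powR_le; rewrite ?(ltW (len_gt0 Sa Sb KF KC _)).
- by move=> x nA; rewrite lenpow_onF.
Qed.

(* Passing from a cell to its children multiplies the trace of the cells by [ratio_sum S s], so it is 0 or infinite;
   the lacunae are dominated by the cells to which [index_code] assigns them. *)
Lemma dtrace_lenpow_trivial s : 0 < s -> ratio_sum S s != 1 ->
  (dtrace (lenpow s) < +oo)%E -> dtrace (lenpow s) = 0%E.
Proof.
move=> s0 r1 fin; have s0' := ltW s0.
have [J [C [C0 Ji Jl Jc]]] := index_code Sa Sb KF KC.
pose Cl : set X := [set x | exists w, x.1 = pcell w].
pose La : set X := ~` Cl.
pose Hd (i : 'I_q) : set X := [set x | exists w, x.1 = pcell (i :: w)].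
pose Ro : set X := [set x | x.1 = pcell [::]].
have clJ x : Cl x -> x = (pcell (J x).1.1, x.2).
  by case: x => e bt [w /= ->]; rewrite Jc.
have nC := lenpow_on_nnb Cl s0'; have nL := lenpow_on_nnb La s0'.
have split_t : dtrace (lenpow s) = (dtrace (lenpow_on Cl s) + dtrace (lenpow_on La s))%E.
  rewrite -(dtraceD st)//; congr dtrace; apply/funext => x.
  have [c|c] := pselect (Cl x).
    by rewrite (lenpow_onT _ c) lenpow_onF ?addr0//; exact.
  by rewrite (lenpow_onF _ c) lenpow_onT ?add0r.
have D0 := dtrace_ge0 st nC; have L0 := dtrace_ge0 st nL.
have Dfin : (dtrace (lenpow_on Cl s) < +oo)%E.
  by apply: le_lt_trans fin; rewrite split_t leeDl.
(* All lacunae have the same flag, so word and endpoint bit determine them, and forgetting the flag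
   maps them injectively to cells. *)
have Lac : (dtrace (lenpow_on La s) <= ((C / L) `^ s)%:E * dtrace (lenpow_on Cl s))%E.
  apply: (@dtrace_lenpow_dom _ _ _ _ (fun x => (pcell (J x).1.1, (J x).1.2))) => //.
  - by rewrite divr_ge0// ltW.
  - have flag x : La x -> (J x).2 = true.
      move=> nx; case E : (J x).2 => //; case: nx.
      have : J x = J (pcell (J x).1.1, (J x).1.2) by rewrite Jc -E; case: (J x) => [[]].
      by move=> /Ji ->; exists (J x).1.1.
    move=> x y; rewrite !inE => /flag fx /flag fy [e1 e1' e2]; apply: Ji.
    have e3 : (J x).1.1 = (J y).1.1.
      by apply: (@pcell_inj _ _ _ KC); rewrite /pcell; congr inr; apply: val_inj; rewrite /= e1 e1'.
    by move: fx fy e2 e3; case: (J x) (J y) => [[? ?] ?] [[? ?] ?] /= -> -> -> ->.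
  - move=> x _; split; first by exists (J x).1.1.
    rewrite /= len_pcell (_ : C / L * _ = C * lam (J x).1.1); first exact: Jl.
    by rewrite mulrCA divfK ?gt_eqF// mulrC.
(* Adding or removing the first letter [i] changes the length of a cell by the factor [l i] wherever
   the cells lie, because the length depends on the word alone. Each direction gives one
   inequality. *)
have head i : dtrace (lenpow_on (Hd i) s) = ((@ss_l _ S i `^ s)%:E * dtrace (lenpow_on Cl s))%E.
  have /andP[l0 _] := @ss_l01 _ S i.
  apply/eqP; rewrite eq_le; apply/andP; split.
    apply: (@dtrace_lenpow_dom _ _ _ _ (fun x => (pcell (behead (J x).1.1), x.2))) => //; first exact: ltW.
      move=> [e bt] [e' bt']; rewrite !inE => -[w /= ->] [w' /= ->].
      rewrite !Jc /= => -[e1 e1' ->].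
      have -> : w = w' by apply: (@pcell_inj _ _ _ KC); rewrite /pcell; congr inr; apply: val_inj; rewrite /= e1 e1'.
      by [].
    move=> [e bt] [w /= ->]; rewrite Jc /=; split; first by exists w.
    by rewrite !len_pcell lam_cons mulrA.
  have -> : (@ss_l _ S i `^ s) = ((@ss_l _ S i)^-1 `^ s)^-1.
    by rewrite powR_V// invrK.
  rewrite lee_pdivrMl ?powR_gt0 ?invr_gt0//.
  apply: (@dtrace_lenpow_dom _ _ _ _ (fun x => (pcell (i :: (J x).1.1), x.2))) => //; first by rewrite invr_ge0 ltW.
    move=> [e bt] [e' bt']; rewrite !inE => -[w /= ->] [w' /= ->].
    rewrite !Jc /= => -[e1 e1' ->].
    have [] : i :: w = i :: w' by apply: (@pcell_inj _ _ _ KC); rewrite /pcell; congr inr; apply: val_inj; rewrite /= e1 e1'.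
    by move=> ->.
  move=> [e bt] [w /= ->]; rewrite Jc /=; split; first by exists w.
  by rewrite !len_pcell lam_cons -mulrA mulKf// gt_eqF.
have nRo := lenpow_on_nnb Ro s0'.
have [nH sH] := dtrace_sum st (index_enum 'I_q) (fun i => lenpow_on_nnb (Hd i) s0').
have Ro0 : dtrace (lenpow_on Ro s) = 0%E.
  apply: (@dtrace_finite _ _ _ st _ Ro nRo); last by move=> x nx; rewrite lenpow_onF.
  apply: (@finite_inj X _ _ [set: bool] (fun x => x.2)) => //.
  - exact: finite_finset.
  by move=> [e bt] [e' bt']; rewrite !inE /Ro /= => -> -> ->.
have DE : dtrace (lenpow_on Cl s) = ((ratio_sum S s)%:E * dtrace (lenpow_on Cl s))%E.
  rewrite {1}(_ : lenpow_on Cl s = fun x => lenpow_on Ro s x + \sum_i lenpow_on (Hd i) s x).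
    rewrite (dtraceD st nRo nH) Ro0 add0e sH (eq_bigr _ (fun i _ => head i)).
    rewrite -ge0_sume_distrl; last by move=> i _; rewrite lee_fin powR_ge0.
    by rewrite sumEFin.
  apply/funext => -[e bt].
  have [[w /= ew]|c] := pselect (Cl (e, bt)); last first.
    rewrite (lenpow_onF _ c) lenpow_onF ?add0r; last by move=> h; apply: c; exists [::].
    by rewrite big1// => i _; apply: lenpow_onF => -[w ew]; apply: c; exists (i :: w).
  have cinj w1 w2 : pcell w1 = pcell w2 -> w1 = w2.
    by move=> h; have := Jc w1 true; rewrite h Jc => -[].
  rewrite lenpow_onT; last by exists w.
  case: w ew => [|i w] /= ew.
    rewrite lenpow_onT// big1 ?addr0// => i _; apply: lenpow_onF => -[w /=].
    by rewrite ew => /cinj.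
  rewrite lenpow_onF ?add0r; last by rewrite /Ro /= ew => /cinj.
  rewrite (bigD1 i)//= lenpow_onT; last by exists w.
  rewrite big1 ?addr0// => j ji; apply: lenpow_onF => -[w' /=].
  by rewrite ew => /cinj[ij]; rewrite ij eqxx in ji.
(* A finite solution of x = r x with r different from 1 is 0. *)
have C00 : dtrace (lenpow_on Cl s) = 0%E.
  move: DE Dfin D0; case: (dtrace _) => [r| |]//= + _ _.
  rewrite -EFinM => -[] /esym/eqP; rewrite -[X in _ == X]mul1r -subr_eq0 -mulrBl mulf_eq0 subr_eq0.
  by rewrite (negbTE r1) => /eqP ->.
rewrite split_t C00 add0e; apply/eqP; rewrite eq_le L0 andbT.
by apply: le_trans Lac _; rewrite C00 mule0.
Qed.

Definition chi w : set X := [set x | under w x.1].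

Lemma dtrace_chi_le s w w' : 0 <= s -> size w = size w' ->
  (dtrace (lenpow_on (chi w) s) <= ((lam w / lam w') `^ s)%:E * dtrace (lenpow_on (chi w') s))%E.
Proof.
move=> s0 ww'; have [pi [pi1 pi2]] := transport_pieces Sa Sb KF KC ww'.
apply: (@dtrace_lenpow_dom _ _ _ _ (fun x => (pi x.1, x.2))) => //.
- by rewrite divr_ge0// ltW// lam_gt0.
- by move=> [e bt] [e' bt']; rewrite !inE => u u' [/(pi2 _ _ u u') /= -> ->].
- move=> x ux; have [h1 h2] := pi1 _ ux; split=> //=.
  rewrite h2 mulrA (_ : lam w / lam w' * (lam w' / lam w) = 1) ?mul1r//.
  have := lam_gt0 w; have := lam_gt0 w' => l1 l2.
  by rewrite mulrA divfK ?mulfV ?gt_eqF.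
Qed.

Variables (d D : R).
Hypotheses (d0 : 0 < d) (ratio1 : ratio_sum S d = 1) (trD : dtrace (lenpow d) = D%:E).

Let chi_nnb w := lenpow_on_nnb (chi w) (ltW d0).

Lemma sum_chi k (m : seq 'I_q -> R) x (w : seq 'I_q) : size w = k -> under w x.1 ->
  \sum_(w' <- words S k) m w' * lenpow_on (chi w') d x = m w * lenpow d x.
Proof.
move=> wk uw; rewrite (bigD1_seq w) ?words_uniq ?mem_words ?wk//= lenpow_onT//.
rewrite big_seq_cond big1 ?addr0// => w' /andP[]; rewrite mem_words => /eqP w'k ww'.
rewrite lenpow_onF ?mulr0// => uw'; move/eqP: ww'; apply.
by apply: (under_unique Sa Sb KF KC _ uw' uw); rewrite wk w'k.
Qed.

Lemma sum_chi0 k (m : seq 'I_q -> R) x : ~ (exists2 w : seq 'I_q, size w = k & under w x.1) ->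
  \sum_(w <- words S k) m w * lenpow_on (chi w) d x = 0.
Proof.
move=> h; rewrite big_seq big1// => w; rewrite mem_words => /eqP wk.
by rewrite lenpow_onF ?mulr0// => u; apply: h; exists w.
Qed.

Definition stray k : set X := [set x | ~ exists2 w : seq 'I_q, size w = k & under w x.1].

Lemma finite_stray k : finite_set (stray k).
Proof.
apply: (@finite_inj X _ _ ([set e | ~ exists2 w : seq 'I_q, size w = k & under w e] `*` [set: bool]) id) => //.
by apply: finite_setX; [exact: (finite_not_under Sa Sb KF KC)|exact: finite_finset].
Qed.

(** Transport in both directions makes the traces over cells of one level proportional to their
    [lam] to the power d. The pieces outside all these cells are finitely many and have trace 0, so
    the traces over the cells add up to [D]; as the powers add up to 1, the factor is [D]. *)
Lemma dtrace_chi w : dtrace (lenpow_on (chi w) d) = (lam w `^ d * D)%:E.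
Proof.
pose k := size w.
have fin w' : dtrace (lenpow_on (chi w') d) \is a fin_num.
  rewrite ge0_fin_numE ?(dtrace_ge0 st)//; apply: le_lt_trans (ltry D); rewrite -trD.
  apply: (le_dtrace st); [exact: chi_nnb|exact/lenpow_nnb/ltW|move=> x].
  by rewrite /lenpow_on; case: ifP => // _; exact: powR_ge0.
have eqw w' : size w' = k -> fine (dtrace (lenpow_on (chi w') d)) =
    lam w' `^ d * ((lam w `^ d)^-1 * fine (dtrace (lenpow_on (chi w) d))).
  move=> w'k; have := dtrace_chi_le (ltW d0) w'k; have := dtrace_chi_le (ltW d0) (esym w'k).
  rewrite -(fineK (fin w)) -(fineK (fin w')) -!EFinM !lee_fin /=.
  have l1 := lam_gt0 w; have l2 := lam_gt0 w'.
  rewrite !powRM ?invr_ge0 ?(ltW l1) ?(ltW l2)// !powR_V//.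
  have p1 : 0 < lam w `^ d by rewrite powR_gt0.
  have p2 : 0 < lam w' `^ d by rewrite powR_gt0.
  move=> h1 h2; apply/eqP; rewrite eq_le mulrA h2 /=.
  by rewrite -invf_div ler_pdivrMl// divr_gt0.
have nw w' : nnb (fun x => 1 * lenpow_on (chi w') d x) by apply: nnbZ.
have [nS sS] := dtrace_sum st (words S k) nw.
have nR := lenpow_on_nnb (stray k) (ltW d0).
have := trD; rewrite (_ : lenpow d = fun x => lenpow_on (stray k) d x +
    \sum_(w' <- words S k) 1 * lenpow_on (chi w') d x); last first.
  apply/funext => x; have [[w' w'k uw]|n] := pselect (exists2 w : seq 'I_q, size w = k & under w x.1).
    by rewrite lenpow_onF ?add0r ?(sum_chi (fun=> 1) w'k uw) ?mul1r//; apply; exists w'.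
  by rewrite lenpow_onT// (sum_chi0 (fun=> 1))// addr0.
rewrite (dtraceD st nR nS) sS (@dtrace_finite _ _ _ st _ (stray k) nR (finite_stray k)); last first.
  by move=> x nx; rewrite lenpow_onF.
rewrite add0e big_seq (eq_bigr (fun w' => (lam w' `^ d * ((lam w `^ d)^-1 *
    fine (dtrace (lenpow_on (chi w) d))))%:E)); last first.
  move=> w'; rewrite mem_words => /eqP w'k; rewrite -eqw// fineK//.
  by congr dtrace; apply/funext => x; rewrite mul1r.
rewrite -big_seq sumEFin -mulr_suml sum_words -[\sum_i _]/(ratio_sum S d) ratio1 expr1n mul1r.
by move=> -[<-]; rewrite mulrA mulfV ?gt_eqF ?powR_gt0 ?lam_gt0// mul1r fineK.
Qed.

(** Step weights are compared with [g] cell by cell. For the lower bound the pieces outside the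
    cells are dropped; for the upper bound they are added back as a finitely supported weight, which
    has trace 0. *)
Lemma dtrace_weighted k (g : X -> R) (m M : seq 'I_q -> R) : nnb g ->
  (forall w, 0 <= m w) -> (forall w, 0 <= M w) ->
  (forall w x, size w = k -> under w x.1 -> m w <= g x <= M w) ->
  (((\sum_(w <- words S k) m w * lam w `^ d) * D)%:E <= dtrace (fun x => g x * lenpow d x)%R /\
  dtrace (fun x => g x * lenpow d x)%R <= ((\sum_(w <- words S k) M w * lam w `^ d) * D)%:E)%E.
Proof.
move=> ng m0 M0 gmM; have [g0 [B gB]] := ng; have [l0 [B' lB]] := lenpow_nnb (ltW d0).
have ngl : nnb (fun x => g x * lenpow d x).
  split=> [x|]; first by rewrite mulr_ge0.
  by exists (B * B') => x; apply: ler_pM.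
have tr (c : seq 'I_q -> R) : (forall w, 0 <= c w) ->
    nnb (fun x => \sum_(w <- words S k) c w * lenpow_on (chi w) d x) /\
    dtrace (fun x => \sum_(w <- words S k) c w * lenpow_on (chi w) d x) =
    ((\sum_(w <- words S k) c w * lam w `^ d) * D)%:E.
  move=> c0; have nc w : nnb (fun x => c w * lenpow_on (chi w) d x) by apply: nnbZ.
  have [n1 ->] := dtrace_sum st (words S k) nc; split=> //.
  rewrite mulr_suml -sumEFin; apply: eq_bigr => w _.
  by rewrite (dtraceZ st)// dtrace_chi -EFinM mulrA.
have [nm trm] := tr m m0; have [nM trM] := tr M M0.
split.
  rewrite -trm; apply: (le_dtrace st) => // x.
  have [[w wk uw]|n] := pselect (exists2 w : seq 'I_q, size w = k & under w x.1).
    rewrite (sum_chi m wk uw) ler_wpM2r ?powR_ge0//.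
    by have /andP[] := gmM w x wk uw.
  by rewrite (sum_chi0 m n) mulr_ge0// powR_ge0.
pose rest x := if `[< stray k x >] then g x * lenpow d x else 0.
have nr : nnb rest.
  apply: (nnb_le _ _ ngl) => x; rewrite /rest; case: ifP => //; by rewrite mulr_ge0.
have r0 : dtrace rest = 0%E.
  apply: (@dtrace_finite _ _ _ st _ (stray k) nr (finite_stray k)).
  by move=> x nx; rewrite /rest asboolF.
rewrite -trM -[leRHS]add0e -r0 -(dtraceD st)//; apply: (le_dtrace st) => //; first exact: nnbD.
move=> x; have [[w wk uw]|n] := pselect (exists2 w : seq 'I_q, size w = k & under w x.1).
  rewrite (sum_chi M wk uw) /rest asboolF; last by apply; exists w.
  rewrite add0r ler_wpM2r ?powR_ge0//.
  by have /andP[] := gmM w x wk uw.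
by rewrite (sum_chi0 M n) /rest asboolT// addr0.
Qed.

End Traces.

(** For n > 0, [m] is the integer part of ln n / |ln rho|, plus one. *)
Lemma geometric_log (R : realType) (rho : R) : 0 < rho < 1 -> exists2 A : R, 0 <= A &
  forall n : nat, exists m : nat, m%:R <= A * ln n%:R + 1 /\ n%:R * rho ^+ m <= 1.
Proof.
move=> /andP[r0 r1]; pose u := - ln rho; have u0 : 0 < u by rewrite oppr_gt0 ln_lt0// r0.
exists u^-1 => [|n]; first by rewrite invr_ge0 ltW.
have [->|n0] := posnP n; first by exists 0%N; rewrite mul0r ln0// mulr0 add0r.
have x0 : 0 <= u^-1 * ln (n%:R : R) by rewrite mulr_ge0 ?ln_nat_ge0// invr_ge0 ltW.
exists (Num.truncn (u^-1 * ln (n%:R : R))).+1; split.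
  by rewrite -natr1 lerD2r truncn_le.
rewrite -ler_pdivlMl ?ltr0n// mulr1 -ler_ln ?posrE ?exprn_gt0 ?invr_gt0 ?ltr0n//.
rewrite lnXn// lnV ?posrE ?ltr0n// -[ln rho *+ _]mulr_natl lerNr -mulrN -/u.
by rewrite -ler_pdivrMr// mulrC ltW// truncnS_gt.
Qed.

(** Bernoulli's inequality term by term. The bound is quadratic in m when r > 1, hence beats the
    logarithm of q^m, which is only linear. *)
Lemma geometric_sum_ge (R : realType) (r : R) (m : nat) : 1 <= r ->
  m.+1%:R * (1 + (r - 1) * m%:R / 2) <= \sum_(j < m.+1) r ^+ j.
Proof.
move=> r1; have bern j : 1 + (r - 1) * j%:R <= r ^+ j.
  elim: j => [|j IH]; first by rewrite mulr0 addr0 expr0.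
  rewrite exprS; apply: le_trans (_ : r * (1 + (r - 1) * j%:R) <= _).
    have j0 : 0 <= j%:R :> R by [].
    have : 0 <= (r - 1) * (r - 1) * j%:R by rewrite !mulr_ge0 ?subr_ge0.
    rewrite -natr1; move: j%:R {IH} j0 => y y0 h; clear -y0 h r1; nra.
  by rewrite ler_wpM2l// (le_trans ler01).
elim: m => [|m IH]; first by rewrite big_ord1 expr0 mulr0 mul0r addr0 mulr1.
rewrite big_ord_recr /=; apply: le_trans (lerD IH (bern m.+1)).
rewrite -[m.+2%:R]natr1 -[m.+1%:R]natr1 le_eqVlt; apply/orP; left; apply/eqP.
by field.
Qed.

(** * Growth of the Ky Fan sums *)

Section Growth.
Context {R : realType}.
Variables (K : limit_fractal R) (S : similar_system R).
Hypotheses (Sa : ss_a S = lf_a K) (Sb : ss_b S = lf_b K).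
Hypothesis KF : fractal K = tail_fractal S 0.
Hypothesis KC : forall c, cells K c <-> exists2 s, size s = c.1 & c.2 = cell S 0 s.
Local Notation q := (ss_q S).
Local Notation L := (ss_b S - ss_a S).
Local Notation lenpow := (@lenpow R K).
Implicit Types (s : R) (n m : nat).

Let L_gt0 : 0 < L. Proof. by rewrite subr_gt0 ss_ab. Qed.

Lemma ratio_sum_lt s t : s < t -> ratio_sum S t < ratio_sum S s.
Proof.
move=> st; have i0 : 'I_q by exists 0%N; exact: ltnW (q_gt1 S).
have lt i : @ss_l _ S i `^ t < @ss_l _ S i `^ s.
  have /andP[l0 l1] := @ss_l01 _ S i.
  rewrite -[t](subrK s) addrC powRD; last by apply/implyP => _; rewrite gt_eqF.
  by rewrite -[ltRHS]mulr1 ltr_pM2l ?powR_gt0// powR_lt1 ?subr_gt0// ltW.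
rewrite /ratio_sum (bigD1 i0)//= [ltRHS](bigD1 i0)//=.
by apply: ltr_leD => //; apply: ler_sum => i _; exact: ltW.
Qed.

Lemma lenpow_positive s : 0 <= s -> positive_op (diag (lenpow s)).
Proof. by move=> s0; apply: diag_positive; exact: (lenpow_nnb Sa Sb KF KC). Qed.

(** The level m at which n thresholds add up to a bounded amount grows like ln n, because the
    thresholds decay geometrically with the level. *)
Lemma sigma_lenpow_log s : 0 < s -> exists2 A : R, 0 <= A & forall n, exists2 m,
  m%:R <= A * ln n%:R + 1 &
  sigma n (diag (lenpow s)) <= A * \sum_(j < m) ratio_sum S s ^+ j + A.
Proof.
move=> s0; have [J [C [C0 Ji Jl _]]] := index_code Sa Sb KF KC.
have [_ [lM [_ /andP[lM0 lM1] _ leM]]] := l_bounds S.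
have rho : 0 < lM `^ s < 1.
  by rewrite powR_gt0//= powR_lt1// ltW.
have [A A0 hA] := geometric_log rho.
pose B := 4 * C `^ s; have B0 : 0 <= B by rewrite mulr_ge0 ?powR_ge0.
exists (A + B) => [|n]; first exact: addr_ge0.
have [m [h1 h2]] := hA n; exists m.
  by apply: le_trans h1 _; rewrite lerD2r ler_wpM2r ?ln_nat_ge0// lerDl.
have := sigma_lenpow_le Sa Sb KF KC C0 Ji Jl n m (ltW s0) (ltW lM0) leM (ltW lM1).
move=> /le_trans; apply; apply: lerD.
  rewrite ler_wpM2r ?lerDr// sumr_ge0// => j _.
  by rewrite exprn_ge0// ltW// ratio_sum_gt0.
rewrite mulrCA; apply: le_trans (_ : C `^ s * 1 <= _).
  by rewrite ler_wpM2l ?powR_ge0.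
rewrite mulr1; apply: le_trans (_ : B <= _); last by rewrite lerDr.
by rewrite ler_peMl ?powR_ge0// ler1n.
Qed.

Lemma sum_le_sigma_lenpow s m : 0 <= s ->
  L `^ s * \sum_(j < m) ratio_sum S s ^+ j <= sigma (q ^ m) (diag (lenpow s)).
Proof.
have [J [C [C0 _ Jl _]]] := index_code Sa Sb KF KC.
exact: (sigma_lenpow_ge Sa Sb KF KC C0 Jl).
Qed.

Lemma sigma_lenpow_bounded s : 0 < s -> ratio_sum S s < 1 ->
  exists B : R, forall n, sigma n (diag (lenpow s)) <= B.
Proof.
move=> s0 r1; have [A A0 hA] := sigma_lenpow_log s0.
have r0 := ratio_sum_gt0 S s.
exists (A * (1 - ratio_sum S s)^-1 + A) => n; have [m _] := hA n.
move=> /le_trans; apply; rewrite lerD2r ler_wpM2l//.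
have h := subrX1 (ratio_sum S s) m.
rewrite -[leRHS]mul1r ler_pdivlMr ?subr_gt0// mulrC.
rewrite -[X in X * _]opprB mulNr -h opprB gerBl exprn_ge0// ltW//.
Qed.

Lemma dix_lenpow_bounded s : 0 < s -> ratio_sum S s = 1 -> bounded_seq (dix (diag (lenpow s))).
Proof.
move=> s0 r1; have [A A0 hA] := sigma_lenpow_log s0.
have l2 : 0 < ln (2 : R) by rewrite ln_gt0// ltr1n.
(* The estimate has the form A (A ln n + 1) + A, and for n >= 2 the constant part A + A is absorbed
   by dividing by ln 2. *)
apply: (@bounded_seq_eventually _ _ 2 (A * A + (A + A) / ln 2)) => n n2.
have ln0 : ln (2 : R) <= ln (n%:R : R) by rewrite ler_ln ?posrE ?ltr0n ?ler_nat// (leq_trans _ n2).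
have lnn := lt_le_trans l2 ln0.
rewrite ger0_norm ?dix_ge0//; last exact/lenpow_positive/ltW.
rewrite /dix ler_pdivrMr//; have [m hm] := hA n.
move=> /le_trans; apply; rewrite r1 (eq_bigr (fun=> 1)); last by move=> j _; rewrite expr1n.
rewrite sumr_const card_ord.
have h1 : A * m%:R <= A * (A * ln n%:R + 1) by rewrite ler_wpM2l.
have h2 : (A + A) * 1 <= (A + A) * (ln n%:R / ln 2).
  by rewrite ler_wpM2l ?addr_ge0// ler_pdivlMr// mul1r.
rewrite mulrDl -[X in _ <= _ + X]mulrA [X in _ <= _ + _ * X]mulrC.
lra.
Qed.

Lemma dix_lenpow_lower s : 0 < s -> ratio_sum S s = 1 ->
  exists c : R, 0 < c /\ exists N, forall n, (N <= n)%N -> c <= dix (diag (lenpow s)) n.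
Proof.
move=> s0 r1; have q1 := q_gt1 S.
have lq : 0 < ln (q%:R : R) by rewrite ln_gt0// ltr1n.
have p0 : 0 < L `^ s by rewrite powR_gt0.
(* With m the integer logarithm of n in base q, ln n <= (m + 1) ln q <= 2 m ln q, while the first m
   levels contribute L^s m. *)
exists (L `^ s / (2 * ln q%:R)); split; first by rewrite divr_gt0// mulr_gt0.
exists q => n nq; have n0 : (0 < n)%N by apply: leq_trans nq; exact: ltnW.
have n1 : (1 < n)%N by exact: leq_trans nq.
have lnn : 0 < ln (n%:R : R) by rewrite ln_gt0// ltr1n.
pose m := trunc_log q n; have /andP[h1 h2] := trunc_log_bounds q1 n0.
have m1 : (0 < m)%N by rewrite trunc_log_max ?expn1.
have := sum_le_sigma_lenpow m (ltW s0).
rewrite r1 (eq_bigr (fun=> 1)); last by move=> j _; rewrite expr1n.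
rewrite sumr_const card_ord => hs.
rewrite /dix ler_pdivlMr//; apply: le_trans (sigma_mono (lenpow_positive (ltW s0)) h1).
apply: le_trans hs.
have : ln (n%:R : R) <= m%:R * (2 * ln q%:R).
  apply: le_trans (_ : ln ((q ^ m.+1)%:R : R) <= _).
    by rewrite ler_ln ?posrE ?ltr0n ?expn_gt0 ?(ltnW q1)// ler_nat ltnW.
  rewrite natrX lnXn ?ltr0n ?(ltnW q1)// -[ln _ *+ _]mulr_natl mulrA ler_wpM2r ?(ltW lq)//.
  by rewrite -natrM ler_nat muln2 -addnn -addn1 leq_add2l.
move=> h; rewrite mulrAC -mulrA ler_wpM2l ?(ltW p0)//.
by rewrite ler_pdivrMr// mulr_gt0.
Qed.

(** At n = q^(m+1) the denominator is linear in m and the numerator at least quadratic. *)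
Lemma dix_lenpow_unbounded s : 0 < s -> 1 < ratio_sum S s -> ~ bounded_seq (dix (diag (lenpow s))).
Proof.
move=> s0 r1 /(bounded_dixP (lenpow_positive (ltW s0)))[M hM]; have q1 := q_gt1 S.
have lq : 0 < ln (q%:R : R) by rewrite ln_gt0// ltr1n.
have p0 : 0 < L `^ s by rewrite powR_gt0.
have e0 : 0 < ratio_sum S s - 1 by rewrite subr_gt0.
suff h m : 1 + (ratio_sum S s - 1) * m%:R / 2 <= M * ln q%:R / L `^ s.
  have hx := truncnS_gt (M * ln q%:R / L `^ s / ((ratio_sum S s - 1) / 2)).
  have := h (Num.truncn (M * ln q%:R / L `^ s / ((ratio_sum S s - 1) / 2))).+1.
  move: hx; rewrite ltr_pdivrMr ?divr_gt0//.
  move: (_.+1%:R : R) (M * ln q%:R / L `^ s) (ratio_sum S s - 1) => x y z h1 h2; lra.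
have hs := sum_le_sigma_lenpow m.+1 (ltW s0).
have lm : 0 < ln ((q ^ m.+1)%:R : R) by rewrite ln_gt0// ltr1n -(expn0 q) ltn_exp2l.
have := hM (q ^ m.+1)%N; rewrite /dix ler_pdivrMr// => /(le_trans hs).
rewrite ler_pdivlMr// => h.
have := le_trans (ler_wpM2l (ltW p0) (geometric_sum_ge m (ltW r1))) h.
rewrite natrX lnXn ?ltr0n ?(ltnW q1)// -[ln _ *+ _]mulr_natl.
by rewrite mulrCA [X in _ <= X]mulrCA ler_pM2l ?ltr0n// mulrC.
Qed.

End Growth.

(** * Hausdorff measure *)

Section HausdorffMeasure.
Context {R : realType}.
Implicit Types (s t r delta : R) (A U P Q X : set R).
Local Open Scope ereal_scope.

Lemma diam_ge U (x y : R) : U x -> U y -> `|x - y|%:E <= diam U.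
Proof. by move=> Ux Uy; apply: ereal_sup_ubound; exists (x, y). Qed.

Lemma diam_le U (D : R) : (forall x y, U x -> U y -> `|x - y| <= D)%R -> diam U <= D%:E.
Proof. by move=> h; apply: ge_ereal_sup => _ [[x y] [Ux Uy] <-]; rewrite lee_fin h. Qed.

Lemma hausdorff_delta_le s delta A : (0 < delta)%R -> hausdorff_delta s delta A <= hausdorff s A.
Proof. by move=> d0; apply: ereal_sup_ubound; exists delta. Qed.

Lemma hausdorff_delta_anti s delta delta' A : (delta <= delta')%R ->
  hausdorff_delta s delta' A <= hausdorff_delta s delta A.
Proof.
move=> dd; apply: ereal_inf_le_tmp => _ [U [dU AU] <-]; exists U => //; split=> // k.
by apply: le_trans (dU k) _; rewrite lee_fin.
Qed.

(** A set of diameter at most [delta] cannot meet both [P] and [Q], so a cover of the union splits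
    into a cover of each. *)
Lemma hausdorff_delta_separated s delta P Q (c c' : R) : (delta < c' - c)%R ->
  (forall x, P x -> (x <= c)%R) -> (forall x, Q x -> (c' <= x)%R) ->
  hausdorff_delta s delta P + hausdorff_delta s delta Q <= hausdorff_delta s delta (P `|` Q).
Proof.
move=> dc Pc Qc; apply: le_ereal_inf_tmp => _ [U [dU PQU] <-].
pose V A k := if `[< U k `&` A !=set0 >] then U k else set0.
have V_cover A : A `<=` P `|` Q -> hausdorff_delta s delta A <= \sum_(k <oo) hweight s (V A k).
  move=> AP; apply: ereal_inf_lbound; exists (V A) => //; split=> [k|x Ax].
    by rewrite /V; case: ifP => // _; rewrite diam0 leNye.
  have [k _ Ux] := PQU x (AP x Ax); exists k => //; rewrite /V asboolT//.
  by exists x.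
apply: le_trans (leeD (V_cover P _) (V_cover Q _)) _; [by left|by right|].
rewrite -nneseriesD; [|by move=> *; exact: hweight_ge0..].
apply: lee_nneseries => [k _ _|k _]; first by rewrite adde_ge0// hweight_ge0.
have h0 : hweight s (set0 : set R) = 0 by rewrite /hweight eqxx.
rewrite /V; case: asboolP => [[x [Ux Px]]|_]; case: asboolP => [[y [Uy Qy]]|_];
  rewrite ?h0 ?adde0 ?add0e//; last exact: hweight_ge0.
have := le_trans (diam_ge Uy Ux) (dU k); rewrite lee_fin => h.
have := le_trans (ler_norm _) h; have := Pc _ Px; have := Qc _ Qy; move: dc.
by clear h0; move=> *; exfalso; lra.
Qed.

Lemma hausdorff_separated s P Q (c c' : R) : (c < c')%R ->
  (forall x, P x -> (x <= c)%R) -> (forall x, Q x -> (c' <= x)%R) ->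
  hausdorff s P + hausdorff s Q <= hausdorff s (P `|` Q).
Proof.
move=> cc Pc Qc.
(* Independent scales for [P] and [Q] allow the two suprema to be taken one after the other. *)
have h d1 d2 : (0 < d1)%R -> (0 < d2)%R ->
    hausdorff_delta s d1 P + hausdorff_delta s d2 Q <= hausdorff s (P `|` Q).
  move=> d10 d20; pose d0 := ((c' - c) / 2)%R.
  have d00 : (0 < d0)%R by rewrite divr_gt0// subr_gt0.
  pose d := Num.min d0 (Num.min d1 d2).
  have d_gt0 : (0 < d)%R by rewrite !lt_min d00 d10 d20.
  apply: le_trans (hausdorff_delta_le s (P `|` Q) d_gt0).
  apply: le_trans (@hausdorff_delta_separated s d P Q c c' _ Pc Qc).
    by apply: leeD; apply: hausdorff_delta_anti; rewrite !ge_min lexx ?orbT.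
  apply: (@le_lt_trans _ _ d0); first by rewrite ge_min lexx.
  by rewrite /d0; move: cc => *; lra.
have [->|] := eqVneq (hausdorff s (P `|` Q)) +oo; first exact: leey.
rewrite -ltey; move: h; move: (hausdorff s (P `|` Q)) => z h zoo.
have dge d A : 0 <= hausdorff_delta s d A := hausdorff_delta_ge0 s d A.
have fin2 d : (0 < d)%R -> hausdorff_delta s d Q \is a fin_num.
  move=> d0; rewrite ge0_fin_numE//; apply: le_lt_trans zoo.
  by apply: le_trans (h 1%R d _ d0); rewrite ?leeDr.
have h1 d : (0 < d)%R -> hausdorff s P + hausdorff_delta s d Q <= z.
  move=> d0; rewrite -leeBrDr ?fin2//; apply: ge_ereal_sup => _ [d' d'0 <-].
  by rewrite leeBrDr ?fin2// h.
have finP : hausdorff s P \is a fin_num.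
  rewrite ge0_fin_numE; last exact: (outer_measure_ge0 (hausdorff_outer s)).
  by apply: le_lt_trans zoo; apply: le_trans (h1 1%R _); rewrite ?leeDl.
rewrite addeC -leeBrDr//; apply: ge_ereal_sup => _ [d' d'0 <-].
by rewrite leeBrDr// addeC h1.
Qed.

(* The layers [B k] at distance about 2^-k from [t] with [k] of the same parity are separated,
   so their measures have a finite sum and those close to [t] are negligible. *)
Lemma hausdorff_ray_caratheodory s (t : R) : (hausdorff_outer s).-caratheodory `]t, +oo[.
Proof.
apply: le_caratheodory_measurable => X; set mu := hausdorff_outer s.
have [->|] := eqVneq (mu X) +oo; first exact: leey.
rewrite -ltey => Xoo; set A := `]t, +oo[%classic.
have [r rE] : exists r : nat -> R, forall k, r k = ((2^-1) ^+ k)%R by exists (fun k => (2^-1) ^+ k)%R.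
have rS k : r k = (r k.+1 + r k.+1)%R by rewrite !rE exprS; move: (_ ^+ k)%R => z; lra.
have r0 k : (0 < r k)%R by rewrite rE exprn_gt0.
pose B k := X `&` [set x | t + r k.+1 < x <= t + r k]%R.
pose Y k := X `&` [set x | t + r k + r k < x]%R.
(* [Y (k + 2)] contains both [B k] and [Y k], because 2 r (k + 2) = r (k + 1), and these two are
   separated by a distance r k. *)
have alt i m : \sum_(j < m) mu (B (2 * j + i)%N) <= mu (Y (2 * m + i)%N).
  elim: m => [|m IH]; first by rewrite big_ord0 outer_measure_ge0.
  rewrite big_ord_recr /=; apply: le_trans (leeD2r _ IH) _.
  have -> : (2 * m.+1 + i = (2 * m + i).+2)%N by rewrite mulnS.
  move: (2 * m + i)%N => k; rewrite addeC.
  apply: le_trans (@hausdorff_separated s (B k) (Y k) (t + r k) (t + r k + r k) _ _ _) _.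
  - by rewrite ltrDl.
  - by move=> x [_ /= /andP[]].
  - by move=> x [_ /= /ltW].
  apply: (le_outer_measure mu) => x.
  have := r0 k.+1; have := rS k; have := rS k.+1; move=> e1 e2 e3.
  by move=> [[Xx /= /andP[x1 x2]]|[Xx /= x1]]; split=> //=; clear IH Xoo; lra.
have sumB m : \sum_(k < 2 * m) mu (B k) <= mu X + mu X.
  have -> : \sum_(k < 2 * m) mu (B k) =
      \sum_(j < m) mu (B (2 * j + 0)%N) + \sum_(j < m) mu (B (2 * j + 1)%N).
    elim: m => [|m IH]; first by rewrite !big_ord0 adde0.
    by rewrite mulnS !addSn add0n !big_ord_recr /= IH addn0 addn1 -!addeA; congr (_ + _); rewrite addeCA.
  by apply: leeD; apply: le_trans (alt _ _) _; apply: le_outer_measure => x [].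
have B0 k : 0 <= mu (B k) := outer_measure_ge0 mu (B k).
have sumBoo : \sum_(k <oo) mu (B k) < +oo.
  apply: (@le_lt_trans _ _ (mu X + mu X)); last by rewrite lte_add_pinfty.
  apply: lime_le; first by apply: is_cvg_nneseries.
  near=> n; apply: le_trans (sumB n); rewrite -(big_mkord xpredT (fun k => mu (B k))).
  by apply: lee_sum_nneg_natr => //; rewrite mul2n -addnn leq_addr.
have tail := nneseries_tail_cvg sumBoo (fun k _ => B0 k).
apply/lee_addgt0Pr => e e0.
have [n hn] : exists n, \sum_(n <= k <oo) mu (B k) < e%:E.
  have : \forall N \near \oo, \sum_(N <= k <oo) mu (B k) < e%:E.
    apply: (tail (fun y => y < e%:E)); apply: open_nbhs_nbhs; split; last by rewrite /= lte_fin.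
    exact: open_ereal_lt_ereal.
  by case=> N _ /(_ N (leqnn N)) h; exists N.
(* The part of [X] in the ray is covered by the points beyond t + r n, which are separated from the
   complement of the ray, and the layers of index at least n, whose total is below e. *)
apply: le_trans (_ : mu (X `&` [set x | t + r n < x]%R) + \sum_(n <= k <oo) mu (B k) + mu (X `&` ~` A) <= _).
  rewrite leeD2r//; apply: le_trans (_ : mu (X `&` [set x | t + r n < x]%R `|` \bigcup_k B (k + n)%N) <= _).
    apply: le_outer_measure => x [Xx]; rewrite /A /= in_itv/= andbT => tx.
    have [h|h] := ltP (t + r n)%R x; first by left.
    right; clear alt sumB sumBoo tail hn Xoo; have [N hN] : exists N, (r N < x - t)%R.
      have := @cvg_expr _ (2^-1 : R); rewrite ger0_norm// invf_lt1// ltr1n => /(_ isT).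
      move=> /cvgrPdist_lt /(_ (x - t)%R); rewrite subr_gt0 => /(_ tx)[N _ /(_ N (leqnn N))].
      by rewrite sub0r normrN -rE ger0_norm ?(ltW (r0 N))// => hN; exists N.
    elim: N hN => [|N IH] hN.
      have : (r n <= 1)%R by rewrite rE exprn_ile1// invf_le1// ler1n.
      by move: hN; rewrite rE expr0 => *; exfalso; lra.
    have [hN'|hN'] := ltP (r N) (x - t)%R; first exact: IH.
    have nN : (n <= N)%N.
      rewrite leqNgt; apply/negP => Nn; have : (r n <= r N.+1)%R.
        by rewrite !rE ler_wiXn2l// invf_le1// ler1n.
      by move=> *; lra.
    by exists (N - n)%N => //; rewrite subnK//; split=> //=; apply/andP; split; lra.
  apply: le_trans (outer_measureU2 _ _ _) _; rewrite leeD2l//.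
  rewrite -(nneseries_addn n B0); exact: outer_measure_sigma_subadditive.
rewrite addeAC leeD ?(ltW hn)// addeC.
apply: le_trans (@hausdorff_separated s _ _ t (t + r n) _ _ _) _.
- by rewrite ltrDl.
- by move=> x [_ /= ]; rewrite /A /= in_itv/= andbT => /negP; rewrite -leNgt.
- by move=> x [_ /= /ltW].
by apply: (le_outer_measure mu) => x [[]|[]].
Unshelve. all: by end_near. Qed.

Lemma borel_caratheodory s (A : set R) : measurable (A : set (measurableTypeR R)) ->
  measurable (A : set (caratheodory_type (hausdorff_outer s))).
Proof.
have : measurable_fun setT (id : caratheodory_type (hausdorff_outer s) -> measurableTypeR R).
  apply: (measurability _ (RGenOInfty.measurableE R)) => _ [_ [x ->] <-].
  by rewrite setTI; exact: hausdorff_ray_caratheodory.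
by move=> h mA; have := h measurableT A mA; rewrite setTI.
Qed.

Lemma hausdorff_sim_le s r (h : R -> R) A : (0 <= s)%R -> (0 < r)%R -> sim r h ->
  hausdorff s (h @` A) <= (r `^ s)%:E * hausdorff s A.
Proof.
move=> s0 r0 sh; apply: ge_ereal_sup => _ [d /= d0 <-].
have d'0 : (0 < d / r)%R by rewrite divr_gt0.
apply: le_trans (_ : (r `^ s)%:E * hausdorff_delta s (d / r) A <= _); last first.
  by rewrite lee_wpmul2l ?lee_fin ?powR_ge0// hausdorff_delta_le.
rewrite -lee_pdivrMl ?powR_gt0//; apply: le_ereal_inf_tmp => _ [U [dU AU] <-].
rewrite lee_pdivrMl ?powR_gt0// -nneseriesZl; last by move=> *; exact: hweight_ge0.
apply: (@le_trans _ _ (\sum_(k <oo) hweight s (h @` U k))).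
  apply: ereal_inf_lbound; exists (fun k => h @` U k) => //; split=> [k|_ [x Ax <-]].
    apply: diam_le => _ _ [x Ux <-] [y Uy <-]; rewrite sh -ler_pdivlMl// mulrC.
    by have := le_trans (diam_ge Ux Uy) (dU k); rewrite lee_fin.
  by have [k _ Ux] := AU x Ax; exists k => //; exists x.
apply: lee_nneseries => [k _ _|k _]; first exact: hweight_ge0.
have [->|/[dup] Un /set0P[x0 Ux0]] := eqVneq (U k) set0.
  by rewrite image_set0 /hweight eqxx mule0.
rewrite /hweight (negbTE Un) ifF; last by apply/negbTE/set0P; exists (h x0), x0.
have dfin : diam (U k) \is a fin_num.
  rewrite ge0_fin_numE; first exact: le_lt_trans (dU k) (ltry _).
  by apply: le_trans (diam_ge Ux0 Ux0); rewrite lee_fin.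
have d_ge0 : (0 <= fine (diam (U k)))%R.
  by rewrite fine_ge0//; apply: le_trans (diam_ge Ux0 Ux0); rewrite lee_fin.
rewrite -(fineK dfin) poweR_EFin -EFinM -powRM ?(ltW r0)// -poweR_EFin.
apply: gt0_ler_poweR => //; rewrite ?in_itv/= ?leey ?andbT.
- by apply: le_trans (diam_ge (imageP h Ux0) (imageP h Ux0)); rewrite lee_fin.
- by rewrite lee_fin mulr_ge0// ltW.
apply: diam_le => _ _ [x Ux <-] [y Uy <-]; rewrite sh ler_wpM2l ?(ltW r0)//.
by have := diam_ge Ux Uy; rewrite -{1}(fineK dfin) lee_fin.
Qed.

Lemma hausdorff_sim s r (h : R -> R) A : (0 <= s)%R -> (0 < r)%R -> sim r h ->
  hausdorff s (h @` A) = (r `^ s)%:E * hausdorff s A.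
Proof.
move=> s0 r0 sh; apply/eqP; rewrite eq_le hausdorff_sim_le//=.
have [g [sg [hg gh]]] := sim_inv r0 sh; have r0' : (0 < r^-1)%R by rewrite invr_gt0.
have := hausdorff_sim_le (h @` A) s0 r0' sg.
rewrite image_comp (_ : (g \o h) @` A = A); last first.
  apply/seteqP; split=> [_ [x Ax <-]|x Ax]; first by rewrite /= hg.
  by exists x => //=; rewrite hg.
by rewrite powR_V// lee_pdivlMl ?powR_gt0.
Qed.

End HausdorffMeasure.

(** * Packing of intervals by length *)

Section Overlap.
Context {R : realType}.
Implicit Types (a b s t u v c l : R).

(* The length of the intersection of [a, b] and [s, t]. *)
Definition overlap a b s t : R := Num.max 0 (Num.min b t - Num.max a s).

Lemma overlap_affine a b s t c l : 0 <= l ->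
  overlap (c + l * a) (c + l * b) (c + l * s) (c + l * t) = l * overlap a b s t.
Proof.
move=> l0; rewrite /overlap -!addr_minr -!addr_maxr -minr_pMr// -maxr_pMr//.
by rewrite [RHS]maxr_pMr// mulr0; congr Num.max; rewrite opprD addrACA subrr add0r mulrBr.
Qed.

Lemma overlapN a b s t : overlap (- b) (- a) (- t) (- s) = overlap a b s t.
Proof. by rewrite /overlap -oppr_max -oppr_min opprK addrC. Qed.

Lemma overlap_ge0 a b s t : 0 <= overlap a b s t.
Proof. by rewrite le_max lexx. Qed.

Lemma overlap_le a b s t : s <= t -> overlap a b s t <= t - s.
Proof.
move=> st; rewrite ge_max subr_ge0 st /=; apply: lerB; first by rewrite ge_min lexx orbT.
by rewrite le_max lexx orbT.
Qed.

Lemma overlap_sub a b s t : s <= a -> a <= b -> b <= t -> overlap a b s t = b - a.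
Proof.
move=> sa ab bt; rewrite /overlap (min_idPl bt) (max_idPl sa).
by apply/max_idPr; rewrite subr_ge0.
Qed.

Lemma lebesgue_overlap a b s t :
  lebesgue_measure (`[a, b] `&` `[s, t] : set R) = (overlap a b s t)%:E.
Proof.
rewrite (_ : _ `&` _ = [set` `[Num.max a s, Num.min b t]]); last first.
  apply/seteqP; split=> x /=; rewrite !in_itv/= ge_max le_min.
    by move=> [/andP[-> ->] /andP[-> ->]].
  by move=> /andP[/andP[-> ->] /andP[-> ->]].
rewrite lebesgue_measure_itv /= lte_fin /overlap -EFinB; case: ltP => h.
  by congr EFin; apply/esym/max_idPr; rewrite subr_ge0 ltW.
by congr EFin; apply/esym/max_idPl; rewrite subr_le0.
Qed.

(** Additivity of Lebesgue measure on disjoint subintervals. *)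
Lemma sum_overlap (n : nat) (a b : 'I_n -> R) a0 b0 s t :
  (forall i, `[a i, b i] `<=` `[a0, b0])%classic ->
  (forall i j, i != j -> `[a i, b i]%classic `&` `[a j, b j] = set0) ->
  \sum_i overlap (a i) (b i) s t <= overlap a0 b0 s t.
Proof.
move=> sub dis; rewrite -lee_fin -sumEFin -lebesgue_overlap.
pose A i := `[a i, b i]%classic `&` `[s, t].
have mA i : measurable (A i) by apply: measurableI; exact: measurable_itv.
rewrite (eq_bigr (fun i => lebesgue_measure (A i))); last by move=> i _; rewrite lebesgue_overlap.
rewrite -(@measure_semi_additive_ord _ _ _ (@lebesgue_measure R) n A) //.
- apply: le_measure; rewrite ?inE.
  + by apply: bigsetU_measurable => i _; exact: mA.
  + by apply: measurableI; exact: measurable_itv.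
  + apply: (big_ind (fun U => U `<=` _)) => [//|U V hU hV|i _].
      by rewrite subUset.
    by apply: setSI; exact: sub.
- apply/trivIsetP => i j _ _ ij; rewrite /A setIACA dis// set0I//.
- by apply: bigsetU_measurable => i _; exact: mA.
Qed.

(** Undoing one similarity: the test interval is pulled back, and enlarging it by r before the
    pullback is enlarging it by r / l afterwards. This drives the induction on levels in
    [mass_le]. *)
Lemma sim_pull l (f : R -> R) a b u v : 0 < l -> sim l f -> a < b -> u < v ->
  exists a' b' u' v', [/\ f @` `[a, b] = `[a', b']%classic, a' < b' /\ u' < v',
    b' - a' = l * (b - a),
    forall x, f x \in `[u, v] = (x \in `[u', v']) &
    forall r, overlap a' b' (u - r) (v + r) = l * overlap a b (u' - r / l) (v' + r / l)].
Proof.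
move=> l0 sf ab uv; have [a' [b' [ab' ba' im _ ends]]] := sim_image_itv l0 sf ab.
have [e [c [e1 fE]]] := sim_affine l0 sf; have ln0 : l != 0 by rewrite gt_eqF.
exists a', b'; case: e1 => e1; rewrite e1 in fE.
  have ffE x : f x = c + l * x by rewrite fE mul1r.
  have {}ends : a' = c + l * a /\ b' = c + l * b.
    rewrite -!ffE; case: ends => // -[h1 h2]; exfalso.
    have : f b < f a by rewrite -h1 -h2.
    by rewrite !ffE ltrD2l ltr_pM2l// ltNge ltW.
  exists ((u - c) / l), ((v - c) / l); split => //.
  - by split=> //; rewrite ltr_pM2r ?invr_gt0// ltrD2r.
  - move=> x; rewrite !in_itv/= ffE ler_pdivrMr// ler_pdivlMr// [x * l]mulrC.
    by rewrite lerBlDl lerBrDl.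
  - move=> r; rewrite -(overlap_affine _ _ _ _ c (ltW l0)) -!ends.1 -ends.2.
    by congr overlap; rewrite -?mulrBl -?mulrDl mulrC mulfVK//; ring.
have ffE x : f x = c + l * - x by rewrite fE; ring.
have {}ends : a' = c + l * - b /\ b' = c + l * - a.
  rewrite -!ffE; case: ends => // -[h1 h2]; exfalso.
  have : f a < f b by rewrite -h1 -h2.
  by rewrite !ffE ltrD2l ltr_pM2l// ltrN2 ltNge ltW.
exists ((c - v) / l), ((c - u) / l); split => //.
- by split=> //; rewrite ltr_pM2r ?invr_gt0// ltrD2l ltrN2.
- move=> x; rewrite !in_itv/= ffE ler_pdivrMr// ler_pdivlMr// [x * l]mulrC mulrN.
  by rewrite andbC; congr andb; apply/idP/idP => ?; lra.
- move=> r; rewrite -[overlap a b _ _]overlapN -(overlap_affine _ _ _ _ c (ltW l0)) -ends.1 -ends.2.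
  by congr overlap; rewrite -?mulrBl -?mulrDl -?mulNr mulrC mulfVK//; ring.
Qed.

End Overlap.

(** * Dimension of the fractal *)

Section Mass.
Context {R : realType}.
Variable S : similar_system R.
Local Notation q := (ss_q S).
Local Notation a := (ss_a S).
Local Notation b := (ss_b S).
Local Notation L := (ss_b S - ss_a S).
Local Notation l := (@ss_l _ S).
Local Notation F := (tail_fractal S 0).
Implicit Types (k n : nat) (u v r : R).

Let L_gt0 : 0 < L. Proof. by rewrite subr_gt0 ss_ab. Qed.

Lemma sum_overlap_le k u v (ai bi : 'I_q -> R) :
  (forall i, ss_W k i @` `[a, b] = `[ai i, bi i]%classic) ->
  \sum_i overlap (ai i) (bi i) u v <= overlap a b u v.
Proof.
move=> im; apply: sum_overlap => [i|i j ij].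
  by rewrite -im; exact: ss_sub.
by rewrite -!im; exact: ss_disj.
Qed.

(** The children are disjoint subintervals of [a, b]. The bound is what places the root of Moran's
    equation at or below 1. *)
Lemma sum_ratios_le1 : \sum_i l i <= 1.
Proof.
have h i := sim_image_itv (proj1 (andP (ss_l01 i))) (@ss_sim _ S 0%N i) (ss_ab S).
have [ai hb] := choice h; have [bi hi] := choice hb.
have im i : ss_W 0%N i @` `[a, b] = `[ai i, bi i]%classic by case: (hi i).
have := sum_overlap_le a b im; rewrite [leRHS]overlap_sub ?(ltW (ss_ab S))//.
rewrite (eq_bigr (fun i => l i * L)); last first.
  move=> i _; have [ab ba e _ _] := hi i; have sub := @ss_sub _ S 0%N i.
  have h1 : `[a, b]%classic (ai i) by apply: sub; rewrite e /= bound_itvE ltW.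
  have h2 : `[a, b]%classic (bi i) by apply: sub; rewrite e /= bound_itvE ltW.
  move: h1 h2; rewrite /= !in_itv/= => /andP[h1 _] /andP[_ h2].
  by rewrite overlap_sub ?(ltW ab).
by rewrite -mulr_suml -[leRHS]mul1r ler_pM2r.
Qed.

(** Intermediate values between the exponent 0, where the sum is q > 1, and the exponent 1, where it
    is at most 1. *)
Lemma ratio_sum_root : exists2 d : R, 0 < d <= 1 & ratio_sum S d = 1.
Proof.
have c : continuous (ratio_sum S).
  apply: (@continuous_big R _ +%R 0 xpredT _ R (index_enum 'I_q) (fun i s => l i `^ s)).
    exact: add_continuous.
  move=> i _ x; have /andP[l0 _] := ss_l01 i; rewrite /powR gt_eqF//.
  apply: (continuous_comp (f := fun s : R => s * ln (l i)) (g := @expR R)); last exact: continuous_expR.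
  by apply: cvgM; [exact: cvg_id|exact: cvg_cst].
have r0 : 1 < ratio_sum S 0.
  rewrite /ratio_sum (eq_bigr (fun=> 1)); last by move=> i _; rewrite powRr0.
  by rewrite sumr_const card_ord ltr1n q_gt1.
have r1 : ratio_sum S 1 <= 1.
  apply: le_trans sum_ratios_le1; apply: ler_sum => i _; rewrite powRr1//.
  by have /andP[/ltW] := ss_l01 i.
have mm : Num.min (ratio_sum S 0) (ratio_sum S 1) <= 1 <= Num.max (ratio_sum S 0) (ratio_sum S 1).
  by rewrite ge_min le_max r1 (ltW r0) orbT.
have [d] := IVT ler01 (continuous_subspaceT c) mm.
rewrite in_itv/= => /andP[d0 d1] rd; exists d => //; rewrite d1 andbT.
by rewrite lt_neqAle d0 andbT; apply: contra_ltN r0 => /eqP ->; rewrite rd.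
Qed.

Variable d : R.
Hypotheses (d01 : 0 < d <= 1) (ratio1 : ratio_sum S d = 1).

Let d_gt0 : 0 < d. Proof. by case/andP: d01. Qed.

(** The weights are those of the natural measure on words; counting the level-n cells that meet
    [u, v] bounds that measure from above without constructing it as a limit. The words start at
    level [k]. *)
Definition mass k n u v : R :=
  \sum_(w <- words S n | `[< cell S k w `&` `[u, v]%classic !=set0 >]) lam w `^ d.

Lemma mass_le1 k n u v : mass k n u v <= 1.
Proof.
apply: le_trans (_ : \sum_(w <- words S n) lam w `^ d <= _).
  by rewrite /mass big_mkcond; apply: ler_sum => w _; case: ifP => // _; exact: powR_ge0.
by rewrite sum_words -[\sum_i _]/(ratio_sum S d) ratio1 expr1n.
Qed.

Lemma mass0 k n u v : ~ (`[a, b]%classic `&` `[u, v] !=set0) -> mass k n u v = 0.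
Proof.
move=> h; rewrite /mass big1// => w /asboolP[x [wx uvx]]; case: h; exists x; split=> //.
exact: cell_sub wx.
Qed.

Lemma massS k n u v (u' v' : 'I_q -> R) :
  (forall i x, ss_W k i x \in `[u, v] = (x \in `[u' i, v' i])) ->
  mass k n.+1 u v = \sum_i l i `^ d * mass k.+1 n (u' i) (v' i).
Proof.
move=> hW; rewrite /mass /= big_mkcond big_allpairs_dep /= big_enum /=.
apply: eq_bigr => i _; have /andP[l0 _] := ss_l01 i.
rewrite mulr_sumr [RHS]big_mkcond; apply: eq_bigr => w _.
rewrite lam_cons powRM ?(ltW l0) ?(ltW (lam_gt0 _))//.
suff -> : `[< cell S k (i :: w) `&` `[u, v]%classic !=set0 >] =
          `[< cell S k.+1 w `&` `[u' i, v' i]%classic !=set0 >] by [].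
apply: asbool_equiv_eq; split.
  move=> [_ [[z zab <-] /= h]]; exists (wd S k.+1 w z); split; first by exists z.
  by rewrite /= -hW.
move=> [_ [[z zab <-] /= h]]; exists (wd S k (i :: w) z); split; first by exists z.
by rewrite /= hW.
Qed.

(* Induction on n: a child of length at least r is rescaled, a shorter child which meets [u, v] lies in [u - r, v + r]. *)
Lemma mass_le (lm lM : R) k n u v r : 0 < lm -> lm <= 1 -> (forall i, lm <= l i) -> 0 < lM ->
  (forall i, l i <= lM) ->
  u < v -> r <= L -> 0 < r -> lM ^+ n * L <= r ->
  mass k n u v <= lm^-1 * (r / L) `^ d * overlap a b (u - r) (v + r) / r.
Proof.
move=> lm0 lm1 hm lM0 hM; elim: n k u v r => [|n IH] k u v r uv rL r0 nr.
  (* At level 0 the two bounds on r force r = L; if [a, b] is met at all, it lies in the enlarged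
     interval and the bound is the inverse of [lm], at least 1. *)
  have {rL nr}rE : r = L by apply/eqP; rewrite eq_le rL -[leLHS]mul1r.
  have [hit|/mass0 ->] := pselect (`[a, b]%classic `&` `[u, v] !=set0); last first.
    by rewrite !mulr_ge0 ?invr_ge0 ?powR_ge0 ?overlap_ge0 ?(ltW r0) ?(ltW lm0).
  apply: le_trans (mass_le1 _ _ _ _) _; rewrite rE divff ?gt_eqF// powR1 mulr1.
  case: hit => x [/=]; rewrite !in_itv/= => /andP[ax xb] /andP[ux xv].
  have ab := ltW (ss_ab S).
  rewrite overlap_sub//; [|by move: ax xb ux xv => *; lra|by move: ax xb ux xv => *; lra].
  by rewrite mulfK ?gt_eqF// invf_ge1.
have h i := sim_pull (proj1 (andP (ss_l01 i))) (@ss_sim _ S k i) (ss_ab S) uv.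
have [ai h1] := choice h; have [bi h2] := choice h1; have [ui h3] := choice h2; have [vi hi] := choice h3.
rewrite (massS n (fun i => let: And5 _ _ _ h _ := hi i in h)).
have im i : ss_W k i @` `[a, b] = `[ai i, bi i]%classic by case: (hi i).
pose c := lm^-1 * (r / L) `^ d.
have c0 : 0 <= c by rewrite mulr_ge0 ?powR_ge0// invr_ge0 ltW.
apply: le_trans (_ : \sum_i c * overlap (ai i) (bi i) (u - r) (v + r) / r <= _); last first.
  rewrite -mulr_suml -mulr_sumr ler_wpM2r ?invr_ge0 ?(ltW r0)// ler_wpM2l//.
  exact: sum_overlap_le im.
apply: ler_sum => i _; have [_ [ab uvi] ba hx ov] := hi i; have /andP[l0 l1] := ss_l01 i.
have [rl|rl] := leP (r / l i) L.
  have small : lM ^+ n * L <= r / l i.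
    rewrite ler_pdivlMr//; apply: le_trans nr; rewrite exprSr -!mulrA ler_pM2l ?exprn_gt0//.
    by rewrite mulrC ler_wpM2r ?(ltW L_gt0).
  have hm' := IH k.+1 (ui i) (vi i) (r / l i) uvi rl (divr_gt0 r0 l0) small.
  apply: le_trans (ler_wpM2l (powR_ge0 _ _) hm') _; rewrite ov /c.
  rewrite (_ : r / L = l i * (r / l i / L)); last by field; rewrite !gt_eqF.
  have rl0 : 0 <= r / l i / L by apply/ltW; rewrite !divr_gt0.
  rewrite (@powRM _ (l i) (r / l i / L) d (ltW l0) rl0).
  rewrite le_eqVlt; apply/orP; left; apply/eqP; move: (powR _ _) (powR _ _) => x y.
  by field; rewrite !gt_eqF.
have [hit|/mass0 ->] := pselect (`[a, b]%classic `&` `[ui i, vi i] !=set0); last first.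
  by rewrite mulr0; apply: mulr_ge0; rewrite ?invr_ge0 ?(ltW r0)// mulr_ge0// overlap_ge0.
(* Bounding the share of a short child by 1 is enough: its overlap is its full length, at least lm
   L, and r / L <= (r / L)^d because d <= 1. *)
apply: le_trans (_ : 1 * 1 <= _).
  apply: ler_pM; rewrite ?powR_ge0 ?mass_le1//.
  - by rewrite /mass sumr_ge0// => *; exact: powR_ge0.
  - by rewrite powR_le1// ltW.
case: hit => x [xab xuv].
have {xuv} : ss_W k i x \in `[u, v] by rewrite hx.
have : `[ai i, bi i]%classic (ss_W k i x) by rewrite -im; exists x.
rewrite /= !in_itv/= => /andP[ax xb] /andP[ux xv].
have {}rl : l i * L < r by rewrite mulrC -ltr_pdivlMr.
rewrite overlap_sub ?(ltW ab) ?ba//; [|by move: ax xb ux xv ba rl => *; lra|by move: ax xb ux xv ba rl => *; lra].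
rewrite mul1r /c ler_pdivlMr// mul1r.
have rho1 : r / L <= 1 by rewrite ler_pdivrMr// mul1r.
have rho0 : 0 < r / L by rewrite divr_gt0.
have p : r / L <= (r / L) `^ d.
  by apply: ger1_powR; [rewrite rho0|case/andP: d01].
apply: le_trans (_ : (r / L) * L <= _); first by rewrite divfK ?gt_eqF.
rewrite mulrA ler_pM2r// mulrAC; apply: le_trans (_ : (r / L) `^ d <= _) => //.
by rewrite ler_peMl ?powR_ge0// ler_pdivlMl// mulr1.
Qed.

(** [mass_le] is applied at scale 2 r: the interval of length 2 r, enlarged by 2 r on each side, has
    length 6 r, which gives the factor 3. If 2 r exceeds L, the bound follows from the total mass
    1. *)
Lemma mass_ball : exists2 C : R, 0 < C & forall x r, 0 < r ->
  exists N, forall n, (N <= n)%N -> mass 0 n (x - r) (x + r) <= C * r `^ d.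
Proof.
have [lm [lM [lm0 /andP[lM0 lM1] hm hM]]] := l_bounds S.
have lm1 : lm <= 1.
  have i0 : 'I_q by exists 0%N; exact: ltnW (q_gt1 S).
  apply: le_trans (hm i0) _; have /andP[_ /ltW//] := ss_l01 i0.
have C0 : 0 < 3 * lm^-1 * (2 / L) `^ d.
  by rewrite !mulr_gt0 ?invr_gt0 ?powR_gt0// divr_gt0.
exists (3 * lm^-1 * (2 / L) `^ d) => // x r r0.
have -> : 3 * lm^-1 * (2 / L) `^ d * r `^ d = 3 * lm^-1 * (2 * r / L) `^ d.
  have p0 : 0 <= 2 / L by rewrite divr_ge0// ltW.
  by rewrite -mulrA -(powRM _ p0 (ltW r0)) [2 / L * r]mulrAC.
have lm1' : 1 <= lm^-1 by rewrite invf_ge1.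
have [rL|rL] := leP (2 * r) L; last first.
  exists 0%N => n _; apply: le_trans (mass_le1 _ _ _ _) _.
  have : 1 <= (2 * r / L) `^ d.
    by rewrite -[leLHS](powRr0 (2 * r / L)) ler_powR ?(ltW d_gt0)// ler_pdivlMr// mul1r ltW.
  move=> h; apply: le_trans (_ : 1 * 1 <= _); first by rewrite mulr1.
  by apply: ler_pM => //; apply: le_trans lm1' _; rewrite ler_peMl ?invr_ge0 ?(ltW lm0)// ler1n.
have e0 : 0 < 2 * r / L by rewrite divr_gt0// mulr_gt0.
have [N hN] : exists N, forall n, (N <= n)%N -> lM ^+ n < 2 * r / L.
  have := @cvg_expr _ lM; rewrite ger0_norm ?(ltW lM0)// => /(_ lM1).
  move=> /cvgrPdist_lt /(_ _ e0)[N _ hN]; exists N => n /hN.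
  by rewrite sub0r normrN ger0_norm// exprn_ge0// ltW.
exists N => n /hN /ltW nr.
apply: le_trans (@mass_le lm lM 0 n (x - r) (x + r) (2 * r) lm0 lm1 hm lM0 hM _ rL _ _) _.
- by lra.
- by rewrite mulr_gt0.
- by rewrite -ler_pdivlMr.
rewrite [leRHS](_ : _ = lm^-1 * (2 * r / L) `^ d * 3); last by ring.
rewrite -mulrA ler_wpM2l ?mulr_ge0 ?powR_ge0 ?invr_ge0 ?(ltW lm0)//.
rewrite ler_pdivrMr ?mulr_gt0//; apply: le_trans (overlap_le _ _ _) _; by lra.
Qed.

End Mass.

(** * Bounds for the Hausdorff measure of the fractal *)

Section FractalDimension.
Context {R : realType}.
Variable S : similar_system R.
Local Notation q := (ss_q S).
Local Notation a := (ss_a S).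
Local Notation b := (ss_b S).
Local Notation L := (ss_b S - ss_a S).
Local Notation F := (tail_fractal S 0).
Implicit Types (k n : nat) (s r : R).

Let L_gt0 : 0 < L. Proof. by rewrite subr_gt0 ss_ab. Qed.

Lemma compact_tail_fractal k : compact (tail_fractal S k).
Proof.
apply: (@subclosed_compact _ _ `[a, b]); last exact: tail_fractal_sub.
  exact: closed_tail_fractal.
exact: segment_compact.
Qed.

(** The cover consists of the cells of level n, listed and continued by empty sets of weight 0. *)
Lemma hausdorff_delta_fractal_le s delta : 0 < s -> 0 < delta -> exists N, forall n, (N <= n)%N ->
  (hausdorff_delta s delta F <= (L `^ s * ratio_sum S s ^+ n)%:E)%E.
Proof.
move=> s0 d0; have dL : 0 < delta / L by rewrite divr_gt0.
have [N hN] := lam_small S dL; exists N => n Nn.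
pose U k := if (k < size (words S n))%N then cell S 0 (nth [::] (words S n) k) else set0.
apply: (@le_trans _ _ (\sum_(k <oo) hweight s (U k))%E).
  apply: ereal_inf_lbound; exists U => //; split=> [k|x Fx].
    rewrite /U; case: ltnP => kn; last by rewrite diam0 leNye.
    apply: diam_le => x y hx hy; apply: le_trans (cell_width hx hy) _.
    rewrite -ler_pdivlMr// ltW// hN//.
    by have := mem_nth [::] kn; rewrite mem_words => /eqP ->.
  have [w wn wx] := fractal_word n Fx.
  exists (index w (words S n)) => //; rewrite /U index_mem wn nth_index//.
rewrite (@nneseries_split _ _ 0 (size (words S n))); last by move=> *; exact: hweight_ge0.
rewrite eseries0 ?adde0; last first.
  by move=> i; rewrite add0n => ni _; rewrite /U ltnNge ni /= /hweight eqxx.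
apply: (@le_trans _ _ (\sum_(0 <= k < size (words S n)) ((lam (nth [::] (words S n) k) * L) `^ s)%:E)%E).
  rewrite add0n big_nat_cond [leRHS]big_nat_cond; apply: lee_sum => k /andP[/andP[_ kn] _].
  rewrite /U kn; have [u [v [uv vu e _ _]]] := cell_itv 0 (nth [::] (words S n) k).
  have nz : (cell S 0 (nth [::] (words S n) k) == set0) = false.
    by apply/negbTE/set0P; exists u; rewrite e /= bound_itvE ltW.
  rewrite /hweight nz -poweR_EFin; apply: gt0_ler_poweR; rewrite ?(ltW s0)// ?in_itv/= ?leey ?andbT.
  - have hu : cell S 0 (nth [::] (words S n) k) u by rewrite e /= bound_itvE ltW.
    by apply: le_trans (diam_ge hu hu); rewrite lee_fin.
  - by rewrite lee_fin mulr_ge0 ?(ltW L_gt0) ?(ltW (lam_gt0 _)).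
  - by apply: diam_le => x y; exact: cell_width.
rewrite sumEFin lee_fin -(big_nth [::] xpredT (fun w => (lam w * L) `^ s)).
rewrite (eq_bigr (fun w => L `^ s * lam w `^ s)); last first.
  by move=> w _; rewrite powRM ?(ltW L_gt0) ?(ltW (lam_gt0 _))// mulrC.
by rewrite -mulr_sumr sum_words.
Qed.

Lemma hausdorff_fractal0 s : 0 < s -> ratio_sum S s < 1 -> hausdorff s F = 0%E.
Proof.
move=> s0 r1; apply/eqP; rewrite eq_le (outer_measure_ge0 (hausdorff_outer s)) andbT.
apply: ge_ereal_sup => _ [delta /= d0 <-]; have [N hN] := hausdorff_delta_fractal_le s0 d0.
have rs0 := ratio_sum_gt0 S s.
apply/lee_addgt0Pr => e e0; rewrite add0e.
have eL : 0 < e / L `^ s by rewrite divr_gt0// powR_gt0.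
have [M hM] : exists M, forall n, (M <= n)%N -> ratio_sum S s ^+ n < e / L `^ s.
  have := @cvg_expr _ (ratio_sum S s); rewrite ger0_norm ?(ltW rs0)// => /(_ r1).
  move=> /cvgrPdist_lt /(_ _ eL)[M _ hM]; exists M => n /hM.
  by rewrite sub0r normrN ger0_norm// exprn_ge0// ltW.
apply: le_trans (hN (maxn N M) _) _; first exact: leq_maxl.
by rewrite lee_fin mulrC -ler_pdivlMr ?powR_gt0// ltW// hM// leq_maxr.
Qed.

Lemma hausdorff_fractal_lty s : 0 < s -> ratio_sum S s = 1 -> (hausdorff s F < +oo)%E.
Proof.
move=> s0 r1; apply: (@le_lt_trans _ _ (L `^ s)%:E); last exact: ltry.
apply: ge_ereal_sup => _ [delta /= d0 <-]; have [N hN] := hausdorff_delta_fractal_le s0 d0.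
by apply: le_trans (hN N (leqnn N)) _; rewrite r1 expr1n mulr1.
Qed.

Lemma sum_half_powers (m : nat) : \sum_(j < m) (2^-1 : R) ^+ j.+1 <= 1.
Proof.
suff -> : \sum_(j < m) (2^-1 : R) ^+ j.+1 = 1 - 2^-1 ^+ m.
  by rewrite gerBl exprn_ge0// invr_ge0.
elim: m => [|m IH]; first by rewrite big_ord0 expr0 subrr.
by rewrite big_ord_recr /= IH exprS; move: (2^-1 ^+ m) => z; lra.
Qed.

(* Mass distribution: by [mass_ball] a ball of radius r carries mass at most C r^d, and by compactness a cover of the
   fractal can be replaced by finitely many balls, whose masses add up to at least 1. *)
Lemma hausdorff_fractal_gt0 d s : 0 < d <= 1 -> ratio_sum S d = 1 -> 0 <= s <= d ->
  (0 < hausdorff s F)%E.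
Proof.
move=> d01 r1 /andP[s0 sd]; have /andP[d0 _] := d01.
have [C C0 hC] := mass_ball d01 r1.
pose c0 := (C * 2 `^ d)^-1 / 2.
have p2 : 0 < 2 `^ d :> R by rewrite powR_gt0.
have c00 : 0 < c0 by rewrite divr_gt0// invr_gt0 mulr_gt0.
apply: (@lt_le_trans _ _ c0%:E); first by rewrite lte_fin.
(* Scale 1 suffices: for diameters at most 1 the weight of exponent s <= d is at least the power d
   of the diameter. *)
apply: le_trans (hausdorff_delta_le s F ltr01).
apply: le_ereal_inf_tmp => _ [U [dU FU] <-].
pose rad k : R := if U k == set0 then 0 else fine (diam (U k)).
pose h k : R := fine (hweight s (U k)).
have radP k x : U k x -> [/\ 0 <= rad k <= 1, diam (U k) = (rad k)%:E &
    forall y, U k y -> `|x - y| <= rad k].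
  move=> Ux; have nz : (U k == set0) = false by apply/negbTE/set0P; exists x.
  have g0 : (0 <= diam (U k))%E by apply: le_trans (diam_ge Ux Ux); rewrite lee_fin.
  have f : diam (U k) \is a fin_num.
    by rewrite ge0_fin_numE//; exact: le_lt_trans (dU k) (ltry _).
  rewrite /rad nz fineK//; split=> //.
    by rewrite fine_ge0//= -lee_fin fineK.
  by move=> y Uy; rewrite -lee_fin fineK//; exact: diam_ge.
have hE k : hweight s (U k) = (h k)%:E.
  have [U0|/set0P[x Ux]] := eqVneq (U k) set0; first by rewrite /h /hweight U0 eqxx.
  have [_ e _] := radP k x Ux; rewrite /h /hweight ifF; last by apply/negbTE/set0P; exists x.
  by rewrite e poweR_EFin.
have h0 k : 0 <= h k by rewrite -lee_fin -hE; exact: hweight_ge0.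
have rad_h k : rad k `^ d <= h k.
  have [U0|/set0P[x Ux]] := eqVneq (U k) set0.
    by rewrite /rad U0 eqxx powR0 ?gt_eqF.
  have [/andP[ra rb] e _] := radP k x Ux.
  have -> : h k = rad k `^ s.
    rewrite /h /hweight ifF; last by apply/negbTE/set0P; exists x.
    by rewrite e poweR_EFin.
  have [->|rn] := eqVneq (rad k) 0; first by rewrite powR0 ?gt_eqF// powR_ge0.
  by apply: ger_powR => //; rewrite lt_neqAle eq_sym rn ra.
(* The enlargements [e k] have d-th powers adding up to at most [eta], and C eta = 1 / 2, so they
   account for at most half of the total mass 1. *)
pose eta : R := (C * 2)^-1; have eta0 : 0 < eta by rewrite invr_gt0 mulr_gt0.
pose e k : R := (eta * 2^-1 ^+ k.+1) `^ d^-1.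
have e0 k : 0 < e k by rewrite powR_gt0// mulr_gt0// exprn_gt0// invr_gt0.
(* Strictly larger than [rad k], even for a set of diameter 0, so that open balls contain the sets
   of the cover and compactness applies. *)
pose rho k : R := Num.max (2 * rad k) (e k).
have rho0 k : 0 < rho k by rewrite lt_max e0 orbT.
have rad0 k : 0 <= rad k.
  have [U0|/set0P[x Ux]] := eqVneq (U k) set0; first by rewrite /rad U0 eqxx.
  by have [/andP[]] := radP k x Ux.
have rho_d k : rho k `^ d <= 2 `^ d * h k + eta * 2^-1 ^+ k.+1.
  have a1 : (2 * rad k) `^ d <= 2 `^ d * h k by rewrite powRM// ler_wpM2l// ltW.
  have a2 : e k `^ d = eta * 2^-1 ^+ k.+1.
    rewrite /e -powRrM mulVf ?gt_eqF// powRr1//.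
    by apply/ltW; rewrite mulr_gt0// exprn_gt0// invr_gt0.
  have a3 : 0 <= (2 * rad k) `^ d by exact: powR_ge0.
  have a4 : 0 <= e k `^ d by exact: powR_ge0.
  by rewrite /rho maxEle; case: ifP => _; [rewrite a2 lerDr mulr_ge0// ltW|rewrite -a2; apply: le_trans a1 _; rewrite lerDl].
have [x hx] : exists x : nat -> R, forall k y, U k y -> `|x k - y| <= rad k.
  have hk k : exists x : R, forall y, U k y -> `|x - y| <= rad k.
    have [U0|/set0P[x Ux]] := eqVneq (U k) set0; first by exists 0; rewrite U0.
    by exists x; have [] := radP k x Ux.
  by have [x] := choice hk; exists x.
have [D _ cD] : finite_subset_cover [set: nat] (fun k => `]x k - rho k, x k + rho k[%classic) F.
  have := compact_tail_fractal (k := 0); rewrite compact_cover; apply.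
    by move=> k _; exact: interval_open.
  move=> y Fy; have [k _ Uy] := FU y Fy; exists k => //=.
  have := hx k y Uy; rewrite ler_norml in_itv/= => /andP[y1 y2].
  have : rad k < rho k \/ rad k = 0.
    have [->|rn] := eqVneq (rad k) 0; [by right|left].
    by rewrite lt_max; apply/orP; left; move: (rad0 k); rewrite le_eqVlt eq_sym (negbTE rn) /= => ?; lra.
  have := rho0 k; move: y1 y2; move: (rad k) (rho k) (x k) => r1' r2' x'.
  by move=> y1 y2 p [?|?]; apply/andP; split; lra.
have [Nk hNk] : exists Nk : nat -> nat, forall k n, (Nk k <= n)%N ->
    mass S d 0 n (x k - rho k) (x k + rho k) <= C * rho k `^ d.
  have [Nk hNk] := choice (fun k => hC (x k) (rho k) (rho0 k)).
  by exists Nk.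
pose n := \max_(j <- D) Nk j.
(* The left end of each cell of level n belongs to the fractal, hence to one of the balls, so each
   cell is counted at least once; the weights of a level add up to 1. *)
have one : 1 <= \sum_(j <- D) mass S d 0 n (x j - rho j) (x j + rho j).
  rewrite -[leLHS](expr1n _ n) -[1]r1 -[ratio_sum S d]/(\sum_i _) -sum_words.
  rewrite /mass (eq_bigr (fun j => \sum_(w <- words S n)
    if `[< cell S 0 w `&` `[x j - rho j, x j + rho j]%classic !=set0 >] then lam w `^ d else 0));
    last by move=> j _; rewrite big_mkcond.
  rewrite exchange_big /=; apply: ler_sum => w _.
  have [u [v [uv _ ew Fu _]]] := cell_itvF 0 w.
  have [j jD uj] := cD u Fu.
  rewrite (bigD1_seq j)//= ?fset_uniq// asboolT.
    by rewrite lerDl sumr_ge0// => i _; case: ifP => // _; exact: powR_ge0.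
  exists u; split; first by rewrite ew /= bound_itvE ltW.
  by move: uj; rewrite /= !in_itv/= => /andP[u1 u2]; rewrite !ltW.
pose m := (\max_(j <- D) j).+1.
have two : \sum_(j <- D) (2 `^ d * h j + eta * 2^-1 ^+ j.+1) <=
    \sum_(j < m) (2 `^ d * h j + eta * 2^-1 ^+ j.+1).
  rewrite -(big_mkord xpredT (fun j => 2 `^ d * h j + eta * 2^-1 ^+ j.+1)).
  apply: sum_le_subset; rewrite ?fset_uniq//.
    move=> j; rewrite addr_ge0// mulr_ge0 ?(ltW p2) ?(ltW eta0)// exprn_ge0// invr_ge0//.
  by move=> j jD; rewrite mem_index_iota /= ltnS; exact: leq_bigmax_seq.
have three : 1 <= C * (2 `^ d * \sum_(j < m) h j + eta).
  apply: le_trans one _.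
  apply: le_trans (_ : \sum_(j <- D) C * (2 `^ d * h j + eta * 2^-1 ^+ j.+1) <= _).
    rewrite big_seq [leRHS]big_seq; apply: ler_sum => j jD.
    apply: le_trans (hNk j n _) _; first exact: leq_bigmax_seq.
    by rewrite ler_pM2l.
  rewrite -mulr_sumr ler_pM2l//; apply: le_trans two _.
  rewrite big_split /= -!mulr_sumr lerD2l -[leRHS]mulr1 ler_pM2l//.
  exact: sum_half_powers.
have four : c0 <= \sum_(j < m) h j.
  have Ceta : C * eta = 2^-1 by rewrite /eta invfM mulrA mulfV ?gt_eqF// mul1r.
  rewrite /c0 mulrC ler_pdivrMr ?mulr_gt0//.
  move: three; rewrite mulrDr Ceta mulrA [_ * (C * _)]mulrC.
  by move: (C * 2 `^ d * _) => z ?; lra.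
apply: le_trans (nneseries_lim_ge m _); last by move=> *; exact: hweight_ge0.
rewrite (eq_bigr (fun k => (h k)%:E)); last by move=> k _; rewrite hE.
by rewrite sumEFin lee_fin big_mkord.
Qed.

(** At the root d' of Moran's equation and below, the measure is positive; beyond d' the ratio sum
    drops below 1 and the measure is 0. Hence the infimum defining the dimension is d'. *)
Lemma ratio_sum_hausdorff_dim d : hausdorff_dim F = d%:E -> ratio_sum S d = 1 /\ 0 < d <= 1.
Proof.
move=> dimF; have [d' d'01 r1] := ratio_sum_root S.
suff -> : d = d' by [].
have /andP[d'0 _] := d'01.
apply/eqP; rewrite eq_le; apply/andP; split; last first.
  rewrite -lee_fin -dimF; apply: le_ereal_inf_tmp => _ [s [s0 Hs] <-].
  rewrite lee_fin leNgt; apply/negP => sd.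
  have : (0 < hausdorff s F)%E by apply: hausdorff_fractal_gt0 d'01 r1 _; rewrite s0 ltW.
  by rewrite Hs ltxx.
rewrite -lee_fin -dimF; apply/lee_addgt0Pr => e e0; rewrite -EFinD.
have d'e : 0 < d' + e by rewrite addr_gt0.
apply: ereal_inf_lbound; exists (d' + e) => //; split; first exact: ltW.
by apply: hausdorff_fractal0 => //; rewrite -r1 ratio_sum_lt// ltrDl.
Qed.

End FractalDimension.

(** * Integration over the fractal against Hausdorff measure *)

Section FractalIntegral.
Context {R : realType}.
Variable S : similar_system R.
Local Notation q := (ss_q S).
Local Notation L := (ss_b S - ss_a S).
Local Notation F := (tail_fractal S 0).
Implicit Types (k n : nat) (g : R -> R) (w : seq 'I_q).

Let L_gt0 : 0 < L. Proof. by rewrite subr_gt0 ss_ab. Qed.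

(** A Lebesgue number argument: finitely many neighbourhoods of half the radius of continuity cover
    the fractal, and a cell shorter than all these half radii stays within the full radius of one
    centre. *)
Lemma cell_oscillation g (e : R) : {within F, continuous g} -> 0 < e -> exists k, forall w x y,
  size w = k -> F x -> F y -> cell S 0 w x -> cell S 0 w y -> `|g x - g y| <= e.
Proof.
move=> /subspace_continuousP cg e0; have e2 : 0 < e / 2 by rewrite divr_gt0.
have loc x : exists de : R, 0 < de /\ (F x -> forall y, F y -> `|x - y| < de + de -> `|g x - g y| < e / 2).
  have [Fx|nFx] := pselect (F x); last by exists 1; split.
  have := cg x Fx; move=> /cvgrPdist_lt /(_ _ e2) /= [de /= de0 h].
  exists (de / 2); split; first by rewrite divr_gt0.
  by move=> _ y Fy; rewrite -splitr => /h; apply.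
have [de hde] := choice loc.
have [D DF cD] : finite_subset_cover F (fun x => `]x - de x, x + de x[%classic) F.
  have := compact_tail_fractal (S := S) (k := 0); rewrite compact_cover; apply.
    by move=> x _; exact: interval_open.
  move=> x Fx; exists x => //=; have [d0 _] := hde x.
  by rewrite in_itv/= ltrDl ltrBlDr ltrDl d0.
have [m [m0 hm]] : exists m, 0 < m /\ forall z, z \in D -> m <= de z.
  have : forall s : seq R, exists m, 0 < m /\ forall z, z \in s -> m <= de z.
    elim=> [|z s [m [m0 hm]]]; first by exists 1; split.
    exists (Num.min (de z) m); split; first by rewrite lt_min m0 (hde z).1.
    move=> y; rewrite inE => /orP[/eqP ->|/hm h]; first by rewrite ge_min lexx.
    by rewrite ge_min h orbT.
  by move=> /(_ D).
have [k hk] := lam_small S (divr_gt0 m0 L_gt0); exists k => w x y wk Fx Fy wx wy.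
have [z zD] := cD x Fx; rewrite /= in_itv/= => zx'; have zx : `|z - x| < de z by rewrite distrC ltr_distl.
 have Fz : F z by have := DF z zD; rewrite inE.
have xy : `|x - y| < m.
  by apply: le_lt_trans (cell_width wx wy) _; rewrite -ltr_pdivlMr// hk// wk.
have [d0 h] := hde z; have h1 : `|g z - g x| < e / 2.
  by apply: (h Fz x Fx); apply: lt_trans zx _; rewrite ltrDl.
have h2 : `|g z - g y| < e / 2.
  apply: (h Fz y Fy); rewrite -(subrKA x); apply: le_lt_trans (ler_normD _ _) _.
  by apply: ltrD => //; apply: lt_le_trans xy _; exact: hm.
rewrite -(subrKA (g z)) [leRHS]splitr; apply: le_trans (ler_normD _ _) _.
by apply: lerD; rewrite ltW// distrC.
Qed.

Variable d : R.
Hypotheses (d01 : 0 < d <= 1) (ratio1 : ratio_sum S d = 1).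
Local Notation mu := (hausdorff_measure d).
Local Notation HF := (fine (hausdorff d F)).

Let d_gt0 : 0 < d. Proof. by case/andP: d01. Qed.

Lemma hausdorff_fractal_fin : hausdorff d F \is a fin_num.
Proof.
rewrite ge0_fin_numE; first exact: hausdorff_fractal_lty.
exact: (outer_measure_ge0 (hausdorff_outer d)).
Qed.

Lemma hausdorff_fractal_fine_gt0 : 0 < HF.
Proof.
rewrite -lte_fin (fineK hausdorff_fractal_fin).
by apply: (hausdorff_fractal_gt0 d01 ratio1); rewrite lexx (ltW d_gt0).
Qed.

Lemma measurable_tail_fractal k :
  measurable (tail_fractal S k : set (caratheodory_type (hausdorff_outer d))).
Proof. by apply: borel_caratheodory; apply: closed_measurable; exact: closed_tail_fractal. Qed.

Lemma measurable_fractal_cell w :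
  measurable (F `&` cell S 0 w : set (caratheodory_type (hausdorff_outer d))).
Proof.
apply: measurableI; first exact: measurable_tail_fractal.
apply: borel_caratheodory; have [u [v [_ _ -> _ _]]] := cell_itv 0 w.
exact: measurable_itv.
Qed.

Lemma continuous_caratheodory g : {within F, continuous g} ->
  measurable_fun (F : set (caratheodory_type (hausdorff_outer d))) g.
Proof.
move=> cg _ B mB; apply: borel_caratheodory.
have mF : measurable (F : set (measurableTypeR R)) by apply: closed_measurable; exact: closed_tail_fractal.
by apply: (subspace_continuous_measurable_fun mF cg).
Qed.

Lemma bigsetU_fractal_cells k : \big[setU/set0]_(w <- words S k) (F `&` cell S 0 w) = F.
Proof.
rewrite -bigcup_seq; apply/seteqP; split=> [x [w _ []]//|x Fx].
by have [w wk wx] := fractal_word k Fx; exists w.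
Qed.

Lemma integral_fractal_cells k g : {within F, continuous g} -> (forall x, F x -> 0 <= g x) ->
  (\int[mu]_(x in F) (g x)%:E = \sum_(w <- words S k) \int[mu]_(x in F `&` cell S 0 w) (g x)%:E)%E.
Proof.
move=> cg g0; rewrite -{1}(bigsetU_fractal_cells k); apply: ge0_integral_bigsetU.
- exact: measurable_fractal_cell.
- exact: words_uniq.
- apply/trivIsetP => w w' wk w'k ww'; apply/seteqP; split=> // x [[_ wx] [_ w'x]].
  move: wk w'k; rewrite /= !mem_words => /eqP wk /eqP w'k.
  by move/eqP: ww'; apply; apply: (cell_eq _ wx w'x); rewrite wk w'k.
- by rewrite bigsetU_fractal_cells; apply/measurable_EFinP; exact: continuous_caratheodory.
- by rewrite bigsetU_fractal_cells => x Fx; rewrite lee_fin g0.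
Qed.

(** Each cell of this level is a copy of the same tail, so its measure is [lam] to the power d times
    that of the tail. Adding over the level, where these powers sum to 1, shows that the tail has
    the measure of the whole fractal. *)
Lemma hausdorff_fractal_cell w :
  hausdorff d (F `&` cell S 0 w) = ((lam w `^ d)%:E * hausdorff d F)%E.
Proof.
have cellE w' : hausdorff d (F `&` cell S 0 w') =
    ((lam w' `^ d)%:E * hausdorff d (tail_fractal S (size w')))%E.
  rewrite -(hausdorff_sim _ (ltW d_gt0) (lam_gt0 w') (wd_sim 0 w')); congr hausdorff.
  by apply/seteqP; split=> x; [move/fractal_cell => [y Fy yx]; exists y|move=> [y Fy yx]; apply/fractal_cell; exists y].
rewrite cellE; congr (_ * _)%E; apply/esym.
have h := integral_fractal_cells (size w) (fun x => cvg_cst (1 : R)) (fun _ _ => ler01).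
have mE (A : set R) : measurable (A : set (caratheodory_type (hausdorff_outer d))) ->
    (\int[mu]_(x in A) (1 : R)%:E = hausdorff d A)%E.
  by move=> mA; rewrite (integral_cst mu mA 1%E) mul1e.
rewrite mE in h; last exact: measurable_tail_fractal.
rewrite h big_seq (eq_bigr (fun w' => (lam w' `^ d)%:E * hausdorff d (tail_fractal S (size w)))%E); last first.
  move=> w'; rewrite mem_words => /eqP w'k; rewrite mE ?cellE ?w'k//.
  exact: measurable_fractal_cell.
rewrite -big_seq -ge0_sume_distrl; last by move=> w' _; rewrite lee_fin powR_ge0.
by rewrite sumEFin sum_words -[\sum_i _]/(ratio_sum S d) ratio1 expr1n mul1e.
Qed.

Lemma integral_fractal_bounds k g (m M : seq 'I_q -> R) : {within F, continuous g} ->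
  (forall x, F x -> 0 <= g x) ->
  (forall w, 0 <= m w) ->
  (forall w x, size w = k -> F x -> cell S 0 w x -> m w <= g x <= M w) ->
  (((\sum_(w <- words S k) m w * lam w `^ d) * HF)%:E <= \int[mu]_(x in F) (g x)%:E /\
   \int[mu]_(x in F) (g x)%:E <= ((\sum_(w <- words S k) M w * lam w `^ d) * HF)%:E)%E.
Proof.
move=> cg g0 m0 gmM; rewrite (integral_fractal_cells k cg g0).
have mg w : measurable_fun (F `&` cell S 0 w : set (caratheodory_type (hausdorff_outer d))) (EFin \o g).
  apply: (measurable_funS _ (@subIsetl _ _ _)); first exact: measurable_tail_fractal.
  by apply/measurable_EFinP; exact: continuous_caratheodory.
have cE w (r : R) : (\int[mu]_(x in F `&` cell S 0 w) r%:E = (r * lam w `^ d * HF)%:E)%E.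
  rewrite (integral_cst mu (measurable_fractal_cell w) r%:E).
  rewrite -[mu _]/(hausdorff d _) hausdorff_fractal_cell -{1}(fineK hausdorff_fractal_fin).
  by rewrite -!EFinM mulrA.
rewrite !mulr_suml -!sumEFin; split; rewrite big_seq [leRHS]big_seq; apply: lee_sum => w;
  rewrite mem_words => /eqP wk; rewrite -cE; apply: ge0_le_integral => //.
all: try exact: measurable_fractal_cell.
all: by move=> x [Fx wx]; rewrite lee_fin ?g0//; have /andP[] := gmM w x wk Fx wx.
Qed.

End FractalIntegral.

(** * Powers of the Dirac operator *)

Section BasisDetermines.
Context {R : realType} {X : choiceType}.
Local Notation C := R[i].
Local Notation H := (ell2 R X).
Implicit Types (xi : H) (s : seq X) (T B : H -> H).

Definition indic_seq s (x : X) : R := (x \in s)%:R.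

Lemma indic_seq_nnb s : nnb (indic_seq s).
Proof. by split=> [x|]; [exact: ler0n|exists 1 => x; rewrite /indic_seq lern1 leq_b1]. Qed.

Lemma diag_indic_seq s xi : uniq s -> diag (indic_seq s) xi = \sum_(x <- s) xi x *: ebas x.
Proof.
move=> us; apply: ell2_eq => y; rewrite (diagE _ _ (indic_seq_nnb s)) -[RHS]inner_ebas inner_sumr.
rewrite (eq_bigr (fun x => xi x * (y == x)%:R)); last first.
  by move=> x _; rewrite innerZr inner_ebas ebasE.
rewrite /indic_seq; have [ys|ys] := boolP (y \in s).
  rewrite (bigD1_seq y)//= eqxx mulr1 mul1r big1 ?addr0// => x xy.
  by rewrite eq_sym (negbTE xy) mulr0.
rewrite mul0r big_seq big1// => x xs; case: eqP => [yx|_]; last by rewrite mulr0.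
by rewrite yx xs in ys.
Qed.

Lemma finite_approx xi (e : R) : 0 < e ->
  exists s, uniq s /\ nsq (xi - diag (indic_seq s) xi) < e.
Proof.
move=> e0; have : ((nsq xi - e)%:E < \esum_(x in [set: X]) (abs2 (xi x))%:E)%E.
  by rewrite -[esum _ _]/(sqnorm xi) -nsqE lte_fin ltrBlDr ltrDl.
move=> /ereal_sup_gt[_ [A [fA _] <-]]; rewrite fsbig_finite//= sumEFin lte_fin => hA.
exists (fset_set A); split; first exact: fset_uniq.
set p := diag _ xi.
have pE : nsq p = \sum_(x <- fset_set A) abs2 (xi x).
  rewrite /p (@nsq_finite_diag _ _ (fset_set A) _ _ (indic_seq_nnb _)) ?fset_uniq//; last first.
    by move=> x xA; rewrite /indic_seq (negbTE xA).
  by rewrite big_seq [RHS]big_seq; apply: eq_bigr => x xA; rewrite /indic_seq xA expr1n mul1r.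
have -> : nsq (xi - p) = nsq xi - nsq p; last by rewrite pE ltrBlDl -ltrBlDr.
apply/eqP; rewrite eq_sym subr_eq; apply/eqP.
rewrite /nsq -psumD; try exact: abs_summable_abs2; try by move=> x; exact: abs2_ge0.
congr psum; apply/funext => x.
rewrite ell2D ell2N /p (diagE _ _ (indic_seq_nnb _)) /indic_seq; case: (x \in _).
  by rewrite mul1r subrr abs2_0 add0r.
by rewrite mul0r subr0 abs2_0 addr0.
Qed.

(** Finite combinations of basis vectors approximate every vector, and both operators are
    bounded. *)
Lemma eq_bounded_op T B : bounded_op T -> bounded_op B ->
  (forall x, T (ebas x) = B (ebas x)) -> T = B.
Proof.
move=> bT bB eTB; apply/funext => xi; apply/eqP; rewrite -subr_eq0; apply/eqP/nsq_eq0.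
have [MT MT0 hT] := bounded_op_nsq bT; have [MB MB0 hB] := bounded_op_nsq bB.
apply/eqP; rewrite eq_le nsq_ge0 andbT; apply/ler_addgt0Pr => e e0; rewrite add0r.
have d0 : 0 < e / (2 * MT + 2 * MB + 1).
  by rewrite divr_gt0// ltr_wpDl// addr_ge0// mulr_ge0.
have [s [us hs]] := finite_approx xi d0; set p := diag _ xi in hs.
have -> : T xi - B xi = T (xi - p) - B (xi - p).
  rewrite (linear_opB bT.1) (linear_opB bB.1).
  have -> : T p = B p.
    rewrite /p diag_indic_seq// (linear_op_sum bT.1) (linear_op_sum bB.1).
    by apply: eq_bigr => x _; rewrite (linear_opZ bT.1) (linear_opZ bB.1) eTB.
  by rewrite opprB addrA subrK.
apply: le_trans (nsqD_le _ _) _; rewrite nsqN.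
have h1 := hT (xi - p); have h2 := hB (xi - p); have h0 := nsq_ge0 (xi - p).
rewrite ltr_pdivlMr in hs; last by rewrite ltr_wpDl// addr_ge0// mulr_ge0.
move: h1 h2 h0 hs; move: (nsq _) (nsq _) (nsq _) => x y z; clear -MT MB; by move=> *; nra.
Qed.

End BasisDetermines.

Lemma eq_sum_diff (R : realType) (V : lmodType R[i]) (u v u' v' : V) :
  u + v = u' + v' -> u - v = u' - v' -> u = u' /\ v = v'.
Proof.
move=> e1 e2; suff uu : u = u' by split=> //; move: e1; rewrite uu => /addrI.
have two0 : (2 : R[i]) != 0 by rewrite pnatr_eq0.
apply: (scalerI two0); rewrite !scaler_nat !mulr2n.
have dbl (x y : V) : x + x = (x + y) + (x - y) by rewrite addrACA subrr addr0.
by rewrite (dbl u v) (dbl u' v') e1 e2.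
Qed.

Section DiracPowers.
Context {R : realType}.
Variables (K : limit_fractal R) (S : similar_system R).
Hypotheses (Sa : ss_a S = lf_a K) (Sb : ss_b S = lf_b K).
Hypothesis KF : fractal K = tail_fractal S 0.
Hypothesis KC : forall c, cells K c <-> exists2 s, size s = c.1 & c.2 = cell S 0 s.
Local Notation X := (hilbert_index K).
Local Notation C := R[i].
Implicit Types (e : piece K) (xi eta : hilbert K) (s : R).

Let len_gt0 := @len_gt0 R K S Sa Sb KF KC.

(** c = 1 and c = -1 give the two eigenvectors of the block of the piece, with eigenvalues of
    opposite sign. *)
Lemma dirac_ebas (c : C) e : c * c = 1 -> forall x : X,
  dirac_op (ebas (e, true) + c *: ebas (e, false)) x =
  (c * (len e)^-1%:C) * (ebas (e, true) + c *: ebas (e, false)) x.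
Proof.
move=> c1 [e' bt].
have vE (y : X) : (ebas (e, true) + c *: ebas (e, false)) y = (y == (e, true))%:R + c * (y == (e, false))%:R.
  by rewrite ell2D ell2Z !ebasE.
rewrite /dirac_op !vE /= !xpair_eqE.
have [->|ne] := eqVneq e' e; last by rewrite /= mulr0 addr0 !mulr0.
case: bt => /=; rewrite ?mulr0 ?addr0 ?add0r ?mulr1; first by rewrite mulrC.
by rewrite mulrAC c1 mul1r.
Qed.

(** The square of the Dirac operator multiplies by the inverse square of the length, so an
    eigenvector lives on pieces of length 1 / |lam|. *)
Lemma dirac_eigen (lam : R) xi : dirac_op xi = lam%:C *: (xi : X -> C^o) ->
  forall x, xi x = 0 \/ `|lam| = (len x.1)^-1.
Proof.
move=> Dxi x; have l0 := len_gt0 x.1.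
have h (y : X) : (len y.1)^-1%:C * xi (y.1, ~~ y.2) = lam%:C * xi y.
  by have := congr1 (fun f : X -> C^o => f y) Dxi.
have [->|n0] := eqVneq (xi x) 0; [by left|right].
have h1 := h x; have := h (x.1, ~~ x.2); rewrite /= negbK -surjective_pairing => h2.
have : (len x.1)^-1%:C * ((len x.1)^-1%:C * xi x) = lam%:C * (lam%:C * xi x).
  by rewrite h2 mulrCA h1.
rewrite !mulrA => /(mulIf n0); rewrite -!rmorphM /= => /complexI e.
have : `|lam| ^+ 2 = (len x.1)^-1 ^+ 2 by rewrite real_normK ?num_real// !expr2 e.
by move/eqP; rewrite eqrXn2 ?invr_ge0 ?(ltW l0)// => /eqP.
Qed.

Lemma lenpow_function_of s : 0 < s ->
  is_function_of (@dirac_op R K) (fun lam => `|lam| `^ (- s)) (diag (lenpow s)).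
Proof.
move=> s0; have nl := lenpow_nnb Sa Sb KF KC (ltW s0); split; first exact: diag_bounded.
- move=> eta h0; apply: ell2_eq => -[e bt].
  have h (c : C) : c * c = 1 -> forall lam : R, c * (len e)^-1%:C = lam%:C ->
      conjc c * eta (e, false) = - eta (e, true).
    move=> c1 lam lamE; have := h0 lam (ebas (e, true) + c *: ebas (e, false)).
    rewrite innerDl innerZl !inner_ebas => h1; apply/eqP; rewrite -addr_eq0 addrC; apply/eqP/h1.
    by apply/funext => x; rewrite dirac_ebas// lamE.
  have c1 : conjc (1 : C) = 1 by rewrite /conjc /= oppr0.
  have e1 := h 1 (mulr1 _) (len e)^-1 (mul1r _); rewrite c1 mul1r in e1.
  have mm : (-1) * (-1) = 1 :> C by rewrite mulrNN mulr1.
  have ll : (-1) * (len e)^-1%:C = (- (len e)^-1)%:C :> C by rewrite mulN1r rmorphN.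
  have e2 := h (-1) mm (- (len e)^-1) ll; rewrite conjcN c1 mulN1r in e2.
  have z : eta (e, false) = 0.
    by have := e1; rewrite -e2 => /eqP; rewrite -addr_eq0 -mulr2n mulrn_eq0 => /eqP.
  have z' : eta (e, true) = 0 by apply: oppr_inj; rewrite -e2 z !oppr0.
  by case: bt; rewrite ?z ?z' ell20.
- move=> lam xi Dxi; apply: ell2_eq => x; rewrite diagE// ell2Z.
  have [->|->] := dirac_eigen Dxi x; first by rewrite !mulr0.
  congr (_%:C * _); rewrite /lenpow powRN powR_V// invrK//.
Qed.

(** [abs_npow] is a choice, so uniqueness has to be shown: any candidate is prescribed on the sum
    and the difference of the two basis vectors of a piece, hence on both of them. *)
Lemma abs_npow_dirac s : 0 < s -> abs_npow (@dirac_op R K) s = diag (lenpow s).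
Proof.
move=> s0; apply: xget_unique; first exact: lenpow_function_of.
move=> B [bB _ hB]; apply: eq_bounded_op => //.
  by apply: diag_bounded; exact: (lenpow_nnb Sa Sb KF KC (ltW s0)).
have [bD _ hD] := lenpow_function_of s0.
have agree (c : C) e : c * c = 1 -> forall lam : R, c * (len e)^-1%:C = lam%:C ->
    B (ebas (e, true) + c *: ebas (e, false)) = diag (lenpow s) (ebas (e, true) + c *: ebas (e, false)).
  move=> c1 lam lamE; have De : dirac_op (ebas (e, true) + c *: ebas (e, false)) =
      lam%:C *: ((ebas (e, true) + c *: ebas (e, false) : hilbert K) : X -> C^o).
    by apply/funext => x; rewrite dirac_ebas// lamE.
  by rewrite (hB _ _ De) (hD _ _ De).
move=> [e bt].
have e1 := agree 1 e (mulr1 _) (len e)^-1 (mul1r _).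
have mm : (-1) * (-1) = 1 :> C by rewrite mulrNN mulr1.
have ll : (-1) * (len e)^-1%:C = (- (len e)^-1)%:C :> C by rewrite mulN1r rmorphN.
have e2 := agree (-1) e mm (- (len e)^-1) ll; rewrite scaleN1r in e2.
rewrite scale1r !(linear_opD bB.1) !(linear_opD bD.1) in e1.
rewrite !(linear_opB bB.1) !(linear_opB bD.1) in e2.
have [tr fl] := eq_sum_diff e1 e2.
by case: bt.
Qed.

End DiracPowers.

(** * The Dixmier trace functional *)

Lemma lip_continuous_within {R : realType} (F : set R) (f : R -> R[i]) (h : R[i] -> R) :
  (forall z w, `|h z - h w|%:C <= `|z - w|) ->
  {within F, continuous (f : R -> R[i]^o)} -> {within F, continuous (h \o f)}.
Proof.
move=> hl /subspace_continuousP cf; apply/subspace_continuousP => x Fx.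
apply/cvgrPdist_lt => e e0; have e0' : 0 < e%:C by rewrite ltcR.
have := cf x Fx; move=> /cvgrPdist_lt /(_ _ e0'); apply: filterS => y /= fy.
by rewrite -ltcR; apply: le_lt_trans (hl _ _) fy.
Qed.

Lemma max0_lip {R : realDomainType} (x y : R) : `|Num.max x 0 - Num.max y 0| <= `|x - y|.
Proof.
by case: (leP x 0) => x0; case: (leP y 0) => y0; rewrite ler_norml; apply/andP;
  split; case: (leP 0 (x - y)) => xy; rewrite ?(ger0_norm xy) ?(ltr0_norm xy); lra.
Qed.

Lemma normc_ge_Im {R : rcfType} (z : R[i]) : `|complex.Im z|%:C <= `|z|.
Proof. by case: z => a b; rewrite normc_def /= lecR -sqrtr_sqr ler_wsqrtr// lerDr sqr_ge0. Qed.

(** The first bit selects the imaginary part, the second the negative part. *)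
Definition part_of {R : realType} (j : bool * bool) (z : R[i]) : R :=
  let y := if j.1 then complex.Im z else complex.Re z in Num.max (if j.2 then - y else y) 0.

Lemma part_of_ge0 {R : realType} j (z : R[i]) : 0 <= part_of j z.
Proof. by rewrite /part_of le_max lexx orbT. Qed.

Lemma part_of_lip {R : realType} j (z w : R[i]) : `|part_of j z - part_of j w|%:C <= `|z - w|.
Proof.
apply: (@le_trans _ _ (`|(if j.1 then complex.Im (z - w) else complex.Re (z - w))|%:C)); last first.
  by case: j.1; [exact: normc_ge_Im|exact: normc_ge_Re].
rewrite lecR; apply: le_trans (max0_lip _ _) _.
case: z w j => a b [c e] [[] []] /=; rewrite ?lexx//.
  by rewrite opprK addrC distrC.
by rewrite opprK addrC distrC.
Qed.

Lemma part_of_diff {R : realType} (j : bool) (z : R[i]) :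
  part_of (j, false) z - part_of (j, true) z = if j then complex.Im z else complex.Re z.
Proof.
rewrite /part_of /=; move: (if j then _ else _) => y.
by rewrite !maxEle oppr_le0; case: (leP y 0); case: (leP 0 y) => *; lra.
Qed.

Lemma part_of_mul {R : realType} (j : bool) (z : R[i]) :
  part_of (j, false) z * part_of (j, true) z = 0.
Proof.
rewrite /part_of /=; move: (if j then _ else _) => y.
by case: (leP y 0) => y0; rewrite ?mul0r// (max_idPr _) ?mulr0// oppr_le0 ltW.
Qed.

(** [H * T] and [D * I] lie in a common interval of length (B - A) D H, which can be made
    arbitrarily short. *)
Lemma proportional_squeeze {R : realFieldType} (T I D H : R) : 0 < D -> 0 < H ->
  (forall e, 0 < e -> exists A B, [/\ B - A <= 2 * e, A * D <= T <= B * D & A * H <= I <= B * H]) ->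
  T = D / H * I.
Proof.
move=> D0 H0 bounds; apply: (mulfI (lt0r_neq0 H0)).
rewrite [RHS]mulrA [H * (D / H)]mulrC divfK ?gt_eqF//.
apply/eqP; rewrite -subr_eq0 -normr_le0; apply/ler_addgt0Pr => e e0; rewrite add0r.
have [|A [B [AB /andP[t1 t2] /andP[i1 i2]]]] := bounds (e / (2 * D * H)).
  by rewrite divr_gt0// !mulr_gt0.
have e2 : e = 2 * (e / (2 * D * H)) * (D * H) by field; rewrite !gt_eqF.
have b1 : (B - A) * (D * H) <= e by rewrite e2 ler_wpM2r// mulr_ge0 ?ltW.
have := ler_wpM2r (ltW D0) i1; have := ler_wpM2r (ltW D0) i2.
have := ler_wpM2r (ltW H0) t1; have := ler_wpM2r (ltW H0) t2.
rewrite ler_norml; move: b1; rewrite mulrBl !mulrA [B * H * D]mulrAC [A * H * D]mulrAC.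
rewrite [D * I]mulrC [H * T]mulrC; move: (B * D * H) (A * D * H) (T * H) (I * D) => b a t i.
by move=> *; apply/andP; split; lra.
Qed.

Section DixmierTrace.
Context {R : realType}.
Variables (K : limit_fractal R) (S : similar_system R).
Hypotheses (Sa : ss_a S = lf_a K) (Sb : ss_b S = lf_b K).
Hypothesis KF : fractal K = tail_fractal S 0.
Hypothesis KC : forall c, cells K c <-> exists2 s, size s = c.1 & c.2 = cell S 0 s.
Local Notation q := (ss_q S).
Local Notation X := (hilbert_index K).
Local Notation F := (tail_fractal S 0).
Local Notation lenpow := (@lenpow R K).
Variable d : R.
Hypotheses (d01 : 0 < d <= 1) (ratio1 : ratio_sum S d = 1).
Local Notation mu := (hausdorff_measure d).
Local Notation HF := (fine (hausdorff d F)).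

Let d0 : 0 < d. Proof. by case/andP: d01. Qed.
Let nl := lenpow_nnb Sa Sb KF KC (ltW d0).

Lemma continuous_bounded (g : R -> R) : {within F, continuous g} ->
  exists M : R, 0 < M /\ forall x, F x -> `|g x| <= M.
Proof.
move=> cg; have [M [_ hM]] := compact_bounded (continuous_compact cg (compact_tail_fractal (S := S) (k := 0))).
exists (`|M| + 1); split; first by rewrite ltr_wpDl.
move=> x Fx; apply: (hM (`|M| + 1)); last by exists x.
by rewrite (le_lt_trans (ler_norm M))// ltrDl.
Qed.

Variables (Lim : (nat -> R) -> R) (L : dilation_invariant_limit Lim).
Let st := dixmier_weight_singular_trace L (X := X).
Local Notation dixtrace := (dtrace (dixmier_weight Lim (X := X))).
Local Notation D := (Lim (dix (diag (lenpow d)))).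

Lemma dtrace_lenpowE : dixtrace (lenpow d) = D%:E.
Proof. by rewrite /dtrace /dixmier_weight asboolT//; exact: (dix_lenpow_bounded Sa Sb KF KC d0 ratio1). Qed.

Lemma Lim_dix_lenpow_gt0 : 0 < D.
Proof.
have [c [c0 [N hN]]] := dix_lenpow_lower Sa Sb KF KC d0 ratio1.
(* The lower bound holds from N on only; the sequence that is 0 before N lies below everywhere and
   converges to c. *)
pose u n := if (n < N)%N then 0 else c.
have uc : u n @[n --> \oo] --> c.
  apply: cvg_near_cst; exists N => // n /= Nn; by rewrite /u ltnNge Nn.
apply: lt_le_trans c0 _; rewrite -(Lim_cvg L uc); apply: (le_Lim L).
- exact: cvg_bounded_seq uc.
- exact: (dix_lenpow_bounded Sa Sb KF KC d0 ratio1).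
move=> n; rewrite /u; case: ltnP => [_|/hN//].
by apply: dix_ge0; exact: diag_positive.
Qed.

Variable g : R -> R.
Hypotheses (cg : {within F, continuous g}) (g0 : forall x, F x -> 0 <= g x).
Local Notation t := (fun x : X => g (vertex x) * lenpow d x).

Let vF (x : X) : F (vertex x). Proof. exact: (vertex_fractal Sa Sb KF KC). Qed.

Lemma weight_le : exists M : R, 0 < M /\ forall x : X, t x <= M * lenpow d x.
Proof.
have [M [M0 hM]] := continuous_bounded cg; exists M; split=> // x.
by rewrite ler_wpM2r ?powR_ge0// (le_trans (ler_norm _))// hM.
Qed.

Lemma weight_nnb : nnb t.
Proof.
have [M [M0 hM]] := weight_le; apply: (nnb_le _ hM); last exact: nnbZ (ltW M0) nl.
by move=> x; rewrite mulr_ge0 ?powR_ge0 ?g0.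
Qed.

Lemma weight_finite_levels : finite_levels t.
Proof.
have [M [M0 hM]] := weight_le => e e0.
have := lenpow_finite_levels Sa Sb KF KC d0 (divr_gt0 e0 M0).
apply: sub_finite_set => x /= ex; rewrite ler_pdivrMr// mulrC.
exact: le_trans (hM x).
Qed.

(** [dixmier_weight] is +oo on operators with unbounded sequences, so boundedness follows from a
    finite trace, obtained by domination. *)
Lemma weight_dix_bounded : bounded_seq (dix (diag t)).
Proof.
have [M [M0 hM]] := weight_le; have nt := weight_nnb.
have : (dixtrace t < +oo)%E.
  apply: le_lt_trans (le_dtrace st nt (nnbZ (ltW M0) nl) hM) _.
  by rewrite (dtraceZ st (ltW M0) nl) dtrace_lenpowE -EFinM ltry.
by rewrite /dtrace /dixmier_weight; case: asboolP.
Qed.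

Lemma Lim_dix_weight : (\int[mu]_(x in F) (g x)%:E \is a fin_num)%E /\
  Lim (dix (diag t)) = D / HF * fine (\int[mu]_(x in F) (g x)%:E).
Proof.
have HF0 := hausdorff_fractal_fine_gt0 d01 ratio1; have D0 := Lim_dix_lenpow_gt0.
have tE : dixtrace t = (Lim (dix (diag t)))%:E.
  by rewrite /dtrace /dixmier_weight asboolT//; exact: weight_dix_bounded.
have Fw w : F (wd S 0 w (ss_a S)) by apply: wd_ends_fractal; left.
have cw w : cell S 0 w (wd S 0 w (ss_a S)).
  by exists (ss_a S) => //; rewrite /= bound_itvE ltW// ss_ab.
have bounds (e : R) : 0 < e -> exists A B : R, [/\ B - A <= 2 * e,
    A * D <= Lim (dix (diag t)) <= B * D &
    ((A * HF)%:E <= \int[mu]_(x in F) (g x)%:E /\ \int[mu]_(x in F) (g x)%:E <= (B * HF)%:E)%E].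
  move=> e0; have [k hk] := cell_oscillation cg e0.
  (* The function is sampled at an end of each cell, which is a point of the fractal. The lower
     values are cut off at 0 because the trace is compared on nonnegative weights. *)
  pose v w := g (wd S 0 w (ss_a S)); pose m w := Num.max 0 (v w - e); pose M w := v w + e.
  have v0 w : 0 <= v w by apply: g0.
  have m0 w : 0 <= m w by rewrite le_max lexx.
  have M0 w : 0 <= M w by rewrite addr_ge0// ltW.
  have gmM w x : size w = k -> F x -> cell S 0 w x -> m w <= g x <= M w.
    move=> wk Fx wx; have := hk w _ _ wk Fx (Fw w) wx (cw w); rewrite -/(v w) ler_norml => /andP[h1 h2].
    rewrite ge_max g0//=; apply/andP; split; first by rewrite addrC -lerBrDr.
    by move: h2; rewrite /M lerBlDl.
  exists (\sum_(w <- words S k) m w * lam w `^ d), (\sum_(w <- words S k) M w * lam w `^ d).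
  split.
  - rewrite -sumrB; apply: le_trans (_ : \sum_(w <- words S k) 2 * e * lam w `^ d <= _).
      apply: ler_sum => w _; rewrite -mulrBl ler_wpM2r ?powR_ge0// lerBlDl -lerBlDr.
      by rewrite le_max; apply/orP; right; rewrite /M; lra.
    by rewrite -mulr_sumr sum_words -[\sum_i _]/(ratio_sum S d) ratio1 expr1n mulr1.
  - have nv : nnb (fun x : X => g (vertex x)).
      have [C [C0 hC]] := continuous_bounded cg; split=> [x|]; first exact: g0.
      by exists C => x; rewrite (le_trans (ler_norm _))// hC.
    have [] := dtrace_weighted Sa Sb KF KC st d0 ratio1 dtrace_lenpowE (k := k) nv m0 M0.
      move=> w x wk uw; apply: gmM => //; exact: (under_vertex Sa Sb KF KC uw).
    by rewrite tE !lee_fin => -> ->.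
  - exact: (integral_fractal_bounds d01 ratio1 cg g0 m0 gmM).
have fin : (\int[mu]_(x in F) (g x)%:E \is a fin_num)%E.
  have [A [B [_ _ [h1 h2]]]] := bounds 1 ltr01.
  rewrite ge0_fin_numE; first exact: le_lt_trans h2 (ltry _).
  by apply: integral_ge0 => x Fx; rewrite lee_fin g0.
split=> //; apply: (proportional_squeeze D0 HF0) => e e0.
have [A [B [AB tAB [h1 h2]]]] := bounds e e0; exists A, B; split=> //.
by rewrite -!lee_fin (fineK fin) h1 h2.
Qed.

End DixmierTrace.

Lemma ell2_lincomb {R : realType} {X : choiceType} (c : R[i]) (A1 A2 A3 A4 : ell2 R X) x :
  ((A1 - A2) + c *: (A3 - A4)) x = (A1 x - A2 x) + c * (A3 x - A4 x).
Proof. by []. Qed.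

Section DixmierFunctional.
Context {R : realType}.
Variables (K : limit_fractal R) (S : similar_system R).
Hypotheses (Sa : ss_a S = lf_a K) (Sb : ss_b S = lf_b K).
Hypothesis KF : fractal K = tail_fractal S 0.
Hypothesis KC : forall c, cells K c <-> exists2 s, size s = c.1 & c.2 = cell S 0 s.
Local Notation X := (hilbert_index K).
Local Notation F := (tail_fractal S 0).
Local Notation lenpow := (@lenpow R K).
Variable d : R.
Hypotheses (d01 : 0 < d <= 1) (ratio1 : ratio_sum S d = 1).
Variables (Lim : (nat -> R) -> R) (L : dilation_invariant_limit Lim).
Local Notation mu := (hausdorff_measure d).
Local Notation HF := (fine (hausdorff d F)).
Local Notation D := (Lim (dix (diag (lenpow d)))).

Let d0 : 0 < d. Proof. by case/andP: d01. Qed.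
Let nl := lenpow_nnb Sa Sb KF KC (ltW d0).

Variable f : R -> R[i].
Hypothesis cf : {within F, continuous (f : R -> R[i]^o)}.

Definition part_weight j (x : X) : R := part_of j (f (vertex x)) * lenpow d x.

Let cpart j : {within F, continuous (part_of j \o f)} := lip_continuous_within (part_of_lip j) cf.
Let part0 j x : F x -> 0 <= (part_of j \o f) x. Proof. by move=> _; exact: part_of_ge0. Qed.

Let part_nnb j : nnb (part_weight j).
Proof. exact: (weight_nnb Sa Sb KF KC d01 (@cpart j) (@part0 j)). Qed.

Let part_levels j : finite_levels (part_weight j).
Proof. exact: (weight_finite_levels Sa Sb KF KC d01 (@cpart j)). Qed.

Lemma L1inf_part j : L1inf (diag (part_weight j)).
Proof.
apply/(L1inf_diag (infinite_index KC) (part_nnb j) (part_levels j)).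
exact: (weight_dix_bounded Sa Sb KF KC d01 ratio1 L (@cpart j) (@part0 j)).
Qed.

Lemma dixmier_pos_part j : dixmier_pos Lim (diag (part_weight j)) =
  D / HF * fine (\int[mu]_(x in F) (part_of j (f x))%:E).
Proof.
rewrite (dixmier_pos_diag (infinite_index KC) (part_nnb j) (part_levels j)).
exact: (Lim_dix_weight Sa Sb KF KC d01 ratio1 L (@cpart j) (@part0 j)).2.
Qed.

Lemma Rintegral_parts (j : bool) :
  \int[mu]_(x in F) (if j then complex.Im (f x) else complex.Re (f x)) =
  fine (\int[mu]_(x in F) (part_of (j, false) (f x))%:E) -
  fine (\int[mu]_(x in F) (part_of (j, true) (f x))%:E).
Proof.
have fin i := (Lim_dix_weight Sa Sb KF KC d01 ratio1 L (@cpart i) (@part0 i)).1.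
rewrite /Rintegral integralE -fineB; [|exact: (fin (j, false))|exact: (fin (j, true))].
congr (fine (_ - _)%E); apply: eq_integral => x _.
  by rewrite funeposE /part_of /= EFin_max.
by rewrite funenegE /part_of /= EFin_max.
Qed.

Lemma parts_split xi : (rep_op (K := K) f \o diag (lenpow d)) xi =
  (diag (part_weight (false, false)) xi - diag (part_weight (false, true)) xi) +
  'i *: (diag (part_weight (true, false)) xi - diag (part_weight (true, true)) xi).
Proof.
have vF (x : X) : F (vertex x) := vertex_fractal Sa Sb KF KC x.
have bound j := continuous_bounded (@cpart j).
(* Boundedness of [f] at the vertices ensures that [rep_op] is genuine multiplication and not the
   default value of [insubd]. *)
have [M [M0 hM]] : exists M : R, 0 <= M /\ forall x : X, abs2 (f (vertex x)) <= M.
  have [M1 [_ h1]] := bound (false, false); have [M2 [_ h2]] := bound (false, true).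
  have [M3 [_ h3]] := bound (true, false); have [M4 [_ h4]] := bound (true, true).
  exists ((`|M1| + `|M2|) ^+ 2 + (`|M3| + `|M4|) ^+ 2); split=> [|x].
    by rewrite addr_ge0 ?sqr_ge0.
  have re := part_of_diff false (f (vertex x)); have im := part_of_diff true (f (vertex x)).
  have le j N : (forall y, F y -> `|(part_of j \o f) y| <= N) -> `|part_of j (f (vertex x))| <= `|N|.
    by move=> h; apply: le_trans (h _ (vF x)) (ler_norm _).
  rewrite /abs2 -re -im /= -(real_normK (num_real (_ - _))) -[X in _ + X](real_normK (num_real (_ - _))).
  by apply: lerD; rewrite lerXn2r ?nnegrE ?addr_ge0//;
    apply: le_trans (ler_normB _ _) _; apply: lerD; apply: le.
apply: ell2_eq => x; rewrite ell2_lincomb.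
have wE j : diag (part_weight j) xi x = (part_weight j x)%:C * xi x by exact: diagE.
have lE : (rep_op (K := K) f \o diag (lenpow d)) xi x = f (vertex x) * ((lenpow d x)%:C * xi x).
  by rewrite [LHS](mul_opE _ _ hM) (diagE _ _ nl).
pose w j : R[i] := (part_weight j x)%:C.
apply: (eq_trans lE); apply: esym.
apply: (@eq_trans _ _ (w (false, false) * xi x - w (false, true) * xi x +
    'i * (w (true, false) * xi x - w (true, true) * xi x))).
  by congr (_ - _ + _ * (_ - _)); exact: wE.
rewrite /w /part_weight {wE lE w}; move: (xi x) => z; apply: esym.
rewrite {1}(_ : f (vertex x) =
    (part_of (false, false) (f (vertex x)) - part_of (false, true) (f (vertex x)))%:C +
    'i * (part_of (true, false) (f (vertex x)) - part_of (true, true) (f (vertex x)))%:C).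
  by rewrite !rmorphM !rmorphB /=; ring.
by rewrite !part_of_diff -complexE.
Qed.

Lemma dixmier_trace_rep :
  is_dixmier_trace Lim (rep_op (K := K) f \o diag (lenpow d)) ((D / HF)%:C * hausdorff_integral d F f).
Proof.
pose A j := diag (part_weight j).
exists (A (false, false)), (A (false, true)), (A (true, false)), (A (true, true)).
have orth (j : bool) : A (j, false) \o A (j, true) = \0.
  apply/funext => xi; apply: ell2_eq => x; rewrite /A /= !(diagE _ _ (part_nnb _)) mulrA -rmorphM /=.
  by rewrite /part_weight mulrACA part_of_mul mul0r rmorph0 mul0r.
split.
- by split; apply: diag_positive; exact: part_nnb.
- by split; exact: L1inf_part.
- by split; exact: orth.
- by apply/funext => xi; exact: parts_split.
rewrite /A !dixmier_pos_part -!mulrBr /hausdorff_integral.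
rewrite (Rintegral_parts false) (Rintegral_parts true).
by apply/eqP; rewrite eq_complex /= !mul0r subr0 addr0 !eqxx.
Qed.

End DixmierFunctional.

Lemma bound_by_exponents {R : realType} (E : set R) (d : R) : (forall s, E s -> d <= s) ->
  (forall s, d < s -> E s) -> ereal_inf [set s%:E | s in E] = d%:E.
Proof.
move=> lo hi; apply/eqP; rewrite eq_le; apply/andP; split.
  apply/lee_addgt0Pr => e e0; rewrite -EFinD; apply: ereal_inf_lbound.
  by exists (d + e) => //; apply: hi; rewrite ltrDl.
by apply: le_ereal_inf_tmp => _ [s Es <-]; rewrite lee_fin lo.
Qed.

Lemma bound_above_exponents {R : realType} (E : set R) (d : R) : 0 < d ->
  (forall s, E s -> s <= d) ->
  (forall s, 0 < s -> s < d -> E s) -> ereal_sup [set s%:E | s in E] = d%:E.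
Proof.
move=> d0 hi lo; apply/eqP; rewrite eq_le; apply/andP; split.
  by apply: ge_ereal_sup => _ [s Es <-]; rewrite lee_fin hi.
apply/lee_subgt0Pr => e e0; rewrite -EFinB.
(* [lo] provides positive exponents only; when [d - e] is at most d / 2, the witness d / 2 takes its
   place. *)
have [de|de] := ltP (d / 2) (d - e).
  by apply: ereal_sup_ubound; exists (d - e) => //; apply: lo; lra.
apply: (@le_trans _ _ (d / 2)%:E); first by rewrite lee_fin.
by apply: ereal_sup_ubound; exists (d / 2) => //; apply: lo; lra.
Qed.

(** * Exponents of singular traceability and noncommutative dimension *)

Section Exponents.
Context {R : realType}.
Variables (K : limit_fractal R) (S : similar_system R).
Hypotheses (Sa : ss_a S = lf_a K) (Sb : ss_b S = lf_b K).
Hypothesis KF : fractal K = tail_fractal S 0.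
Hypothesis KC : forall c, cells K c <-> exists2 s, size s = c.1 & c.2 = cell S 0 s.
Local Notation X := (hilbert_index K).
Local Notation lenpow := (@lenpow R K).
Variable d : R.
Hypotheses (d01 : 0 < d <= 1) (ratio1 : ratio_sum S d = 1).

Let d0 : 0 < d. Proof. by case/andP: d01. Qed.
Let npow := abs_npow_dirac Sa Sb KF KC.

Lemma traceability_exponent_dirac s : traceability_exponent (dirac_op (K := K)) s <-> s = d.
Proof.
split=> [[s0 [tau [st]]]|->].
  rewrite npow// => /andP[t0 tf]; apply/eqP; apply: contraT => sd.
  have r1 : ratio_sum S s != 1.
    rewrite -ratio1; move: sd; rewrite neq_lt => /orP[] h; first by rewrite gt_eqF// ratio_sum_lt.
    by rewrite lt_eqF// ratio_sum_lt.
  by have := dtrace_lenpow_trivial Sa Sb KF KC st s0 r1 tf; rewrite /dtrace => e; rewrite e ltxx in t0.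
split=> //; have [Lim L] := @exists_dilation_invariant_limit R.
exists (dixmier_weight Lim (X := X)); split; first exact: dixmier_weight_singular_trace.
rewrite npow// -[dixmier_weight _ _]/(dtrace (dixmier_weight Lim (X := X)) _).
rewrite (dtrace_lenpowE Sa Sb KF KC d01 ratio1) ltry andbT lte_fin.
exact: (Lim_dix_lenpow_gt0 Sa Sb KF KC d01 ratio1 L).
Qed.

(** [ratio_sum] is strictly decreasing: for s > d it is below 1 and the Ky Fan sums are bounded; for
    s < d it exceeds 1 and they outgrow the logarithm. *)
Lemma nc_hausdorff_dim_dirac : is_nc_hausdorff_dim (dirac_op (K := K)) d.
Proof.
have infX := infinite_index KC.
have nl s : 0 < s -> nnb (lenpow s) by move=> s0; exact: (lenpow_nnb Sa Sb KF KC (ltW s0)).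
have fl s : 0 < s -> finite_levels (lenpow s) by exact: (lenpow_finite_levels Sa Sb KF KC).
have iff s : 0 < s -> L1inf (diag (lenpow s)) <-> bounded_seq (dix (diag (lenpow s))).
  by move=> s0; exact: (L1inf_diag infX (nl s s0) (fl s s0)).
have above s : d < s -> L1inf0 (diag (lenpow s)).
  move=> ds; have s0 := lt_trans d0 ds; have r1 : ratio_sum S s < 1 by rewrite -ratio1 ratio_sum_lt.
  have [B hB] := sigma_lenpow_bounded Sa Sb KF KC s0 r1.
  exact: (L1inf0_diag infX (nl s s0) (fl s s0) hB).
have below s : 0 < s -> s < d -> ~ L1inf (diag (lenpow s)).
  move=> s0 sd /(iff s s0); apply: (dix_lenpow_unbounded Sa Sb KF KC) => //.
  by rewrite -ratio1 ratio_sum_lt.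
split.
  apply: bound_by_exponents => s; last first.
    by move=> ds; have s0 := lt_trans d0 ds; split=> //; rewrite npow//; exact: above.
  move=> [s0]; rewrite npow// => /L1inf0_L1inf h; rewrite leNgt; apply/negP => sd.
  exact: below h.
apply: bound_above_exponents => // s.
  move=> [s0]; rewrite npow// => h; rewrite leNgt; apply/negP => ds; apply: h.
  exact/L1inf0_L1inf/above.
by move=> s0 sd; split=> //; rewrite npow//; exact: below.
Qed.

End Exponents.

Theorem theorem4p15 (R : realType) (K : limit_fractal R) (d : R)
    (selfK : self_similar K) (d01 : 0 < d < 1)
    (dimK : hausdorff_dim (fractal K) = d%:E) :
  [/\ forall s : R, traceability_exponent (dirac_op (K := K)) s <-> s = d,
      forall Lim : (nat -> R) -> R, dilation_invariant_limit Lim ->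
        exists2 c : R, 0 < c &
        forall f : R -> R[i],
          {within fractal K, continuous (f : R -> R[i]^o)} ->
          is_dixmier_trace Lim (rep_op (K := K) f \o abs_npow (dirac_op (K := K)) d)
            (c%:C * hausdorff_integral d (fractal K) f) &
      is_nc_hausdorff_dim (dirac_op (K := K)) d].
Proof.
have [S [Sa Sb KF KC]] := self_similar_system selfK.
(* The dimension hypothesis is turned into Moran's equation, the form in which it is used below. *)
have [|ratio1 d1] := @ratio_sum_hausdorff_dim R S d; first by rewrite -KF.
have d0 : 0 < d by case/andP: d01.
split=> [s|Lim L|].
- exact: (traceability_exponent_dirac Sa Sb KF KC d1 ratio1).
(* The constant is the total trace divided by the total Hausdorff measure. *)
- exists (Lim (dix (diag (@lenpow R K d))) / fine (hausdorff d (tail_fractal S 0))).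
    apply: divr_gt0; first exact: (Lim_dix_lenpow_gt0 Sa Sb KF KC d1 ratio1 L).
    exact: (hausdorff_fractal_fine_gt0 d1 ratio1).
  move=> f; rewrite (abs_npow_dirac Sa Sb KF KC d0) KF => cf.
  exact: (dixmier_trace_rep Sa Sb KF KC d1 ratio1 L cf).
- exact: (nc_hausdorff_dim_dirac Sa Sb KF KC d1 ratio1).
Qed.
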